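(* Let $\Gamma$ be a compact Hausdorff abelian group, let $G$ be a locally compact Hausdorff groupoid with a Haar system $\{\lambda^u\}_{u\in G^{(0)}}$, let $(\Sigma,\iota,\pi)$ be a $\Gamma$-twist over $G$, and let $\chi$ be a character on $\Gamma$. Then there is a $\mathbb{T}$-twist $(\Sigma',\iota',\pi')$ over $G$ such that the full and reduced $\Gamma$-twisted groupoid $C^*$-algebras $\mathcal{C}^*(\Sigma;G;\chi)$ and $\mathcal{C}^*_r(\Sigma;G;\chi)$ are canonically $*$-isomorphic, respectively, to the full and reduced twisted groupoid $C^*$-algebras $\mathcal{C}^*(\Sigma';G;\mathrm{id}_{\mathbb{T}})$ and $\mathcal{C}^*_r(\Sigma';G;\mathrm{id}_{\mathbb{T}})$ of $(\Sigma',\iota',\pi')$.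
   Context: The word ''canonically'' is informal; the assertion is the existence of the $*$-isomorphisms. The usual twisted groupoid $C^*$-algebras of a $\mathbb{T}$-twist are those obtained below with $\Gamma=\mathbb{T}$ and the character $\mathrm{id}_{\mathbb{T}}$. A locally compact Hausdorff groupoid is a topological groupoid (continuous multiplication and inversion) whose topology is locally compact Hausdorff; $G^{(0)}$ is the unit space, $r,s$ the range and source maps, $G^u=r^{-1}(u)$. A character is a continuous homomorphism into the circle group $\mathbb{T}$. $\Gamma$-twist: let $\Gamma$ be a locally compact Hausdorff abelian group with identity $e$, and regard $G^{(0)}\times\Gamma$ as the trivial group bundle with fibres $\Gamma$ (so $(u,\alpha)(u,\beta)=(u,\alpha\beta)$, unit space $G^{(0)}\times\{e\}\equiv G^{(0)}$). A $\Gamma$-twist $(\Sigma,\iota,\pi)$ over $G$ is a locally compact Hausdorff groupoid $\Sigma$ with unit space $\Sigma^{(0)}=\iota(G^{(0)}\times\{e\})$ and maps $\iota:G^{(0)}\times\Gamma\to\Sigma$, $\pi:\Sigma\to G$ such that: (i) $\iota,\pi$ are continuous groupoid homomorphisms, $\iota$ a topological embedding and $\pi$ a quotient map, which restrict to homeomorphisms of unit spaces; one identifies $\Sigma^{(0)}=G^{(0)}$ via $\pi|_{\Sigma^{(0)}}$; (ii) $\iota$ is injective, $\pi$ is surjective and $\iota(G^{(0)}\times\Gamma)=\pi^{-1}(G^{(0)})$; (iii) for all $\sigma\in\Sigma$, $\alpha\in\Gamma$, $\iota(r(\sigma),\alpha)\sigma=\sigma\iota(s(\sigma),\alpha)$ (in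 particular these products are defined). The action of $\Gamma$ on $\Sigma$ is $\alpha\cdot\sigma:=\iota(r(\sigma),\alpha)\sigma$. Haar system on $G$: Radon measures $\lambda^u$ on $G$, $u\in G^{(0)}$, with $\operatorname{supp}\lambda^u=G^u$, with $u\mapsto\int f\,d\lambda^u$ continuous for all $f\in\mathcal{C}_c(G)$, and $\int f(\gamma\eta)\,d\lambda^{s(\gamma)}(\eta)=\int f(\eta)\,d\lambda^{r(\gamma)}(\eta)$ for $\gamma\in G$, $f\in\mathcal{C}_c(G)$. The Haar measure $\lambda$ on a compact group $\Gamma$ is normalised, $\lambda(\Gamma)=1$. With $\mathfrak{s}:G\to\Sigma$ any (not necessarily continuous) section of $\pi$, the induced Haar system on $\Sigma$ consists of the Radon measures $\mu^u$ with $$\int_\Sigma f\,d\mu^u=\int_{G^u}\int_\Gamma f(\alpha\cdot\mathfrak{s}(\gamma))\,d\lambda(\alpha)\,d\lambda^u(\gamma)\quad(f\in\mathcal{C}_c(\Sigma)),$$ and $\mu_u$ is defined by $\int f(\sigma)\,d\mu_u(\sigma)=\int f(\sigma^{-1})\,d\mu^u(\sigma)$; its support is $\Sigma_u=s^{-1}(u)$. $\mathcal{C}_c(\Sigma)$ is a $*$-algebra with $f*g(\sigma)=\int_\Sigma f(\tau)g(\tau^{-1}\sigma)\,d\mu^{r(\sigma)}(\tau)$ and $f^*(\sigma)=\overline{f(\sigma^{-1})}$. For a character $\chi$ of the compact group $\Gamma$, $$\mathcal{C}_c(\Sigma;G;\chi)=\{f\in\mathcal{C}_c(\Sigma): f(\alpha\cdot\sigma)=\chi(\alpha)f(\sigma)\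 \forall\sigma\in\Sigma,\alpha\in\Gamma\},$$ a $*$-subalgebra of $\mathcal{C}_c(\Sigma)$. Put $\|f\|_{I,r}=\sup_u\int|f|\,d\mu^u$, $\|f\|_{I,s}=\sup_u\int|f|\,d\mu_u$, $\|f\|_I=\max\{\|f\|_{I,s},\|f\|_{I,r}\}$. The full norm on $\mathcal{C}_c(\Sigma;G;\chi)$ is $\|f\|=\sup\|L(f)\|$ over all $*$-representations $L$ of $\mathcal{C}_c(\Sigma;G;\chi)$ on Hilbert spaces with $\|L(g)\|\le\|g\|_I$ for all $g\in\mathcal{C}_c(\Sigma;G;\chi)$; the full $\Gamma$-twisted groupoid $C^*$-algebra $\mathcal{C}^*(\Sigma;G;\chi)$ is the completion. For $u\in\Sigma^{(0)}$, $\operatorname{Ind}\delta_u$ is the $I$-norm bounded representation of $\mathcal{C}_c(\Sigma)$ on $L^2(\Sigma_u,\mu_u)$ obtained by extending continuously $\operatorname{Ind}\delta_u(f)(g)=f*g$ ($f,g\in\mathcal{C}_c(\Sigma)$, as functions on $\Sigma_u$). The reduced norm is $\|f\|_r=\sup_{u}\|\operatorname{Ind}\delta_u(f)\|_{\mathcal{B}(L^2(\Sigma_u,\mu_u))}$ and the reduced $\Gamma$-twisted groupoid $C^*$-algebra $\mathcal{C}^*_r(\Sigma;G;\chi)$ is the completion of $\mathcal{C}_c(\Sigma;G;\chi)$ in it. All algebras are formed with the same Haar system $\{\lambda^u\}$ on $G$. *)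

(* Defs.v *)
From HB Require Import structures.
From mathcomp Require Import all_boot all_order all_algebra complex.
From mathcomp Require Import all_classical all_reals all_analysis.
Import numFieldNormedType.Exports.

Set Implicit Arguments.
Unset Strict Implicit.
Unset Printing Implicit Defensive.

Import Order.TTheory GRing.Theory Num.Theory.
Local Open Scope classical_set_scope.
Local Open Scope ring_scope.

(* Groupoids, with objects identified with unit arrows.  The product is a     *)
(* total function whose value matters only on composable pairs, i.e. when     *)
(* gsrc x = grng y.                                                           *)

HB.mixin Record isGroupoid T := {
  grng : T -> T ;
  gsrc : T -> T ;
  ginv : T -> T ;
  gmul : T -> T -> T ;
  grng_rng : forall x, grng (grng x) = grng x ;
  gsrc_rng : forall x, gsrc (grng x) = grng x ;
  grng_src : forall x, grng (gsrc x) = gsrc x ;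
  gsrc_src : forall x, gsrc (gsrc x) = gsrc x ;
  grngM : forall x y, gsrc x = grng y -> grng (gmul x y) = grng x ;
  gsrcM : forall x y, gsrc x = grng y -> gsrc (gmul x y) = gsrc y ;
  gmulA : forall x y z, gsrc x = grng y -> gsrc y = grng z ->
    gmul x (gmul y z) = gmul (gmul x y) z ;
  gmul_rng : forall x, gmul (grng x) x = x ;
  gmul_src : forall x, gmul x (gsrc x) = x ;
  grngV : forall x, grng (ginv x) = gsrc x ;
  gsrcV : forall x, gsrc (ginv x) = grng x ;
  gmulgV : forall x, gmul x (ginv x) = grng x ;
  gmulVg : forall x, gmul (ginv x) x = gsrc x }.

#[short(type="groupoidType")]
HB.structure Definition Groupoid := {T of isGroupoid T}.

HB.mixin Record isTopologicalGroupoid T & Topological T & Groupoid T := {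
  gmul_continuous : {within [set p : T * T | gsrc p.1 = grng p.2],
    continuous (fun p : T * T => gmul p.1 p.2)} ;
  ginv_continuous : continuous (ginv : T -> T) }.

#[short(type="topologicalGroupoidType")]
HB.structure Definition TopologicalGroupoid :=
  {T of Topological T & Groupoid T & isTopologicalGroupoid T}.

Section groupoid_defs.
Variable G : groupoidType.

Definition unit_space : set G := [set u | grng u = u].

Lemma rngU_subproof (x : G) : grng x \in unit_space.
Proof. by rewrite inE /unit_space /= grng_rng. Qed.

Lemma srcU_subproof (x : G) : gsrc x \in unit_space.
Proof. by rewrite inE /unit_space /= grng_src. Qed.

Definition rngU (x : G) : unit_space := exist _ (grng x) (rngU_subproof x).
Definition srcU (x : G) : unit_space := exist _ (gsrc x) (srcU_subproof x).

Definition rfiber (u : G) : set G := [set x | grng x = u].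

End groupoid_defs.
Arguments unit_space : clear implicits.

Definition groupoid_hom (G H : groupoidType) (f : G -> H) : Prop :=
  forall x y, gsrc x = grng y ->
    gsrc (f x) = grng (f y) /\ f (gmul x y) = gmul (f x) (f y).

(* The trivial group bundle G^(0) x Gamma; the abelian group Gamma is written *)
(* additively, as everywhere in the library.                                  *)

Definition trivial_bundle (G : topologicalGroupoidType)
  (Gam : topologicalZmodType) : Type := (unit_space G * Gam)%type.

Section trivial_bundle.
Variables (G : topologicalGroupoidType) (Gam : topologicalZmodType).
Notation TB := (trivial_bundle G Gam).

HB.instance Definition _ := Topological.copy TB (unit_space G * Gam)%type.

Let tb_unit (p : TB) : TB := (p.1, 0).
Let tb_inv (p : TB) : TB := (p.1, - p.2).
Let tb_mul (p q : TB) : TB := (p.1, p.2 + q.2).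

Let tb_mulA (p q t : TB) : tb_unit p = tb_unit q -> tb_unit q = tb_unit t ->
  tb_mul p (tb_mul q t) = tb_mul (tb_mul p q) t.
Proof. by move=> _ _; rewrite /tb_mul /= addrA. Qed.

Let tb_srcM (p q : TB) : tb_unit p = tb_unit q ->
  tb_unit (tb_mul p q) = tb_unit q.
Proof. exact: id. Qed.

Let tb_mul1 (p : TB) : tb_mul (tb_unit p) p = p.
Proof. by case: p => u a; rewrite /tb_mul /= add0r. Qed.

Let tb_mulr1 (p : TB) : tb_mul p (tb_unit p) = p.
Proof. by case: p => u a; rewrite /tb_mul /= addr0. Qed.

Let tb_mulV (p : TB) : tb_mul p (tb_inv p) = tb_unit p.
Proof. by rewrite /tb_mul /= subrr. Qed.

Let tb_mulVl (p : TB) : tb_mul (tb_inv p) p = tb_unit p.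
Proof. by rewrite /tb_mul /= addNr. Qed.

HB.instance Definition _ := @isGroupoid.Build TB
  tb_unit tb_unit tb_inv tb_mul
  (fun _ => erefl) (fun _ => erefl) (fun _ => erefl) (fun _ => erefl)
  (fun _ _ _ => erefl) tb_srcM tb_mulA tb_mul1 tb_mulr1
  (fun _ => erefl) (fun _ => erefl) tb_mulV tb_mulVl.

Let tb_mul_continuous : {within [set p : TB * TB | gsrc p.1 = grng p.2],
  continuous (fun p : TB * TB => gmul p.1 p.2)}.
Proof.
apply: continuous_subspaceT => -[[u a] [v b]].
apply: (@cvg_pair _ _ _ _ (nbhs u) (nbhs (a + b))).
  exact: (cvg_comp _ _ cvg_fst cvg_fst).
have cg : (fun q : TB * TB => (q.1.2, q.2.2)) @ ((u, a), (v, b)) --> (a, b).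
  apply: (@cvg_pair _ _ _ _ (nbhs a) (nbhs b)).
    exact: (cvg_comp _ _ cvg_fst cvg_snd).
  exact: (cvg_comp _ _ cvg_snd cvg_snd).
exact: (cvg_comp _ _ cg (@add_continuous Gam (a, b))).
Qed.

Let tb_inv_continuous : continuous (ginv : TB -> TB).
Proof.
move=> [u a]; apply: (@cvg_pair _ _ _ _ (nbhs u) (nbhs (- a))).
  exact: cvg_fst.
have cs : (fun q : TB => q.2) @ (u, a) --> a by exact: cvg_snd.
exact: (cvg_comp _ _ cs (@opp_continuous Gam a)).
Qed.

HB.instance Definition _ :=
  isTopologicalGroupoid.Build TB tb_mul_continuous tb_inv_continuous.

End trivial_bundle.

Section twist.

Definition top_embedding (X Y : topologicalType) (f : X -> Y) : Prop :=
  injective f /\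
  forall U : set X, open U <-> exists2 V, open V & U = f @^-1` V.

Definition quotient_map (X Y : topologicalType) (f : X -> Y) : Prop :=
  set_surj setT setT f /\ forall U : set Y, open U <-> open (f @^-1` U).

Definition homeomorphism_on (X Y : topologicalType) (A : set X) (B : set Y)
    (f : X -> Y) : Prop :=
  exists g : Y -> X,
    [/\ set_fun A B f /\ set_fun B A g,
        {in A, cancel f g} /\ {in B, cancel g f},
        {within A, continuous f} & {within B, continuous g}].

Variables (G : topologicalGroupoidType) (Gam : topologicalZmodType).
Variables (S : topologicalGroupoidType).
Variables (iota : trivial_bundle G Gam -> S) (p : S -> G).

(* The unit spaces of S and G are identified through p, and                   *)
(* p (grng x) = grng (p x), so iota(r(x), a) reads iota (rngU (p x), a).      *)
Record gamma_twist : Prop := {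
  twist_hausdorff : hausdorff_space S ;
  twist_locally_compact : locally_compact [set: S] ;
  twist_units : unit_space S = iota @` [set q | q.2 = 0] ;
  twist_iota_hom : groupoid_hom iota ;
  twist_iota_continuous : continuous iota ;
  twist_iota_embedding : top_embedding iota ;
  twist_iota_units :
    homeomorphism_on (unit_space (trivial_bundle G Gam)) (unit_space S) iota ;
  twist_p_hom : groupoid_hom p ;
  twist_p_continuous : continuous p ;
  twist_p_quotient : quotient_map p ;
  twist_p_units : homeomorphism_on (unit_space S) (unit_space G) p ;
  twist_iota_inj : injective iota ;
  twist_p_surj : set_surj setT setT p ;
  twist_exact : range iota = p @^-1` unit_space G ;
  twist_central : forall (x : S) (a : Gam),
    [/\ gsrc (iota (rngU (p x), a)) = grng x,
        gsrc x = grng (iota (srcU (p x), a)) &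
        gmul (iota (rngU (p x), a)) x = gmul x (iota (srcU (p x), a))] }.

Definition twist_act (a : Gam) (x : S) : S := gmul (iota (rngU (p x), a)) x.

End twist.

(* The circle group, again written additively: the sum of z and w in          *)
(* [circle R] is the product of the underlying complex numbers.               *)

Definition circle (R : realType) : Type := [set z : R[i]^o | `|z| = 1].

Section circle.
Variable R : realType.
Notation T := (circle R).

HB.instance Definition _ := Topological.copy T [set z : R[i]^o | `|z| = 1].

Definition cval (z : T) : R[i] := set_val z.

Let mk (z : R[i]) (hz : `|z| = 1) : T := exist _ (z : R[i]^o) (mem_set hz).

Let norm_cval (z : T) : `|cval z| = 1.
Proof. exact: (set_valP z). Qed.

Let cval_inj : injective cval.
Proof. exact: val_inj. Qed.

Let zero_subproof : `|1 : R[i]| = 1. Proof. exact: normr1. Qed.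

Let opp_subproof (z : T) : `|(cval z)^-1| = 1.
Proof. by rewrite normfV norm_cval invr1. Qed.

Let add_subproof (z w : T) : `|cval z * cval w| = 1.
Proof. by rewrite normrM !norm_cval mulr1. Qed.

Let czero := mk zero_subproof.
Let copp z := mk (opp_subproof z).
Let cadd z w := mk (add_subproof z w).

Let caddA : associative cadd.
Proof. by move=> x y z; apply: cval_inj; exact: (mulrA (cval x) (cval y) (cval z)). Qed.
Let caddC : commutative cadd.
Proof. by move=> x y; apply: cval_inj; exact: (mulrC (cval x) (cval y)). Qed.
Let cadd0 : left_id czero cadd.
Proof. by move=> x; apply: cval_inj; exact: (mul1r (cval x)). Qed.
Let caddN : left_inverse czero copp cadd.
Proof.
move=> x; apply: cval_inj; apply: (@mulVf _ (cval x)).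
by rewrite -normr_eq0 (norm_cval x) oner_eq0.
Qed.

HB.instance Definition _ :=
  GRing.isZmodule.Build T caddA caddC cadd0 caddN.

Let cval_continuous : continuous (cval : T -> R[i]^o).
Proof. exact: initial_continuous. Qed.

Let cadd_continuous : continuous (fun x : T * T => x.1 + x.2).
Proof.
apply: continuous_comp_initial => -[z w].
have c1 : (fun q : T * T => q.1) @ (z, w) --> z by exact: cvg_fst.
have c2 : (fun q : T * T => q.2) @ (z, w) --> w by exact: cvg_snd.
have cp : (fun q : T * T => (cval q.1 : R[i]^o, cval q.2 : R[i]^o)) @ (z, w)
    --> (cval z : R[i]^o, cval w : R[i]^o).
  apply: (@cvg_pair _ _ _ _ (nbhs (cval z : R[i]^o)) (nbhs (cval w : R[i]^o))).
    exact: (cvg_comp _ _ c1 (@cval_continuous z)).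
  exact: (cvg_comp _ _ c2 (@cval_continuous w)).
exact: (cvg_comp _ _ cp (@mul_continuous _ (cval z, cval w))).
Qed.

Let copp_continuous : continuous (-%R : T -> T).
Proof.
apply: continuous_comp_initial => z.
apply: (@cvg_comp _ _ _ (cval : T -> R[i]^o) (fun a : R[i]^o => a^-1) _ _ _
  (@cval_continuous z)).
by apply: inv_continuous; rewrite -normr_eq0 (norm_cval z) oner_eq0.
Qed.

HB.instance Definition _ :=
  PreTopologicalNmodule_isTopologicalNmodule.Build T cadd_continuous.
HB.instance Definition _ :=
  TopologicalNmodule_isTopologicalZmodule.Build T copp_continuous.

Lemma cvalD (z w : T) : cval (z + w) = cval z * cval w. Proof. by []. Qed.

End circle.
Definition is_character (R : realType) (Gam : topologicalZmodType)
    (chi : Gam -> circle R) : Prop :=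
  {morph chi : a b / a + b} /\ continuous chi.

(* Borel structures and Radon measures.  Measurable types of the library are  *)
(* pointed, hence the base point t, which has no influence on the sigma       *)
(* algebra: this way spaces without a canonical point need not be assumed     *)
(* nonempty.                                                                  *)

Definition with_point (T : choiceType) (t : T) : Type := T.
HB.instance Definition _ (T : choiceType) (t : T) :=
  Choice.copy (with_point t) T.
HB.instance Definition _ (T : choiceType) (t : T) :=
  isPointed.Build (with_point t) t.

Definition borel (T : topologicalType) (t : T) : Type :=
  g_sigma_algebraType (@open T : set (set (with_point t))).
HB.instance Definition _ (T : topologicalType) (t : T) :=
  Measurable.copy (borel t)
    (g_sigma_algebraType (@open T : set (set (with_point t)))).

Notation borel_measure R t := {measure set (borel t) -> \bar R}.

Lemma continuous_borel (T U : topologicalType) (t : T) (u : U) (f : T -> U) :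
  continuous f -> measurable_fun setT (f : borel t -> borel u).
Proof.
move=> /continuousP cf.
apply: (@measurability _ _ (borel t) (borel u) setT f (@open U)) => //.
move=> _ [V oV <-]; rewrite setTI; apply: sub_sigma_algebra; exact: cf.
Qed.

Section integration.
Variable R : realType.
Local Notation C := (R[i]^o).

(* `|x| is an element of R[i]; this is the same number as an element of R. *)
Definition rnorm (V : normedModType R[i]) (x : V) : R := complex.Re `|x|.

(* Suprema of sets of nonnegative quantities, so that sup {} = 0. *)
Definition esup0 (A : set (\bar R)) : \bar R := ereal_sup (0%E |` A).

Definition cintegral d (T : measurableType d) (mu : {measure set T -> \bar R})
    (D : set T) (f : T -> R[i]) : R[i] :=
  Complex (\int[mu]_(x in D) complex.Re (f x))
          (\int[mu]_(x in D) complex.Im (f x)).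

Definition Cc (X : topologicalType) : set (X -> C) :=
  [set f | continuous f /\ compact (closure [set x | f x != 0])].

Record radon (X : topologicalType) (t : X) (mu : borel_measure R t) : Prop := {
  radon_compact : forall K : set X, compact K -> (mu K < +oo)%E ;
  radon_outer : forall B : set (borel t), measurable B ->
    mu B = ereal_inf [set mu U | U in [set U : set X | open U /\ B `<=` U]] ;
  radon_inner : forall U : set X, open U ->
    mu U = ereal_sup [set mu K | K in [set K : set X | compact K /\ K `<=` U]] }.

Definition measure_support (X : topologicalType) (t : X)
    (mu : borel_measure R t) : set X :=
  [set x | forall U : set X, open U -> U x -> (0 < mu U)%E].

Record normalised_haar (Gam : topologicalZmodType)
    (lam : borel_measure R (0 : Gam)) : Prop := {
  haar_radon : radon lam ;
  haar_total : lam setT = 1%E ;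
  haar_invariant : forall (a : Gam) (B : set (borel (0 : Gam))), measurable B ->
    lam ([set a + x | x in (B : set Gam)]) = lam B }.

Definition measure_family (G : topologicalGroupoidType) :=
  forall u : unit_space G, borel_measure R (\val u).

Record haar_system (G : topologicalGroupoidType) (lambda : measure_family G) :
    Prop := {
  haar_system_radon : forall u, radon (lambda u) ;
  haar_system_support : forall u, measure_support (lambda u) = rfiber (\val u) ;
  haar_system_continuous : forall f : G -> C, Cc f ->
    continuous (fun u : unit_space G => cintegral (lambda u) setT f : C) ;
  haar_system_invariant : forall (g : G) (f : G -> C), Cc f ->
    cintegral (lambda (srcU g)) (rfiber (gsrc g)) (fun h => f (gmul g h)) =
    cintegral (lambda (rngU g)) (rfiber (grng g)) f }.

Section twisted_algebra.
Variables (G : topologicalGroupoidType) (Gam : topologicalZmodType).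
Variables (S : topologicalGroupoidType).
Variables (iota : trivial_bundle G Gam -> S) (p : S -> G).

(* mu is the Haar system on S induced by the Haar system lambda on G and the  *)
(* Haar measure lam of Gam; s is an arbitrary section of p.                   *)
Definition induced_haar_system (lam : borel_measure R (0 : Gam))
    (lambda : measure_family G) (mu : measure_family S) : Prop :=
  forall u : unit_space S, radon (mu u) /\
    forall (s : G -> S), cancel s p -> forall f : S -> C, Cc f ->
      cintegral (mu u) setT f =
      cintegral (lambda (rngU (p (\val u)))) (rfiber (p (\val u)))
        (fun g => cintegral lam setT (fun a => f (twist_act iota p a (s g)))).

Definition Cc_twist (chi : Gam -> circle R) : set (S -> C) :=
  [set f | Cc f /\
    forall a x, f (twist_act iota p a x) = cval (chi a) * f x].

End twisted_algebra.

Section groupoid_algebra.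
Variables (S : topologicalGroupoidType) (mu : measure_family S).

Lemma ginv_measurable (u : S) :
  measurable_fun setT (ginv : borel u -> borel u).
Proof. exact: (@continuous_borel _ _ u u _ (@ginv_continuous S)). Qed.

(* mu_u, the image of mu^u under inversion *)
Definition mu_src (u : unit_space S) : borel_measure R (\val u) :=
  measure_function_pushforward__canonical__measure_function_Measure
    (mu u) (ginv_measurable (u := \val u)).

Definition conv (f g : S -> C) : S -> C := fun x =>
  cintegral (mu (rngU x)) (rfiber (grng x))
    (fun y => f y * g (gmul (ginv y) x)).

Definition gstar (f : S -> C) : S -> C := fun x => conjc (f (ginv x)).

Definition I_norm (f : S -> C) : \bar R :=
  maxe (esup0 [set \int[mu_src u]_x (rnorm (f x))%:E | u in setT])%E
       (esup0 [set \int[mu u]_x (rnorm (f x))%:E | u in setT])%E.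

(* L^2(S_u, mu_u), as square-integrable functions on S up to equality mu_u    *)
(* almost everywhere; mu_u is concentrated on S_u.                            *)
Definition L2norm (u : unit_space S) (h : S -> C) : \bar R :=
  Lnorm (mu_src u) 2%:E (fun x : borel (\val u) => (rnorm (h x))%:E).

Definition L2 (u : unit_space S) : set (S -> C) :=
  [set h | [/\ measurable_fun setT
                 (fun x : borel (\val u) => complex.Re (h x)),
               measurable_fun setT
                 (fun x : borel (\val u) => complex.Im (h x)) &
               (L2norm u h < +oo)%E]].

Definition L2eq (u : unit_space S) (h k : S -> C) : Prop :=
  {ae mu_src u, forall x, h x = k x}.

(* The action of an operator on L^2(S_u, mu_u) on representatives; linearity  *)
(* and boundedness make it compatible with equality almost everywhere.        *)
Definition L2_operator (u : unit_space S) (T : (S -> C) -> (S -> C)) : Prop :=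
  [/\ forall h, L2 u h -> L2 u (T h),
      forall (a : C) h k, L2 u h -> L2 u k ->
        L2eq u (T (fun x => a * h x + k x)) (fun x => a * T h x + T k x) &
      exists M : R, forall h, L2 u h -> (L2norm u (T h) <= M%:E * L2norm u h)%E].

Definition L2_opnorm (u : unit_space S) (T : (S -> C) -> (S -> C)) : \bar R :=
  ereal_sup [set L2norm u (T h) | h in [set h | L2 u h /\ (L2norm u h <= 1)%E]].

(* T is Ind delta_u (f). *)
Definition Ind_delta (u : unit_space S) (f : S -> C)
    (T : (S -> C) -> (S -> C)) : Prop :=
  L2_operator u T /\ forall g, Cc g -> L2eq u (T g) (conv f g).

Definition reduced_norm (f : S -> C) : \bar R :=
  esup0 [set e | exists u T, Ind_delta u f T /\ e = L2_opnorm u T].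

End groupoid_algebra.

Record hilbert_space := HilbertSpace {
  hilbert_car :> completeNormedModType R[i] ;
  inner : hilbert_car -> hilbert_car -> R[i] ;
  inner_linear : forall (a : R[i]) x y z,
    inner (a *: x + y) z = a * inner x z + inner y z ;
  inner_conj : forall x y, inner y x = conjc (inner x y) ;
  inner_norm : forall x, inner x x = `|x| ^+ 2 }.

Definition opnorm (H : hilbert_space) (T : H -> H) : \bar R :=
  ereal_sup [set (rnorm (T x))%:E | x in [set x | rnorm x <= 1]].

Record cstar_algebra := CstarAlgebra {
  cstar_car :> completeNormedModType R[i] ;
  cmul : cstar_car -> cstar_car -> cstar_car ;
  cstar : cstar_car -> cstar_car ;
  cmulA : forall x y z, cmul x (cmul y z) = cmul (cmul x y) z ;
  cmul_linearl : forall (a : R[i]) x y z,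
    cmul (a *: x + y) z = a *: cmul x z + cmul y z ;
  cmul_linearr : forall (a : R[i]) x y z,
    cmul x (a *: y + z) = a *: cmul x y + cmul x z ;
  cstar_semilinear : forall (a : R[i]) x y,
    cstar (a *: x + y) = conjc a *: cstar x + cstar y ;
  cstarK : forall x, cstar (cstar x) = x ;
  cstarM : forall x y, cstar (cmul x y) = cmul (cstar y) (cstar x) ;
  cnormM : forall x y, `|cmul x y| <= `|x| * `|y| ;
  cnorm_star : forall x, `|cmul (cstar x) x| = `|x| ^+ 2 }.

Definition star_isomorphic (A B : cstar_algebra) : Prop :=
  exists Phi : A -> B,
    [/\ linear Phi, {morph Phi : x y / cmul x y}, {morph Phi : x / cstar x} &
        bijective Phi].

Section completions.
Variables (S : topologicalGroupoidType) (mu : measure_family S).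
(* V is a star-subalgebra of Cc(S). *)
Variable V : set (S -> C).

Definition star_representation (H : hilbert_space)
    (L : (S -> C) -> (H -> H)) : Prop :=
  [/\ forall f, V f -> linear (L f) /\ continuous (L f),
      forall (a : C) f g x, V f -> V g ->
        L (fun y => a * f y + g y) x = a *: L f x + L g x,
      forall f g x, V f -> V g -> L (conv mu f g) x = L f (L g x) &
      forall f x y, V f -> inner (L (gstar f) x) y = inner x (L f y)].

Definition full_norm (f : S -> C) : \bar R :=
  esup0 [set e | exists (H : hilbert_space) (L : (S -> C) -> (H -> H)),
    [/\ star_representation L,
        forall g, V g -> (opnorm (L g) <= I_norm mu g)%E &
        e = opnorm (L f)]].

(* (A, j) is a completion of the star-algebra V for the C*-norm N. *)
Definition is_completion (N : (S -> C) -> \bar R) (A : cstar_algebra)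
    (j : (S -> C) -> A) : Prop :=
  [/\ forall (a : C) f g, V f -> V g ->
        j (fun y => a * f y + g y) = a *: j f + j g,
      forall f g, V f -> V g -> j (conv mu f g) = cmul (j f) (j g),
      forall f, V f -> j (gstar f) = cstar (j f),
      forall f, V f -> (rnorm (j f))%:E = N f &
      dense (j @` V)].

End completions.

Section twisted_cstar.
Variables (G : topologicalGroupoidType) (Gam : topologicalZmodType).
Variables (S : topologicalGroupoidType).
Variables (iota : trivial_bundle G Gam -> S) (p : S -> G).
Variables (mu : measure_family S) (chi : Gam -> circle R) (A : cstar_algebra).

(* A is a model of C*(S; G; chi), resp. of C*_r(S; G; chi), which are         *)
(* determined up to isomorphism as completions.                               *)
Definition is_full_cstar : Prop := exists j : (S -> C) -> A,
  is_completion mu (Cc_twist iota p chi)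
    (full_norm mu (Cc_twist iota p chi)) j.

Definition is_reduced_cstar : Prop := exists j : (S -> C) -> A,
  is_completion mu (Cc_twist iota p chi) (reduced_norm mu) j.

End twisted_cstar.

End integration.

(* Main.v *)
(* Let S' be the quotient of T x S that identifies (z, a x) with (chi(a) z,
   x), i.e. the pushout of the extension S along chi.  It is a T-twist over
   G, and f' |-> f'([1, -]) is a bijection from the T-equivariant functions
   on S' to the chi-equivariant functions on S, with inverse f |-> ([z, x]
   |-> z f(x)). If f and g are equivariant then |f| and y |-> f(y) g(y^-1 x)
   are constant on the fibres over G, so that their integrals against the
   induced Haar systems are integrals against the Haar system of G, the same
   one for S and S'.  Hence the bijection respects convolution, involution,
   the I-norm and L^2-norms, and full norms agree because representations can
   be transported.  For reduced norms, Ind delta_u (f) is determined by its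
   restriction to Cc(S), and averaging over Gamma is an L^2-contraction of
   Cc(S) onto the equivariant functions that does not change f * g; so the
   operator norm of Ind delta_u (f) is a supremum over equivariant functions. *)

Require Import Defs.
From HB Require Import structures.
From mathcomp Require Import all_boot all_order all_algebra complex generic_quotient.
From mathcomp Require Import all_classical all_reals all_analysis.
From mathcomp Require Import ring lra measurable_realfun.
Import numFieldNormedType.Exports.
Set Implicit Arguments.
Unset Strict Implicit.
Unset Printing Implicit Defensive.
Import Order.TTheory GRing.Theory Num.Theory.
Local Open Scope classical_set_scope.
Local Open Scope ring_scope.

(** The obstacle is that the data determine integrals only of functions in [Cc], while the norms
    involve |f|^2 over whole spaces and convolution has the integrand y |-> f(y) g(y^-1 x),
    meaningful on one range fibre only. The bridge is that the Borel measure lambda^v is the image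
    of mu^u under [p], where v lies under u. It is obtained by comparing Radon measures on open sets
    and then on Borel sets, and rests on compactness of the group, which makes [p] closed and
    proper. Convolutions stay in [Cc] because Tietze's theorem extends integrands off their fibre.

    In the reduced norm, Ind delta_u (f) is a bounded operator on L^2 prescribed only on [Cc].
    Density of [Cc] in L^2 gives its norm, and completeness of L^2 gives its existence whenever
    convolution by f is bounded on [Cc]; so the norms entering the supremum are described by [Cc]
    alone.

    The comparison is made for two twists by arbitrary compact groups, along a homomorphism over G
    that intertwines actions and characters and whose pullback of equivariant functions has an
    inverse. The pushout supplies x |-> [1, x]. *)

Local Notation conv := Defs.conv.

(** * Norms of complex numbers *)

Section rnorm.
Variable R : realType.
Local Notation C := (R[i]^o).
Implicit Types z w : C.

(** In the partial order of [R[i]] a nonnegative element has zero imaginary part, so [rnorm] loses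
    nothing and estimates can be made in the totally ordered field [R]. *)
Lemma rnormC (V : normedModType R[i]) (x : V) : (rnorm x)%:C%C = `|x|.
Proof.
rewrite /rnorm; have : 0 <= `|x| by [].
by case: (`|x|) => a b; rewrite lecE /= => /andP[/eqP -> _].
Qed.

Lemma rnorm_lt (V : normedModType R[i]) (x : V) (e : R) :
  (`|x| < e%:C%C) = (rnorm x < e).
Proof. by rewrite -rnormC ltcR. Qed.

Lemma rnorm_ge0 (V : normedModType R[i]) (x : V) : 0 <= rnorm x.
Proof. by rewrite -[0 <= _]lecR rnormC normr_ge0. Qed.

Lemma rnorm0 (V : normedModType R[i]) : rnorm (0 : V) = 0.
Proof. by rewrite /rnorm normr0. Qed.

Lemma rnorm_eq0 (V : normedModType R[i]) (x : V) : (rnorm x == 0) = (x == 0).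
Proof. by rewrite -(inj_eq (@complexI R)) rnormC normr_eq0. Qed.

Lemma rnormD (V : normedModType R[i]) (x y : V) : rnorm (x + y) <= rnorm x + rnorm y.
Proof. by rewrite -lecR rmorphD/= !rnormC ler_normD. Qed.

Lemma rnormN (V : normedModType R[i]) (x : V) : rnorm (- x) = rnorm x.
Proof. by rewrite /rnorm normrN. Qed.

Lemma rnormZ (V : normedModType R[i]) (a : R[i]) (x : V) :
  rnorm (a *: x) = rnorm (a : C) * rnorm x.
Proof. by apply: (@complexI R); rewrite rmorphM/= !rnormC normrZ. Qed.

Lemma rnormM z w : rnorm (z * w : C) = rnorm z * rnorm w.
Proof. by apply: (@complexI R); rewrite rmorphM/= !rnormC normrM. Qed.

Lemma rnormB (V : normedModType R[i]) (x y : V) : rnorm (x - y) = rnorm (y - x).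
Proof. by rewrite /rnorm distrC. Qed.

Lemma rnormE z : rnorm z = Num.sqrt (complex.Re z ^+ 2 + complex.Im z ^+ 2).
Proof. by rewrite /rnorm; have -> : `|z| = `|(z : R[i])| by []; rewrite normc_def. Qed.

Lemma rnorm_Re z : `|complex.Re z| <= rnorm z.
Proof.
by rewrite rnormE -sqrtr_sqr ler_wsqrtr// lerDl sqr_ge0.
Qed.

Lemma rnorm_Im z : `|complex.Im z| <= rnorm z.
Proof.
by rewrite rnormE -sqrtr_sqr ler_wsqrtr// lerDr sqr_ge0.
Qed.

Lemma rnorm_real (a : R) : rnorm (a%:C%C : C) = `|a|.
Proof. by rewrite rnormE/= expr0n/= addr0 sqrtr_sqr. Qed.

Lemma rnorm_conj z : rnorm (conjc z : C) = rnorm z.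
Proof. by case: z => a b; rewrite !rnormE /= sqrrN. Qed.

Lemma rnorm_sqr z : rnorm z ^+ 2 = complex.Re z ^+ 2 + complex.Im z ^+ 2.
Proof. by rewrite rnormE sqr_sqrtr// addr_ge0 ?sqr_ge0. Qed.

Lemma rnorm_le_ReIm z : rnorm z <= `|complex.Re z| + `|complex.Im z|.
Proof.
rewrite -(@ler_pXn2r _ 2)// ?nnegrE ?rnorm_ge0 ?addr_ge0// rnorm_sqr.
rewrite -(real_normK (num_real (complex.Re z))) -(real_normK (num_real (complex.Im z))).
have := normr_ge0 (complex.Re z); have := normr_ge0 (complex.Im z); nra.
Qed.

Lemma ReB z w : complex.Re (z - w) = complex.Re z - complex.Re w.
Proof. by case: z w => ? ? []. Qed.

Lemma ImB z w : complex.Im (z - w) = complex.Im z - complex.Im w.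
Proof. by case: z w => ? ? []. Qed.

Lemma cplx_gt0 (e : R[i]) : 0 < e -> exists2 r : R, 0 < r & e = r%:C%C.
Proof.
by case: e => a b; rewrite ltcE/= => /andP[/eqP -> a0]; exists a.
Qed.

(** Balls of a normed module over [R[i]] have radii in [R[i]]; a positive radius is real, so real
    radii suffice. *)
Lemma nbhs_rnorm (V : normedModType R[i]) (x : V) (P : set V) :
  nbhs x P <-> exists2 e : R, 0 < e & forall y, rnorm (y - x) < e -> P y.
Proof.
split=> [/nbhs_ballP[e /= e0 xP]|[e e0 xP]].
  have [r r0 er] := cplx_gt0 e0; exists r => // y yx; apply: xP.
  by rewrite -ball_normE/= distrC er rnorm_lt.
apply/nbhs_ballP; exists e%:C%C => /=; first by rewrite ltcR.
by move=> y; rewrite -ball_normE/= distrC rnorm_lt; exact: xP.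
Qed.

Lemma cvg_rnormP (V : normedModType R[i]) (T : Type) (F : set_system T) (FF : Filter F) (f : T -> V) (l : V) :
  f @ F --> l <-> forall e : R, 0 < e -> \forall x \near F, rnorm (f x - l) < e.
Proof.
split=> [fl e e0|H P /nbhs_rnorm[e e0 lP]].
  have : nbhs l [set y | rnorm (y - l) < e] by apply/nbhs_rnorm; exists e.
  exact: fl.
by near=> x; apply: lP; near: x; exact: H.
Unshelve. all: end_near. Qed.

Lemma cvg_realP (T : Type) (F : set_system T) (FF : Filter F) (f : T -> R) (l : R) :
  f @ F --> l <-> forall e : R, 0 < e -> \forall x \near F, `|l - f x| < e.
Proof. exact: (@cvgrPdist_lt R R). Qed.

Lemma Re_continuous : continuous (@complex.Re R : C -> R).
Proof.
move=> z; apply/(@cvg_realP _ (nbhs z)) => e e0.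
have : nbhs z [set y : C | rnorm (y - z) < e] by apply/nbhs_rnorm; exists e.
apply: filterS => w /=; apply: le_lt_trans; rewrite rnormB.
have -> : complex.Re z - complex.Re w = complex.Re (z - w) by case: z w => ? ? [].
exact: rnorm_Re.
Qed.

Lemma Im_continuous : continuous (@complex.Im R : C -> R).
Proof.
move=> z; apply/(@cvg_realP _ (nbhs z)) => e e0.
have : nbhs z [set y : C | rnorm (y - z) < e] by apply/nbhs_rnorm; exists e.
apply: filterS => w /=; apply: le_lt_trans; rewrite rnormB.
have -> : complex.Im z - complex.Im w = complex.Im (z - w) by case: z w => ? ? [].
exact: rnorm_Im.
Qed.

Lemma rnorm_continuous (V : normedModType R[i]) : continuous (@rnorm R V).
Proof.
move=> z; apply/(@cvg_realP _ (nbhs z)) => e e0.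
have : nbhs z [set y : V | rnorm (y - z) < e] by apply/nbhs_rnorm; exists e.
apply: filterS => w /=; apply: le_lt_trans.
have H1 := rnormD (z - w) w; have H2 := rnormD (w - z) z.
rewrite !subrK in H1 H2; rewrite (rnormB z w) in H1.
rewrite ler_norml; apply/andP; split; lra.
Qed.

Lemma cvg_ReIm (T : Type) (F : set_system T) (FF : Filter F) (f : T -> C) (l : C) :
  (fun x => complex.Re (f x)) @ F --> complex.Re l ->
  (fun x => complex.Im (f x)) @ F --> complex.Im l -> f @ F --> l.
Proof.
move=> /cvg_realP fr /cvg_realP fi.
apply/cvg_rnormP => e e0; near=> x.
rewrite rnormB; apply: le_lt_trans (rnorm_le_ReIm _) _.
rewrite (splitr e) ltrD//.
  by rewrite ReB; near: x; apply: fr; rewrite divr_gt0.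
by rewrite ImB; near: x; apply: fi; rewrite divr_gt0.
Unshelve. all: end_near. Qed.

Lemma continuous_ReIm (X : topologicalType) (f : X -> C) :
  continuous (fun x => complex.Re (f x)) ->
  continuous (fun x => complex.Im (f x)) -> continuous f.
Proof. by move=> fr fi x; apply: cvg_ReIm; [exact: fr|exact: fi]. Qed.

Lemma conjc_continuous : continuous (@conjc R : C -> C).
Proof.
move=> z; apply/(@cvg_rnormP C _ (nbhs z)) => e e0.
have : nbhs z [set y : C | rnorm (y - z) < e] by apply/nbhs_rnorm; exists e.
apply: filterS => w /=.
by rewrite -(rnorm_conj (w - z)) (raddfB (@conjc R)).
Qed.

End rnorm.

Lemma continuous_image_compact (X Y : topologicalType) (f : X -> Y) (K : set X) :
  continuous f -> compact K -> compact (f @` K).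
Proof. by move=> cf cK; apply: continuous_compact => //; exact: continuous_subspaceT. Qed.

(** * Compactly supported functions *)

Section locally_compact_hausdorff.
Variables (R : realType) (X : topologicalType).
Local Notation C := (R[i]^o).
Local Notation opc := (one_point_compactification X).

(** The tube lemma. It is the source of all uniform estimates below, over supports of functions and
    over the compact group. *)
Lemma compact_near_uniform (Y : topologicalType) (K : set X) (y : Y)
    (P : X -> Y -> Prop) : compact K ->
  (forall x, K x -> \forall x' \near x & y' \near y, K x' -> P x' y') ->
  \forall y' \near y, forall x, K x -> P x y'.
Proof.
move=> /compact_near_coveringP/near_covering_withinP cK H.
exact: (cK Y (nbhs y) (fun y' x => P x y') _ H).
Qed.

Lemma compact_rnorm_bounded (K : set X) (f : X -> C) : compact K ->
  {within K, continuous f} -> exists2 M : R, 0 < M & forall x, K x -> rnorm (f x) <= M.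
Proof.
move=> cK cf.
have /compact_bounded[M [_ HM]] : compact ((fun x => rnorm (f x)) @` K).
  apply: continuous_compact => //; apply/subspace_continuousP => x Kx.
  move/subspace_continuousP: cf => /(_ x Kx) cf.
  exact: (cvg_comp _ _ cf (@rnorm_continuous R C (f x))).
exists (`|M| + 1); first by rewrite ltr_wpDl.
move=> x Kx; apply: le_trans (ler_norm _) _.
apply: (HM (`|M| + 1)); first by rewrite (le_lt_trans (ler_norm M))// ltrDl.
by exists x.
Qed.

Hypothesis hX : hausdorff_space X.

Lemma Cc_compact_support (f : X -> C) (K : set X) : continuous f -> compact K ->
  (forall x, ~ K x -> f x = 0) -> Cc f.
Proof.
move=> cf cK fK; split=> //; apply: (subclosed_compact _ cK); first exact: closed_closure.
have cl : closed K by exact: compact_closed.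
rewrite (closure_id K).1//; apply: closureS => x /= /eqP fx.
by apply: contrapT => /fK.
Qed.

Hypothesis lX : locally_compact [set: X].

(** A locally compact Hausdorff space need not be normal; Urysohn and Tietze are applied in its
    one-point compactification and restricted. *)
Lemma opc_normal : normal_space opc.
Proof.
apply: compact_normal; first exact: one_point_compactification_hausdorff.
exact: one_point_compactification_compact.
Qed.

Lemma opc_compact_preimage (K : set opc) : compact K -> ~ K None ->
  compact (Some @^-1` K).
Proof.
move=> cK KN; apply/compact_near_coveringP => I F P FF H.
(* The condition is extended to infinity by a trivial one; as [K] misses that point, covering [K] in
   the compactification amounts to covering its trace on [X]. *)
move/compact_near_coveringP: cK => /(_ I F (fun i z => if z is Some x then P i x else True) FF) cK.
have {}cK : \near F, K `<=` (fun z => if z is Some x then P F x else True).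
  apply: cK => -[x|//] Kx; have [[U V] [/= xU FV] UV] := H x Kx.
  exists (Some @` U, V); first by split => //=; exact: one_point_compactification_some_nbhs.
  by move=> [_ i] /= [[y Uy <-] Vi]; exact: (UV (y, i)).
apply: filterS cK => i Ki x Kx; exact: (Ki (Some x) Kx).
Qed.

Lemma opc_closed (K : set X) : compact K -> closed (Some @` K : set opc).
Proof.
move=> cK; apply: compact_closed; first exact: one_point_compactification_hausdorff.
apply: continuous_compact => //; apply: continuous_subspaceT => x.
exact: one_point_compactification_some_continuous.
Qed.

Lemma urysohn_compact (K U : set X) : compact K -> open U -> K `<=` U ->
  exists (g : X -> R) (L : set X), [/\ continuous g, compact L, L `<=` U,
    forall x, 0 <= g x <= 1 & (forall x, K x -> g x = 1) /\ (forall x, ~ L x -> g x = 0)].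
Proof.
move=> cK oU KU.
have /(@uniform_separatorP opc R)[f [cf f01 f0 f1]] :
    uniform_separator (Some @` K : set opc) (~` (Some @` U)).
  apply: ((@normal_separatorP R opc).1 opc_normal).
  - exact: opc_closed.
  - by apply: open_closedC; exact: one_point_compactification_open_some.
  - by rewrite -subset0 => _ [[x Kx <-]] /=; apply; exists x => //; exact: KU.
have fb z : 0 <= f z <= 1.
  by have := f01 (f z) (ex_intro2 _ _ z I erefl); rewrite /= in_itv.
(* [f] is 0 on [K] and 1 outside [U], in particular at infinity. Doubling before truncation makes
   the bump vanish as soon as [f] exceeds 1/2, so it lives on a closed set that avoids infinity and
   is therefore compact in [X]. *)
pose L := Some @^-1` [set z : opc | f z <= 1/2].
exists (fun x => Num.max 0 (1 - 2 * f (Some x))), L; split.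
- apply: (@max_fun_continuous _ X R (fun=> 0) (fun x => 1 - 2 * f (Some x))).
    by move=> x; exact: cvg_cst.
  move=> x; apply: (@cvgB R R); first exact: cvg_cst.
  apply: (@cvgM R); first exact: cvg_cst.
  apply: (continuous_comp (@one_point_compactification_some_continuous X x)).
  exact: cf.
- apply: opc_compact_preimage.
    apply: (subclosed_compact _ (@one_point_compactification_compact X)) => //.
    exact: (@closed_comp _ _ f [set y | y <= 1/2] (fun z _ => cf z) (@closed_le R _)).
  have /f1 /= -> : (f @` (~` (Some @` U))) (f None) by exists None => // -[].
  by apply/negP; rewrite -ltNge; lra.
- move=> x; rewrite /L /= => fx; apply: contrapT => nUx.
  have /f1 /= fx1 : (f @` (~` (Some @` U))) (f (Some x)).
    by exists (Some x) => // -[y Uy [yx]]; apply: nUx; rewrite -yx.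
  by move: fx; rewrite fx1; lra.
- by move=> x; have := fb (Some x); rewrite le_max lexx/= ge_max; lra.
split=> x.
  move=> Kx; have /f0 /= -> : (f @` (Some @` K)) (f (Some x)).
    by exists (Some x) => //; exists x.
  by rewrite mulr0 subr0 max_r.
rewrite /L /= => /negP; rewrite -ltNge => fx; apply: max_l.
lra.
Qed.

Lemma tietze_compact (K : set X) (h : X -> C) : compact K ->
  {within K, continuous h} -> exists2 H : X -> C, continuous H & forall x, K x -> H x = h x.
Proof.
move=> cK ch.
have ext (r : X -> R) : {within K, continuous r} ->
    exists2 H : X -> R, continuous H & forall x, K x -> H x = r x.
  move=> cr.
  have /compact_bounded[M [_ HM]] : compact (r @` K) by exact: continuous_compact.
  pose M' := `|M| + 1.
  have M'0 : 0 < M' by rewrite ltr_wpDl.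
  (* The value at infinity is arbitrary: continuity and the bound are claimed only on the image of
     [K]. *)
  pose r' (z : opc) := if z is Some x then r x else 0.
  have cr' : {within (Some @` K : set opc), continuous (r' : opc -> R^o)}.
    apply/subspace_continuousP => _ [x Kx <-].
    move/subspace_continuousP: cr => /(_ x Kx) cr W /cr xW.
    have {}xW : nbhs x [set y | K y -> W (r y)] := xW.
    suff : nbhs x [set y | (Some @` K : set opc) (Some y) -> W (r y)] by [].
    by apply: filterS xW => y /= yW [y' Ky' [yy']]; apply: yW; rewrite -yy'.
  have br' z : (Some @` K : set opc) z -> `|r' z| <= M'.
    move=> [x Kx <-] /=; apply: (HM M'); last by exists x.
    by rewrite (le_lt_trans (ler_norm M))// ltrDl.
  have [H [Hr cH _]] := continuous_bounded_extension opc_normal (opc_closed cK) M'0 cr' br'.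
  exists (H \o Some).
    move=> x; apply: (continuous_comp (@one_point_compactification_some_continuous X x)).
    exact: cH.
  by move=> x Kx /=; rewrite -Hr// inE; exists x.
have [|HR cR eR] := ext (fun x => complex.Re (h x)).
  apply/subspace_continuousP => x Kx; move/subspace_continuousP: ch => /(_ x Kx) ch.
  exact: (cvg_comp _ _ ch (@Re_continuous R (h x))).
have [|HI cI eI] := ext (fun x => complex.Im (h x)).
  apply/subspace_continuousP => x Kx; move/subspace_continuousP: ch => /(_ x Kx) ch.
  exact: (cvg_comp _ _ ch (@Im_continuous R (h x))).
exists (fun x => Complex (HR x) (HI x)); first exact: continuous_ReIm.
by move=> x Kx; rewrite eR// eI//; case: (h x).
Qed.

End locally_compact_hausdorff.

(** * Topological groupoids *)

Section groupoid_algebra_facts.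
Variable S : groupoidType.
Implicit Types x y z u : S.

Lemma gmulKV x y : gsrc x = grng y -> gmul (ginv x) (gmul x y) = y.
Proof. by move=> xy; rewrite gmulA ?gsrcV// gmulVg xy gmul_rng. Qed.

Lemma gmulVK x y : grng x = grng y -> gmul x (gmul (ginv x) y) = y.
Proof. by move=> xy; rewrite gmulA ?gsrcV ?grngV// gmulgV xy gmul_rng. Qed.

Lemma ginvK : involutive (ginv : S -> S).
Proof.
move=> x; rewrite -[LHS]gmul_src gsrcV grngV -gmulVg gmulA ?gsrcV ?grngV//.
by rewrite gmulVg gsrcV gmul_rng.
Qed.

Lemma gmulI x y z : gsrc x = grng y -> gsrc x = grng z ->
  gmul x y = gmul x z -> y = z.
Proof. by move=> xy xz e; rewrite -(gmulKV xy) e gmulKV. Qed.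

Lemma unit_idem x : gsrc x = grng x -> gmul x x = x -> grng x = x.
Proof. by move=> sr e; apply: (@gmulI x); rewrite ?grng_rng// e -sr gmul_src. Qed.

Lemma unit_src u : grng u = u -> gsrc u = u.
Proof. by move=> <-; rewrite gsrc_rng. Qed.

End groupoid_algebra_facts.

Section groupoid_hom_facts.
Variables (S T : groupoidType) (f : S -> T).
Hypothesis hf : groupoid_hom f.

(** A homomorphism is only asked to respect products. The image of a unit is idempotent, and
    cancellation shows that an idempotent is a unit. *)
Lemma hom_rng x : f (grng x) = grng (f x).
Proof.
have [c e] : gsrc (f (grng x)) = grng (f x) /\ f (gmul (grng x) x) = gmul (f (grng x)) (f x).
  by apply: hf; rewrite gsrc_rng.
have [c' e'] : gsrc (f (grng x)) = grng (f (grng x)) /\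
    f (gmul (grng x) (grng x)) = gmul (f (grng x)) (f (grng x)).
  by apply: hf; rewrite gsrc_rng grng_rng.
have ee : gmul (grng x) (grng x) = grng x by rewrite -{1}(grng_rng x) gmul_rng.
rewrite ee in e'.
have eu : grng (f (grng x)) = f (grng x) by apply: unit_idem.
by rewrite -c unit_src.
Qed.

Lemma hom_src x : f (gsrc x) = gsrc (f x).
Proof.
have [c _] : gsrc (f x) = grng (f (gsrc x)) /\ f (gmul x (gsrc x)) = gmul (f x) (f (gsrc x)).
  by apply: hf; rewrite grng_src.
by rewrite c -hom_rng grng_src.
Qed.

Lemma hom_inv x : f (ginv x) = ginv (f x).
Proof.
have [c e] : gsrc (f x) = grng (f (ginv x)) /\ f (gmul x (ginv x)) = gmul (f x) (f (ginv x)).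
  by apply: hf; rewrite grngV.
apply: (@gmulI _ (f x)) => //; first by rewrite grngV.
by rewrite -e !gmulgV hom_rng.
Qed.

Lemma hom_mul x y : gsrc x = grng y -> f (gmul x y) = gmul (f x) (f y).
Proof. by move=> /hf[]. Qed.

End groupoid_hom_facts.

Lemma eq_closed (X Y : topologicalType) (f g : X -> Y) : hausdorff_space Y ->
  continuous f -> continuous g -> closed [set x | f x = g x].
Proof.
move=> hY cf cg x clx; apply: (hY) => U V fU gV.
have fUx : nbhs x (f @^-1` U) := cf x _ fU.
have gVx : nbhs x (g @^-1` V) := cg x _ gV.
have [y [/= e [Uy Vy]]] := clx _ (filterI fUx gVx).
by exists (f y); split => //; rewrite e.
Qed.

Section topological_groupoid_facts.
Variable S : topologicalGroupoidType.

Lemma cvg_gmul (T : Type) (F : set_system T) (FF : Filter F) (f g : T -> S) a b :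
  gsrc a = grng b -> f @ F --> a -> g @ F --> b ->
  (\forall t \near F, gsrc (f t) = grng (g t)) ->
  (fun t => gmul (f t) (g t)) @ F --> gmul a b.
Proof.
move=> ab fa gb fg.
have /subspace_continuousP /(_ (a, b) ab) H := @gmul_continuous S.
have fgab : (fun t => (f t, g t)) @ F --> within [set p : S * S | gsrc p.1 = grng p.2] (nbhs (a, b)).
  move=> W /= Wab.
  have H2 : (fun t => (f t, g t)) @ F --> (a, b) by exact: cvg_pair.
  have {}Wab := H2 _ Wab.
  by apply: filterS2 fg Wab => t /= fgt; apply.
exact: (cvg_comp _ _ fgab H).
Qed.

Lemma grng_continuous : continuous (grng : S -> S).
Proof.
rewrite (_ : grng = (fun x : S => gmul x (ginv x))); last by apply/funext => y; rewrite gmulgV.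
move=> x.
apply: cvg_gmul; [by rewrite grngV|exact: cvg_id|exact: ginv_continuous|].
by apply: nearW => y; rewrite grngV.
Qed.

Lemma gsrc_continuous : continuous (gsrc : S -> S).
Proof.
rewrite (_ : gsrc = (fun x : S => gmul (ginv x) x)); last by apply/funext => y; rewrite gmulVg.
move=> x.
apply: cvg_gmul; [by rewrite gsrcV|exact: ginv_continuous|exact: cvg_id|].
by apply: nearW => y; rewrite gsrcV.
Qed.

Lemma rngU_continuous : continuous (@rngU S).
Proof. by apply: continuous_comp_initial => x; exact: grng_continuous. Qed.

Lemma rngU_unit (u : unit_space S) : rngU (\val u) = u.
Proof. by apply: val_inj => /=; exact: (set_valP u). Qed.

Lemma unitUP (u : unit_space S) : grng (\val u) = \val u.
Proof. exact: (set_valP u). Qed.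

Hypothesis hS : hausdorff_space S.

Lemma rfiber_closed (u : S) : closed (rfiber u).
Proof.
apply: eq_closed => //; first exact: grng_continuous.
by move=> x; exact: cvg_cst.
Qed.

Lemma compact_ginv (K : set S) : compact K -> compact (ginv @^-1` K).
Proof.
move=> cK; rewrite (_ : _ @^-1` _ = ginv @` K).
  by apply: continuous_image_compact => //; exact: ginv_continuous.
apply/seteqP; split => x /=; last by move=> [y Ky <-]; rewrite ginvK.
by move=> Kx; exists (ginv x) => //; rewrite ginvK.
Qed.

(** The composable pairs are closed in the product of [K] and [L]. This set will contain the support
    of a convolution. *)
Lemma compact_gmul (K L : set S) : compact K -> compact L ->
  compact [set z | exists x y, [/\ K x, L y, gsrc x = grng y & z = gmul x y]].
Proof.
move=> cK cL; set A := [set z | _].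
pose D := (K `*` L) `&` [set p : S * S | gsrc p.1 = grng p.2].
have -> : A = (fun p : S * S => gmul p.1 p.2) @` D.
  apply/seteqP; split=> z /=.
    by move=> [x [y [Kx Ly xy ->]]]; exists (x, y).
  by move=> [[x y] [[Kx Ly] xy] <-]; exists x, y.
apply: continuous_compact.
  apply: continuous_subspaceW (@gmul_continuous S).
  by move=> p [].
apply: compact_closedI; first exact: compact_setX.
apply: eq_closed => // p.
  by apply: (@continuous_comp _ _ _ fst); [exact: cvg_fst|exact: gsrc_continuous].
by apply: (@continuous_comp _ _ _ snd); [exact: cvg_snd|exact: grng_continuous].
Qed.

End topological_groupoid_facts.

(** * Twists *)

Section twist_facts.
Variables (G : topologicalGroupoidType) (Gam : topologicalZmodType).
Variables (S : topologicalGroupoidType).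
Variables (iota : trivial_bundle G Gam -> S) (p : S -> G).
Hypothesis tw : gamma_twist iota p.
Implicit Types (x y : S) (a b : Gam).

Local Notation act := (twist_act iota p).
Let ph := twist_p_hom tw.
Let ih := twist_iota_hom tw.

Lemma twist_p_unit_inj x y : grng x = x -> grng y = y -> p x = p y -> x = y.
Proof.
have [g [_ [fg _] _ _]] := twist_p_units tw.
by move=> xu yu xy; rewrite -(fg x) ?inE// xy fg// inE.
Qed.

Lemma twist_eq_rng x y : p x = p y -> grng x = grng y.
Proof.
move=> xy; apply: twist_p_unit_inj; rewrite ?grng_rng//.
by rewrite !(hom_rng ph) xy.
Qed.

Lemma twist_eq_src x y : p x = p y -> gsrc x = gsrc y.
Proof.
move=> xy; apply: twist_p_unit_inj; rewrite ?grng_src//.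
by rewrite !(hom_src ph) xy.
Qed.

Lemma twist_section : exists s : G -> S, cancel s p.
Proof.
have H g : exists x, p x = g by have [x _ <-] := @twist_p_surj _ _ _ _ _ tw g I; exists x.
by have [s sp] := choice H; exists s.
Qed.

Lemma twist_iota_unit (u : unit_space G) a : grng (iota (u, a)) = iota (u, 0).
Proof. by rewrite -(hom_rng ih). Qed.

Lemma twist_iota_src (u : unit_space G) a : gsrc (iota (u, a)) = iota (u, 0).
Proof. by rewrite -(hom_src ih). Qed.

Lemma twist_iota0 x : iota (rngU (p x), 0) = grng x.
Proof. by have [+ _ _] := twist_central tw x 0; rewrite twist_iota_src. Qed.

(** The axioms do not say which unit lies under [iota (u, a)]. Exactness makes its image a unit, and
    centrality, applied to a point above [u], identifies this unit as [u]. *)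
Lemma twist_p_iota (u : unit_space G) a : p (iota (u, a)) = \val u.
Proof.
have [s sp] := twist_section.
have pu : grng (p (iota (u, a))) = p (iota (u, a)).
  suff : (p @^-1` unit_space G) (iota (u, a)) by [].
  by rewrite -(twist_exact tw); exists (u, a).
rewrite -pu -(hom_rng ph) twist_iota_unit -[in LHS](rngU_unit u).
rewrite -(sp (\val u)) twist_iota0 (hom_rng ph) sp; exact: unitUP.
Qed.

Lemma twist_iotaD (u : unit_space G) a b : iota (u, a + b) = gmul (iota (u, a)) (iota (u, b)).
Proof. by rewrite -(hom_mul ih). Qed.

Lemma twist_iota_act_src x a : gsrc (iota (rngU (p x), a)) = grng x.
Proof. by have [] := twist_central tw x a. Qed.

Lemma twist_iota_act_rng x a : grng (iota (rngU (p x), a)) = grng x.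
Proof. by rewrite twist_iota_unit -(twist_iota_src _ a) twist_iota_act_src. Qed.

Lemma twist_act_rng a x : grng (act a x) = grng x.
Proof. by rewrite /twist_act grngM ?twist_iota_act_src// twist_iota_act_rng. Qed.

Lemma twist_act_src a x : gsrc (act a x) = gsrc x.
Proof. by rewrite /twist_act gsrcM ?twist_iota_act_src. Qed.

Lemma twist_act_p a x : p (act a x) = p x.
Proof.
by rewrite /twist_act (hom_mul ph) ?twist_iota_act_src// twist_p_iota/= gmul_rng.
Qed.

Lemma twist_act0 x : act 0 x = x.
Proof. by rewrite /twist_act twist_iota0 gmul_rng. Qed.

Lemma twist_actD a b x : act (a + b) x = act a (act b x).
Proof.
rewrite {1 2}/twist_act twist_act_p twist_iotaD gmulA//.
  by rewrite twist_iota_act_src twist_iota_act_rng.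
by rewrite twist_iota_act_src.
Qed.

Lemma twist_actK a : cancel (act a) (act (- a)).
Proof. by move=> x; rewrite -twist_actD addNr twist_act0. Qed.

Lemma twist_actNK a : cancel (act (- a)) (act a).
Proof. by move=> x; rewrite -twist_actD subrr twist_act0. Qed.

Lemma twist_actC x a : act a x = gmul x (iota (srcU (p x), a)).
Proof. by have [] := twist_central tw x a. Qed.

Lemma twist_act_mull a x y : gsrc x = grng y -> gmul (act a x) y = act a (gmul x y).
Proof.
move=> xy; rewrite /twist_act -gmulA ?twist_iota_act_src//.
do 3 f_equal; rewrite (hom_mul ph)//; apply: val_inj => /=.
by rewrite grngM// -(hom_rng ph) -(hom_src ph) xy.
Qed.

Lemma twist_act_mulr a x y : gsrc x = grng y -> gmul x (act a y) = act a (gmul x y).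
Proof.
move=> xy; rewrite -twist_act_mull// [act a x]twist_actC.
have -> : iota (srcU (p x), a) = iota (rngU (p y), a).
  by congr (iota (_, _)); apply: val_inj; rewrite /= -(hom_rng ph) -(hom_src ph) xy.
by rewrite -gmulA// ?twist_iota_act_src ?twist_iota_act_rng.
Qed.

Lemma twist_act_inv a x : ginv (act a x) = act (- a) (ginv x).
Proof.
apply: (@gmulI _ (act a x)).
- by rewrite grngV.
- by rewrite twist_act_rng grngV twist_act_src.
rewrite gmulgV twist_act_rng twist_act_mull ?twist_act_rng ?grngV//.
by rewrite twist_act_mulr ?grngV// twist_actNK gmulgV.
Qed.

(** y x^-1 lies over a unit, hence comes from [iota] by exactness: the fibres of [p] are orbits. *)
Lemma twist_fiber x y : p x = p y -> exists a, y = act a x.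
Proof.
move=> xy; have rxy := twist_eq_rng xy; have sxy := twist_eq_src xy.
have pz : p (gmul y (ginv x)) = grng (p x).
  by rewrite (hom_mul ph) ?grngV// (hom_inv ph) xy gmulgV.
have : (p @^-1` unit_space G) (gmul y (ginv x)).
  by rewrite /unit_space /= pz grng_rng.
rewrite -(twist_exact tw) => -[[u a] _ ua]; exists a.
have uE : u = rngU (p x).
  by apply: val_inj; rewrite /= -pz -ua twist_p_iota.
rewrite /twist_act -uE ua -gmulA ?grngV ?gsrcV//.
by rewrite gmulVg sxy gmul_src.
Qed.

Lemma twist_rfiber x : rfiber (grng x) = p @^-1` rfiber (grng (p x)).
Proof.
apply/seteqP; split => y; rewrite /rfiber /=.
  by move=> e; rewrite -!(hom_rng ph) e.
rewrite -!(hom_rng ph) => e; apply: twist_p_unit_inj; rewrite ?grng_rng//.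
Qed.

Lemma twist_act_cvg (T : Type) (F : set_system T) (FF : Filter F) (f : T -> Gam) (g : T -> S) a x :
  f @ F --> a -> g @ F --> x -> (fun t => act (f t) (g t)) @ F --> act a x.
Proof.
move=> fa gx; apply: cvg_gmul => //.
- exact: twist_iota_act_src.
- have H : (fun t => (rngU (p (g t)), f t)) @ F --> (rngU (p x), a).
    apply: (@cvg_pair _ _ _ _ (nbhs (rngU (p x))) (nbhs a)) => //.
    have cx : {for x, continuous (fun y => rngU (p y))}.
      apply: continuous_comp; first exact: (twist_p_continuous tw).
      exact: rngU_continuous.
    exact: (cvg_comp _ _ gx cx).
  exact: (cvg_comp _ _ H (@twist_iota_continuous _ _ _ _ _ tw _)).
- by apply: nearW => t; rewrite twist_iota_act_src.
Qed.

Lemma twist_act_continuousr a : continuous (act a).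
Proof. by move=> x; apply: twist_act_cvg; [exact: cvg_cst|exact: cvg_id]. Qed.

Lemma twist_act_continuousl x : continuous (act^~ x).
Proof. by move=> a; apply: twist_act_cvg; [exact: cvg_id|exact: cvg_cst]. Qed.

(** The saturation of [U] is the union of its translates under [Gam], and [p] is a quotient map. *)
Lemma twist_p_open (U : set S) : open U -> open (p @` U).
Proof.
move=> oU; have [_ pq] := twist_p_quotient tw; apply/pq.
rewrite (_ : _ @^-1` _ = \bigcup_(a in [set: Gam]) (act a @^-1` U)).
  apply: bigcup_open => a _; apply: open_comp => // x _.
  exact: twist_act_continuousr.
apply/seteqP; split => x /=.
  by move=> [y Uy yx]; have [a ya] := twist_fiber (esym yx); exists a => //=; rewrite -ya.
by move=> [a _ Ux]; exists (act a x) => //; rewrite twist_act_p.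
Qed.

Lemma twist_p_nbhs x (A : set S) : nbhs x A -> nbhs (p x) (p @` A).
Proof.
rewrite nbhsE => -[U [oU Ux] UA]; rewrite nbhsE.
exists (p @` U); first by split; [exact: twist_p_open|exists x].
exact: image_subset.
Qed.

Hypothesis Gam_compact : compact [set: Gam].

(** If the orbit of x misses [F], the tube lemma over the compact group gives a neighbourhood of x
    all of whose orbits miss [F]. *)
Lemma twist_p_closed (F : set S) : closed F -> closed (p @` F).
Proof.
move=> cF; rewrite -[_ @` _]setCK; apply: open_closedC.
have [_ pq] := twist_p_quotient tw; apply/pq.
rewrite openE => x /= nFx; rewrite /interior.
have H : \forall y \near x, forall a, [set: Gam] a -> ~ F (act a y).
  apply: (@compact_near_uniform _ _ [set: Gam] x (fun a y => ~ F (act a y))) => // a _.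
  have nF : nbhs (act a x) (~` F).
    apply: open_nbhs_nbhs; split; first exact: closed_openC.
    by move=> Fa; apply: nFx; exists (act a x) => //; rewrite twist_act_p.
  have : (fun q : Gam * S => act q.1 q.2) @ (a, x) --> act a x.
    by apply: twist_act_cvg; [exact: cvg_fst|exact: cvg_snd].
  move=> /(_ _ nF) [[B1 B2] [/= aB xB] B12]; exists (B1, B2) => //.
  by move=> q Bq _; exact: (B12 q Bq).
apply: filterS H => y Hy [z Fz zy].
by have [a za] := twist_fiber (esym zy); apply: (Hy a) => //; rewrite -za.
Qed.

(** A covering condition on the preimage of [K] holds along the whole compact orbit above g, hence
    along all orbits that meet a neighbourhood of one point x of it. As [p] is open, this
    neighbourhood has a neighbourhood of g as image, and compactness of [K] finishes. *)
Lemma twist_p_proper (K : set G) : compact K -> compact (p @^-1` K).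
Proof.
move=> cK; apply/compact_near_coveringP => J F P FF H.
have : \near F, K `<=` (fun g => forall y, p y = g -> P F y).
  move/compact_near_coveringP: cK; apply=> g Kg.
  have [x _ xg] := @twist_p_surj _ _ _ _ _ tw g I.
  suff [[A V] [/= xA FV] AV] : \forall x' \near x & i \near F, forall a, P i (act a x').
    exists (p @` A, V); first by split => //=; rewrite -xg; exact: twist_p_nbhs.
    move=> [_ i] /= [[x' Ax' <-] Vi] y yx.
    by have [a ->] := twist_fiber (esym yx); exact: (AV (x', i)).
  have : filter_prod (nbhs x) F [set xi | [set: Gam] `<=` (fun a => P xi.2 (act a xi.1))].
    move/compact_near_coveringP: Gam_compact.
    move=> /(_ _ (filter_prod (nbhs x) F) (fun xi a => P xi.2 (act a xi.1)) _).
    apply => a _; have [|[A V] [/= xA FV] AV] := H (act a x).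
      by rewrite /= twist_act_p xg.
    have : (fun q : Gam * S => act q.1 q.2) @ (a, x) --> act a x.
      by apply: twist_act_cvg; [exact: cvg_fst|exact: cvg_snd].
    move=> /(_ _ xA) [[B1 B2] [/= aB1 xB2] B12].
    exists (B1, [set xi | B2 xi.1 /\ V xi.2]).
      by split => //=; exists (B2, V).
    move=> [a' [x' i]] /= [B1a [B2x Vi]].
    by apply: (AV (act a' x', i)); split => //; exact: (B12 (a', x')).
  by apply: filterS => xi H' a; exact: (H' a).
by apply: filterS => i Hi y Ky; exact: (Hi _ Ky).
Qed.

End twist_facts.

(** * Integration of complex functions *)

Section cintegral_facts.
Context d (T : measurableType d) (R : realType) (mu : {measure set T -> \bar R}).
Local Notation C := (R[i]^o).
Implicit Types (D : set T) (f g : T -> R[i]).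

Definition cmeasurable D f :=
  measurable_fun D (fun x => complex.Re (f x)) /\
  measurable_fun D (fun x => complex.Im (f x)).

Definition cintegrable D f :=
  mu.-integrable D (fun x => (complex.Re (f x))%:E) /\
  mu.-integrable D (fun x => (complex.Im (f x))%:E).

Lemma cintegrable_measurable D f : cintegrable D f -> cmeasurable D f.
Proof. by move=> [/integrableP[+ _] /integrableP[+ _]]; split; exact/measurable_EFinP. Qed.

Lemma cmeasurable_rnorm D f : cmeasurable D f ->
  measurable_fun D (fun x => rnorm (f x : C)).
Proof.
move=> [mR mI].
rewrite (_ : (fun x => rnorm (f x : C)) = (fun x => Num.sqrt (complex.Re (f x) ^+ 2 + complex.Im (f x) ^+ 2))).
  apply: (@measurableT_comp _ _ _ _ _ _ (@Num.sqrt R)).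
    by apply: continuous_measurable_fun => x; exact: sqrt_continuous.
  by apply: measurable_funD; apply: measurable_funX.
by apply/funext => x; rewrite rnormE.
Qed.

Lemma cmeasurable_rnorm_sqr D f : cmeasurable D f ->
  measurable_fun D (fun x => (rnorm (f x : C) ^+ 2)%:E).
Proof.
by move=> mf; apply/measurable_EFinP; apply: measurable_funX; exact: cmeasurable_rnorm.
Qed.

Lemma eq_cintegral D f g : (forall x, D x -> f x = g x) ->
  cintegral mu D f = cintegral mu D g.
Proof.
by move=> fg; congr Complex; apply: eq_Rintegral => x; rewrite inE => /fg ->.
Qed.

Lemma cintegrable_bound D f (h : T -> R) : measurable D -> cmeasurable D f ->
  mu.-integrable D (EFin \o h) -> (forall x, D x -> rnorm (f x : C) <= h x) ->
  cintegrable D f.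
Proof.
move=> mD [mR mI] ih fh; split; apply: (@le_integrable _ _ _ mu D mD _ (EFin \o h)) => //.
- exact/measurable_EFinP.
- move=> x Dx /=; rewrite lee_fin (le_trans (rnorm_Re _))// (le_trans (fh x Dx))//.
  exact: ler_norm.
- exact/measurable_EFinP.
- move=> x Dx /=; rewrite lee_fin (le_trans (rnorm_Im _))// (le_trans (fh x Dx))//.
  exact: ler_norm.
Qed.

Lemma cintegrable_rnorm D f : measurable D -> cintegrable D f ->
  mu.-integrable D (fun x => (rnorm (f x : C))%:E).
Proof.
move=> mD if_; have [mR mI] := cintegrable_measurable if_; case: if_ => iR iI.
apply: (@le_integrable _ _ _ mu D mD _
  ((fun x => `|(complex.Re (f x))%:E|) \+ (fun x => `|(complex.Im (f x))%:E|))%E).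
- by apply/measurable_EFinP; exact: cmeasurable_rnorm.
- move=> x Dx /=; rewrite lee_fin ger0_norm ?rnorm_ge0//.
  by rewrite (le_trans (rnorm_le_ReIm _))// ler_norm.
- by apply: integrableD => //; exact: integrable_abse.
Qed.

Lemma cintegrableP D f : measurable D -> cmeasurable D f ->
  (\int[mu]_(x in D) (rnorm (f x : C))%:E < +oo)%E -> cintegrable D f.
Proof.
move=> mD mf foo; apply: (cintegrable_bound (h := fun x => rnorm (f x : C))) => //.
apply/integrableP; split; first by apply/measurable_EFinP; exact: cmeasurable_rnorm.
by under eq_integral do rewrite /= ger0_norm ?rnorm_ge0//.
Qed.

Lemma cintegralDZ D (a : R[i]) f g : measurable D -> cintegrable D f -> cintegrable D g ->
  cintegral mu D (fun x => a * f x + g x) = a * cintegral mu D f + cintegral mu D g.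
Proof.
move=> mD [fR fI] [gR gI]; case: a => a b; rewrite /cintegral.
have aZ (c : R) (h : T -> R) : mu.-integrable D (fun x => (h x)%:E) ->
    mu.-integrable D (fun x => (c * h x)%:E).
  by move=> ih; under eq_fun do rewrite EFinM; exact: integrableZl.
have bD (h k : T -> R) : mu.-integrable D (fun x => (h x)%:E) ->
    mu.-integrable D (fun x => (k x)%:E) -> mu.-integrable D (fun x => (h x + k x)%:E).
  by move=> ih ik; under eq_fun do rewrite EFinD; exact: integrableD.
have -> : (fun x => complex.Re ((a +i* b)%C * f x + g x)) =
    (fun x => (a * complex.Re (f x) + (- b) * complex.Im (f x)) + complex.Re (g x)).
  by apply/funext => x; case: (f x) (g x) => ? ? [] ? ? /=; rewrite mulNr.
have -> : (fun x => complex.Im ((a +i* b)%C * f x + g x)) =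
    (fun x => (a * complex.Im (f x) + b * complex.Re (f x)) + complex.Im (g x)).
  by apply/funext => x; case: (f x) (g x) => ? ? [].
rewrite !RintegralD//; try by [apply: aZ|apply: bD; apply: aZ].
by rewrite !RintegralZl// mulNr.
Qed.

Lemma cintegral0 D : cintegral mu D (fun=> 0) = 0.
Proof. by rewrite /cintegral /Rintegral /= integral0. Qed.

Lemma cmeasurableDZ D (a : R[i]) f g : cmeasurable D f -> cmeasurable D g ->
  cmeasurable D (fun x => a * f x + g x).
Proof.
move=> [fR fI] [gR gI]; case: a => a b; split.
  rewrite (_ : (fun _ => _) =
    (fun x => (a * complex.Re (f x) - b * complex.Im (f x)) + complex.Re (g x))).
    by apply: measurable_funD => //; apply: measurable_funB; exact: measurable_funM.
  by apply/funext => x; case: (f x) (g x) => ? ? [].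
rewrite (_ : (fun _ => _) =
    (fun x => (a * complex.Im (f x) + b * complex.Re (f x)) + complex.Im (g x))).
  by apply: measurable_funD => //; apply: measurable_funD; exact: measurable_funM.
by apply/funext => x; case: (f x) (g x) => ? ? [].
Qed.

Lemma cmeasurable_cst D (a : R[i]) : cmeasurable D (fun=> a).
Proof. by split; exact: measurable_cst. Qed.

Lemma cintegrableDZ D (a : R[i]) f g : measurable D -> cintegrable D f -> cintegrable D g ->
  cintegrable D (fun x => a * f x + g x).
Proof.
move=> mD if_ ig.
apply: (cintegrable_bound (h := fun x => rnorm (a : C) * rnorm (f x : C) + rnorm (g x : C))) => //.
- by apply: cmeasurableDZ; apply: cintegrable_measurable.
- rewrite (_ : _ \o _ = (fun x => (rnorm (a : C))%:E * (rnorm (f x : C))%:E) \+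
    (fun x => (rnorm (g x : C))%:E))%E//.
  by apply: integrableD => //; [apply: integrableZl|]; rewrite //; exact: cintegrable_rnorm.
- by move=> x Dx; rewrite (le_trans (rnormD _ _))// rnormM.
Qed.

Lemma cintegralZ D (a : R[i]) f : measurable D -> cintegrable D f ->
  cintegral mu D (fun x => a * f x) = a * cintegral mu D f.
Proof.
move=> mD if_; have i0 : cintegrable D (fun=> 0) by split; exact: integrable0.
by rewrite -[RHS]addr0 -(cintegral0 D) -cintegralDZ//; under [in RHS]eq_cintegral do rewrite addr0.
Qed.

Lemma cintegralB D f g : measurable D -> cintegrable D f -> cintegrable D g ->
  cintegral mu D (fun x => f x - g x) = cintegral mu D f - cintegral mu D g.
Proof.
move=> mD if_ ig; rewrite addrC -mulN1r -cintegralDZ//.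
by apply: eq_cintegral => x _; rewrite mulN1r addrC.
Qed.

(* Rotating by a unimodular constant makes the integral real and nonnegative. *)
Lemma rnorm_cintegral_le D f : measurable D -> cmeasurable D f ->
  ((rnorm (cintegral mu D f : C))%:E <= \int[mu]_(x in D) (rnorm (f x : C))%:E)%E.
Proof.
move=> mD mf; have [if_|] := pselect (\int[mu]_(x in D) (rnorm (f x : C))%:E < +oo)%E; last first.
  by move=> /negP; rewrite -leNgt; apply: le_trans; exact: leey.
have {}if_ := cintegrableP mD mf if_.
set z := cintegral mu D f; have [->|z0] := eqVneq z 0.
  by rewrite (rnorm0 C); apply: integral_ge0 => x _; rewrite lee_fin rnorm_ge0.
have nz0 : rnorm (z : C) != 0 by rewrite (@rnorm_eq0 _ C).
pose c : C := conjc z / (rnorm (z : C))%:C%C.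
have cz : c * z = (rnorm (z : C))%:C%C.
  have zc : z * conjc z = (rnorm (z : C))%:C%C * (rnorm (z : C))%:C%C.
    by rewrite (@rnormC _ C) -sqr_normc expr2.
  apply: (@etrans _ _ (z * conjc z / (rnorm (z : C))%:C%C)); first by rewrite mulrC mulrA.
  by rewrite zc mulfK//; apply: contra nz0 => /eqP /complexI ->.
have c1 : rnorm c = 1.
  apply: (mulIf nz0); rewrite -rnormM cz rnorm_real mul1r.
  by rewrite ger0_norm ?rnorm_ge0.
have icf : cintegrable D (fun x => c * f x).
  have i0 : cintegrable D (fun=> 0) by split; exact: integrable0.
  by have := cintegrableDZ c mD if_ i0; under eq_fun do rewrite addr0.
have -> : rnorm (z : C) = \int[mu]_(x in D) complex.Re (c * f x).
  by rewrite -[LHS]/(complex.Re (rnorm (z : C))%:C%C) -cz -cintegralZ.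
rewrite /Rintegral fineK; last by apply: integrable_fin_num => //; case: icf.
apply: le_integral => //; first by case: icf.
  exact: cintegrable_rnorm.
move=> x _; rewrite lee_fin -[leRHS]mul1r -c1 -rnormM.
by rewrite (le_trans (ler_norm _))// rnorm_Re.
Qed.

End cintegral_facts.

(** * Integration against an image measure *)

Section image_measure.
Context d1 d2 (X : measurableType d1) (Y : measurableType d2) (R : realType).
Variables (phi : X -> Y) (mphi : measurable_fun setT phi).
Variables (mu : {measure set X -> \bar R}) (nu : {measure set Y -> \bar R}).
Hypothesis nuE : forall B, measurable B -> nu B = mu (phi @^-1` B).

Lemma ge0_integral_image D (f : Y -> \bar R) : measurable D -> measurable_fun D f ->
  (forall y, D y -> 0 <= f y)%E ->
  (\int[nu]_(y in D) f y = \int[mu]_(x in phi @^-1` D) f (phi x))%E.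
Proof.
move=> mD mf f0; rewrite -(ge0_integral_pushforward mphi mu mD mf).
  by apply: (@eq_measure_integral _ _ _ _ (measure_function_pushforward__canonical__measure_function_Measure mu mphi)) => A mA _; exact: nuE.
by move=> y; rewrite inE; exact: f0.
Qed.

Lemma integral_image D (f : Y -> \bar R) : measurable D -> measurable_fun D f ->
  (\int[nu]_(y in D) f y = \int[mu]_(x in phi @^-1` D) f (phi x))%E.
Proof.
move=> mD mf; rewrite integralE [RHS]integralE.
have -> : (fun x => f (phi x))^\+%E = f^\+%E \o phi by exact: funepos_comp.
have -> : (fun x => f (phi x))^\-%E = f^\-%E \o phi by exact: funeneg_comp.
by congr (_ - _)%E; apply: ge0_integral_image => //;
  [exact: measurable_funepos|exact: measurable_funeneg].
Qed.

Lemma cintegral_image D (f : Y -> R[i]) : measurable D -> cmeasurable D f ->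
  cintegral nu D f = cintegral mu (phi @^-1` D) (f \o phi).
Proof.
move=> mD [mR mI]; rewrite /cintegral /Rintegral.
by rewrite !integral_image//; exact/measurable_EFinP.
Qed.

End image_measure.

(** * Radon measures and continuous functions *)

Section borel_facts.
Variables (R : realType) (X : topologicalType) (t : X).
Local Notation C := (R[i]^o).

Lemma borel_open (U : set X) : open U -> measurable (U : set (borel t)).
Proof. exact: sub_sigma_algebra. Qed.

Lemma borel_closed (U : set X) : closed U -> measurable (U : set (borel t)).
Proof.
move=> cU; rewrite -(setCK U); apply: measurableC; apply: borel_open.
exact: closed_openC.
Qed.

Lemma borel_within_continuous (D : set X) (f : X -> R) : closed D ->
  {within D, continuous f} -> measurable_fun (D : set (borel t)) f.
Proof.
move=> cD /continuousP cf; apply: (measurability _ (RGenOpens.measurableE R)).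
move=> _ [_ [a [b ->] <-]].
have [V oV VD] := (open_subspaceP D (f @^-1` `]a, b[)).1 (cf _ (@interval_open R (BRight a) (BLeft b) isT isT)).
rewrite setIC -VD; apply: measurableI; last exact: borel_closed.
exact: borel_open.
Qed.

Lemma borel_continuous (f : X -> R) : continuous f ->
  measurable_fun (setT : set (borel t)) f.
Proof.
move=> cf; apply: borel_within_continuous; first exact: closedT.
exact: continuous_subspaceT.
Qed.

Lemma borel_cmeasurable_within (D : set X) (f : X -> C) : closed D ->
  {within D, continuous f} -> cmeasurable (D : set (borel t)) f.
Proof.
move=> cD /subspace_continuousP cf; split; apply: borel_within_continuous => //.
  apply/subspace_continuousP => x Dx.
  exact: (cvg_comp _ _ (cf x Dx) (@Re_continuous R (f x))).
apply/subspace_continuousP => x Dx.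
exact: (cvg_comp _ _ (cf x Dx) (@Im_continuous R (f x))).
Qed.

Lemma borel_cmeasurable (f : X -> C) : continuous f ->
  cmeasurable (setT : set (borel t)) f.
Proof.
move=> cf; apply: borel_cmeasurable_within; first exact: closedT.
exact: continuous_subspaceT.
Qed.

Hypothesis hX : hausdorff_space X.
Variable mu : borel_measure R t.
Hypothesis mu_radon : radon mu.

Lemma borel_compact (K : set X) : compact K -> measurable (K : set (borel t)).
Proof. by move=> cK; apply: borel_closed; exact: compact_closed. Qed.

(** The function is dominated by a multiple of the indicator of [K], which has finite measure. The
    closed domain [D] will be a range fibre, the only place where a convolution integrand is
    meaningful. *)
Lemma radon_cintegrable (D : set X) (f : X -> C) (K : set X) (M : R) :
  closed D -> compact K -> cmeasurable (D : set (borel t)) f ->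
  (forall x, D x -> rnorm (f x) <= M) -> (forall x, D x -> ~ K x -> f x = 0) ->
  cintegrable mu D f.
Proof.
move=> cD cK mf fM fK; have mD := borel_closed cD; have mK := borel_compact cK.
apply: (cintegrable_bound (h := fun x : borel t => `|M| * \1_K x)) => //.
  rewrite (_ : _ \o _ = fun x => (`|M|%:E * (\1_K x)%:E)%E)//.
  apply: integrableZl => //.
  apply/integrableP; split; first by apply/measurable_EFinP; exact: measurable_indic.
  under eq_integral do rewrite /= ger0_norm//.
  rewrite integral_indic//; apply: le_lt_trans (radon_compact mu_radon cK).
  by apply: le_measure; rewrite ?inE//; exact: measurableI.
move=> x Dx; have [Kx|nKx] := pselect (K x).
  by rewrite indicE mem_set// mulr1 (le_trans (fM x Dx))// ler_norm.
by rewrite fK// (rnorm0 C) mulr_ge0.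
Qed.

Lemma Cc_bounded (f : X -> C) : Cc f ->
  exists2 M : R, 0 < M & forall x, rnorm (f x) <= M.
Proof.
move=> [cf cK]; have [M M0 fM] := compact_rnorm_bounded cK (continuous_subspaceT cf).
exists M => // x; have [->|fx] := eqVneq (f x) 0; first by rewrite (rnorm0 C) ltW.
by apply: fM; apply: subset_closure.
Qed.

Lemma Cc_eq0 (f : X -> C) x : ~ closure [set x | f x != 0] x -> f x = 0.
Proof. by move=> nx; apply/eqP/negPn/negP => fx; apply: nx; exact: subset_closure. Qed.

Lemma Cc_cintegrable (D : set X) (f : X -> C) : closed D -> Cc f -> cintegrable mu D f.
Proof.
move=> cD fC; have [M _ fM] := Cc_bounded fC; case: (fC) => cf cK.
apply: (radon_cintegrable (K := closure [set x | f x != 0]) (M := M)) => //.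
  by apply: borel_cmeasurable_within => //; exact: continuous_subspaceT.
by move=> x _; exact: Cc_eq0.
Qed.

(** Together with Urysohn functions and inner regularity this recovers the measure of an open set
    from integrals over [Cc]. *)
Lemma radon_sandwich (K L U : set X) (g : X -> R) : compact K -> compact L ->
  measurable (U : set (borel t)) -> L `<=` U -> continuous g -> (forall x, 0 <= g x <= 1) ->
  (forall x, K x -> g x = 1) -> (forall x, ~ L x -> g x = 0) ->
  (mu K <= (complex.Re (cintegral mu setT (fun x => (g x)%:C%C)))%:E <= mu U)%E.
Proof.
move=> cK cL mU LU cg g01 gK gL.
have mg := borel_continuous cg.
have -> : (complex.Re (cintegral mu setT (fun x => (g x)%:C%C)))%:E =
    (\int[mu]_x (g x)%:E)%E.
  rewrite /cintegral /= /Rintegral fineK//; apply: integrable_fin_num => //.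
  have [] // : cintegrable mu setT (fun x => (g x)%:C%C).
  apply: (radon_cintegrable (K := L) (M := 1)) => //.
  - by move=> x _; rewrite rnorm_real ger0_norm; case/andP: (g01 x).
  - by move=> x _ /gL ->.
rewrite -(setIT K) -(setIT U) -(integral_indic mu measurableT (borel_compact cK)).
rewrite -(integral_indic mu measurableT mU).
apply/andP; split; apply: ge0_le_integral => //.
- by apply/measurable_EFinP; apply: measurable_indic; exact: borel_compact.
- exact/measurable_EFinP.
- move=> x _; rewrite lee_fin indicE; have [Kx|nKx] := pselect (K x).
    by rewrite mem_set// gK.
  by rewrite memNset//; case/andP: (g01 x).
- by move=> x _; rewrite lee_fin; case/andP: (g01 x).
- exact/measurable_EFinP.
- by apply/measurable_EFinP; exact: measurable_indic.
- move=> x _; rewrite lee_fin indicE; have [Lx|nLx] := pselect (L x).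
    by rewrite mem_set; [case/andP: (g01 x)|exact: LU].
  by rewrite gL.
Qed.

Lemma radon_null_open (U : set X) : open U ->
  (forall x, U x -> ~ measure_support mu x) -> mu U = 0%E.
Proof.
move=> oU US; rewrite (radon_inner mu_radon oU); apply/eqP; rewrite eq_le; apply/andP; split.
  apply: ge_ereal_sup => _ [K [cK KU] <-].
  have mK := borel_compact cK.
  suff /negligibleP -> // : mu.-negligible (K : set (borel t)) by [].
  have /compact_near_coveringP/near_covering_withinP := cK.
  (* Compactness is applied along the filter of conull sets instead of to a finite subcover. Near
     each point of [K] there is a null open set, so almost every i differs from all points of it;
     uniformly over [K], almost every i lies outside [K], that is, [K] is null. *)
  move=> /(_ X (almost_everywhere mu) (fun i x => i <> x) _).
  case; first exact: (@ae_filter_ringOfSetsType _ (borel t) R mu).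
    move=> x Kx; have /existsNP[V /not_implyP[oV /not_implyP[Vx V0]]] := US _ (KU _ Kx).
    exists (V, ~` V).
      split => /=; first exact: open_nbhs_nbhs.
      exists V; split; [exact: borel_open| |by move=> y /=; rewrite notK].
      by apply/eqP; rewrite eq_le measure_ge0 andbT leNgt; exact/negP.
    by move=> [x' i] /= [Vx' nVi] _ ix'; apply: nVi; rewrite ix'.
  move=> N [mN N0 KN]; exists N; split => // x Kx; apply: KN => /= /(_ _ Kx).
  exact.
apply: ereal_sup_ubound; exists set0; last exact: measure0.
by split; [exact: compact0|exact: sub0set].
Qed.

End borel_facts.

Section negligible_complement.
Context (R : realType) (X : topologicalType) (t : X) (nu : borel_measure R t).
Local Notation C := (R[i]^o).

Lemma integral_conull (D : set (borel t)) (f : borel t -> \bar R) :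
  measurable D -> nu (~` D) = 0%E -> measurable_fun setT f ->
  (\int[nu]_(x in setT) f x = \int[nu]_(x in D) f x)%E.
Proof.
move=> mD D0 mf.
have mDC : measurable (~` D) by exact: measurableC.
have DE : D = setT `\` ~` D by rewrite setTD setCK.
rewrite integralE [RHS]integralE [in RHS]DE.
by congr (_ - _)%E; apply: ge0_negligible_integral => //;
  [exact: measurable_funepos|exact: measurable_funeneg].
Qed.

Lemma cintegral_conull (D : set (borel t)) (f : borel t -> C) :
  measurable D -> nu (~` D) = 0%E -> cmeasurable setT f ->
  cintegral nu setT f = cintegral nu D f.
Proof.
move=> mD D0 [mR mI]; rewrite /cintegral /Rintegral.
by rewrite (integral_conull mD D0)// ?(@integral_conull D)//; exact/measurable_EFinP.
Qed.

End negligible_complement.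

(** * Averages over the compact group *)

Section haar_facts.
Variables (R : realType) (Gam : topologicalZmodType).
Variables (lam : borel_measure R (0 : Gam)) (lam_haar : normalised_haar lam).
Local Notation C := (R[i]^o).

Lemma haar_cst (c : C) : cintegral lam setT (fun=> c) = c.
Proof.
by rewrite /cintegral !Rintegral_cst// (haar_total lam_haar) /= !mulr1; case: c.
Qed.

End haar_facts.

Section haar_averages.
Variables (R : realType) (Gam : topologicalZmodType).
Hypothesis Gam_hausdorff : hausdorff_space Gam.
Hypothesis Gam_compact : compact [set: Gam].
Variables (lam : borel_measure R (0 : Gam)) (lam_haar : normalised_haar lam).
Local Notation C := (R[i]^o).

Lemma rnorm_cval (z : circle R) : rnorm (cval z : C) = 1.
Proof.
have e : `|cval z| = 1 by exact: (set_valP z).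
by apply: (@complexI R); rewrite (@rnormC _ C).
Qed.

Lemma cval_continuous : continuous (@cval R : circle R -> C).
Proof. exact: initial_continuous. Qed.

Lemma cval0 : cval (0 : circle R) = 1.
Proof. by []. Qed.

Lemma cvalN (z : circle R) : cval (- z) * cval z = 1.
Proof. by rewrite -cvalD addNr. Qed.

Lemma character0 (chi : Gam -> circle R) : is_character chi -> chi 0 = 0.
Proof. by move=> [cD _]; apply: (@addrI _ (chi 0)); rewrite -cD !addr0. Qed.

Lemma characterN (chi : Gam -> circle R) a : is_character chi -> chi (- a) = - chi a.
Proof.
move=> cc; have [cD _] := cc.
by apply: (@addrI _ (chi a)); rewrite -cD !subrr character0.
Qed.

Lemma haar_cintegrable (f : Gam -> C) : continuous f -> cintegrable lam setT f.
Proof.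
move=> cf; have [M _ fM] := compact_rnorm_bounded Gam_compact (continuous_subspaceT cf).
apply: (radon_cintegrable Gam_hausdorff (haar_radon lam_haar) (K := setT) (M := M)) => //.
exact: borel_cmeasurable.
Qed.

(** Invariance is stated for direct images of sets; direct images under translation by [- b] are the
    preimages under translation by [b] that the change of variables asks for. *)
Lemma haar_translate (f : Gam -> C) (b : Gam) : continuous f ->
  cintegral lam setT (fun a => f (b + a)) = cintegral lam setT f.
Proof.
move=> cf; have cb : continuous (fun a : Gam => b + a).
  move=> a; have H : (fun x : Gam => (b, x)) @ a --> (b, a).
    by apply: cvg_pair; [exact: cvg_cst|exact: cvg_id].
  exact: (cvg_comp _ _ H (@add_continuous Gam (b, a))).
have mb : measurable_fun setT ((fun a : Gam => b + a) : borel (0 : Gam) -> borel (0 : Gam)).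
  exact: (@continuous_borel _ _ 0 0 _ cb).
rewrite [RHS](@cintegral_image _ _ _ _ _ _ mb lam lam) ?preimage_setT//.
  move=> B mB; rewrite -(haar_invariant lam_haar (- b) mB); congr (lam _).
  apply/seteqP; split => x /=.
    by move=> [y By <-]; rewrite addrA subrr add0r.
  by move=> Bx; exists (b + x) => //; rewrite addrA addNr add0r.
exact: borel_cmeasurable.
Qed.

Lemma haar_le_norm (f : Gam -> C) (M : R) : continuous f ->
  (forall a, rnorm (f a) <= M) -> rnorm (cintegral lam setT f : C) <= M.
Proof.
move=> cf fM; have if_ := haar_cintegrable cf.
rewrite -lee_fin; apply: le_trans (rnorm_cintegral_le lam measurableT (cintegrable_measurable if_)) _.
rewrite -[leRHS]mule1 -(haar_total lam_haar) -integral_cst//.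
apply: ge0_le_integral => //.
- by move=> x _; rewrite lee_fin rnorm_ge0.
- by apply/measurable_EFinP; apply: cmeasurable_rnorm; exact: (cintegrable_measurable if_).
- by move=> x _; rewrite lee_fin.
Qed.

Lemma cvgX2 (T : Type) (F : set_system T) (FF : Filter F) (f : T -> R) (l : R) :
  f @ F --> l -> (fun x => f x ^+ 2) @ F --> l ^+ 2.
Proof. by move=> fl; rewrite expr2; under eq_fun do rewrite expr2; exact: cvgM. Qed.

(* Jensen's inequality for the square; [lam] is a probability measure. *)
Lemma haar_sqr_le (f : Gam -> C) : continuous f ->
  rnorm (cintegral lam setT f : C) ^+ 2 <=
  complex.Re (cintegral lam setT (fun a => (rnorm (f a) ^+ 2)%:C%C)).
Proof.
move=> cf; have if_ := haar_cintegrable cf.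
have cn : continuous (fun a => (rnorm (f a))%:C%C : C).
  apply: continuous_ReIm => a /=; last exact: cvg_cst.
  exact: (cvg_comp _ _ (cf a) (@rnorm_continuous R C (f a))).
have cn2 : continuous (fun a => (rnorm (f a) ^+ 2)%:C%C : C).
  apply: continuous_ReIm => a /=; last exact: cvg_cst.
  apply: cvgX2.
  exact: (cvg_comp _ _ (cf a) (@rnorm_continuous R C (f a))).
have [in1 _] := haar_cintegrable cn; have [in2 _] := haar_cintegrable cn2.
rewrite /= in in1 in2.
pose m := \int[lam]_a rnorm (f a).
have m0 : 0 <= m by apply: Rintegral_ge0 => a _; exact: rnorm_ge0.
have le1 : rnorm (cintegral lam setT f : C) <= m.
  rewrite -lee_fin /m /Rintegral fineK; last exact: integrable_fin_num.
  exact: (rnorm_cintegral_le lam measurableT (cintegrable_measurable if_)).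
apply: (@le_trans _ _ (m ^+ 2)); first by rewrite ler_pXn2r// nnegrE ?rnorm_ge0.
(* The variance of |f| is nonnegative; expanding it gives m^2 <= integral of |f|^2. *)
have H : 0 <= \int[lam]_a ((rnorm (f a) ^+ 2 + (- (2 * m)) * rnorm (f a)) + m ^+ 2).
  apply: Rintegral_ge0 => a _.
  have -> : rnorm (f a) ^+ 2 + - (2 * m) * rnorm (f a) + m ^+ 2 = (rnorm (f a) - m) ^+ 2 by ring.
  exact: sqr_ge0.
have i1 : lam.-integrable setT (EFin \o (fun a => - (2 * m) * rnorm (f a))).
  by rewrite (_ : _ \o _ = (fun a => (- (2 * m))%:E * (rnorm (f a))%:E)%E)//; exact: integrableZl.
have ic : lam.-integrable setT (EFin \o (fun a : borel (0 : Gam) => m ^+ 2)).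
  apply/integrableP; split; first exact: measurable_cst.
  by rewrite /= integral_cst//= (haar_total lam_haar) mule1 ltry.
rewrite RintegralD// in H; last first.
  exact: (integrableD measurableT in2 i1).
rewrite RintegralD// RintegralZl// Rintegral_cst// (haar_total lam_haar) /= mulr1 -/m in H.
rewrite /cintegral /=; lra.
Qed.

End haar_averages.

Lemma cmeasurableB d (T : measurableType d) (R : realType) (D : set T) (f g : T -> R[i]) :
  cmeasurable D f -> cmeasurable D g -> cmeasurable D (fun x => f x - g x).
Proof.
move=> mf mg; have := cmeasurableDZ (-1) mg mf.
by under eq_fun do rewrite mulN1r addrC.
Qed.

(** * Convolution preserves continuity and compact support *)

Section convolution.
Variables (R : realType) (S : topologicalGroupoidType).
Hypothesis S_hausdorff : hausdorff_space S.
Hypothesis S_locally_compact : locally_compact [set: S].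
Variable mu : measure_family R S.
Hypothesis mu_radon : forall u, radon (mu u).
Hypothesis mu_conull : forall u, mu u (~` rfiber (\val u)) = 0%E.
Local Notation C := (R[i]^o).
Hypothesis mu_continuous : forall k : S -> C, Cc k ->
  continuous (fun u : unit_space S => cintegral (mu u) setT k : C).

Lemma cvg_conv_integrand (f g : S -> C) (T : Type) (F : set_system T) (FF : Filter F)
    (h k : T -> S) y x : continuous f -> continuous g -> grng y = grng x ->
  h @ F --> y -> k @ F --> x -> (\forall t \near F, grng (h t) = grng (k t)) ->
  (fun t => f (h t) * g (gmul (ginv (h t)) (k t)) : C) @ F --> (f y * g (gmul (ginv y) x) : C).
Proof.
move=> cf cg yx hy kx hk; apply: cvgM.
  exact: (cvg_comp _ _ hy (cf y)).
have H : (fun t => gmul (ginv (h t)) (k t)) @ F --> gmul (ginv y) x.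
  apply: cvg_gmul => //; first by rewrite gsrcV.
    exact: (cvg_comp _ _ hy (@ginv_continuous S y)).
  by apply: filterS hk => t; rewrite gsrcV.
exact: (cvg_comp _ _ H (cg _)).
Qed.

Lemma conv_integrand_continuous (f g : S -> C) x : continuous f -> continuous g ->
  {within rfiber (grng x), continuous (fun y => f y * g (gmul (ginv y) x) : C)}.
Proof.
move=> cf cg; apply/subspace_continuousP => y yx.
apply: cvg_conv_integrand => //.
- exact: cvg_within.
- exact: cvg_cst.
- exact: withinT.
Qed.

(** The axioms of a Haar system concern functions in [Cc] on the whole groupoid, while the integrand
    makes sense only on one fibre. Its second factor is extended by Tietze from the part of the
    fibre inside the support of [f], and multiplication by [f] restores compact support. *)
Lemma conv_integrand_extension (f g : S -> C) x : Cc f -> continuous g ->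
  exists k : S -> C, [/\ Cc k,
    forall y, rfiber (grng x) y -> k y = f y * g (gmul (ginv y) x) &
    forall y, ~ closure [set y | f y != 0] y -> k y = 0].
Proof.
move=> [cf cK] cg; set K := closure _.
have cKx : compact (K `&` rfiber (grng x)).
  by apply: compact_closedI => //; exact: rfiber_closed.
have [|H cH HE] := @tietze_compact R S S_hausdorff S_locally_compact _
    (fun y => g (gmul (ginv y) x)) cKx.
  apply/subspace_continuousP => y [_ yx].
  have W : (fun y => gmul (ginv y) x) @ within (K `&` rfiber (grng x)) (nbhs y) --> gmul (ginv y) x.
    apply: cvg_gmul; first by rewrite gsrcV.
    - have H : id @ within (K `&` rfiber (grng x)) (nbhs y) --> y by exact: cvg_within.
      exact: (cvg_comp _ _ H (@ginv_continuous S y)).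
    - exact: cvg_cst.
    - by apply: filterS (withinT _ _) => z [_ zx]; rewrite gsrcV.
  exact: (cvg_comp _ _ W (cg _)).
have k0 y : ~ K y -> f y * H y = 0 by move=> nKy; rewrite (Cc_eq0 nKy) mul0r.
exists (fun y => f y * H y); split; last exact: k0.
- apply: (Cc_compact_support S_hausdorff _ cK k0).
  by move=> y; apply: cvgM; [exact: cf|exact: cH].
- move=> y yx; have [Ky|nKy] := pselect (K y); first by rewrite HE.
  by rewrite k0// (Cc_eq0 nKy) mul0r.
Qed.

Lemma conv_extensionE (f g : S -> C) x (k : S -> C) : Cc k ->
  (forall y, rfiber (grng x) y -> k y = f y * g (gmul (ginv y) x)) ->
  conv mu f g x = cintegral (mu (rngU x)) setT k.
Proof.
move=> kC kE; rewrite (@cintegral_conull _ _ _ (mu (rngU x)) (rfiber (grng x))).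
- by apply: eq_cintegral => y /kE.
- by apply: borel_closed; exact: rfiber_closed.
- exact: (mu_conull (rngU x)).
- by apply: borel_cmeasurable; case: kC.
Qed.

(** The weight [w] will be 1 on the support of [f]: it turns a small pointwise bound into a small
    integral although the fibre may have infinite measure. *)
Lemma cintegral_le_weight (u : unit_space S) (D : set S) (h : S -> C) (w : S -> R) (d : R) :
  closed D -> cmeasurable (D : set (borel (\val u))) h -> 0 <= d ->
  continuous w -> (forall x, 0 <= w x) -> Cc (fun x => (w x)%:C%C : C) ->
  (forall x, D x -> rnorm (h x) <= d * w x) ->
  rnorm (cintegral (mu u) D h : C) <= d * complex.Re (cintegral (mu u) setT (fun x => (w x)%:C%C)).
Proof.
move=> cD mh d0 cw w0 wC hw; have mD := borel_closed (t := \val u) cD.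
have [iw _] := Cc_cintegrable (t := \val u) S_hausdorff (mu_radon u) (@closedT S) wC.
rewrite /= in iw.
have iwD : ((complex.Re (cintegral (mu u) setT (fun x => (w x)%:C%C)))%:E =
    \int[mu u]_x (w x)%:E)%E.
  by rewrite /cintegral /= /Rintegral fineK//; exact: integrable_fin_num.
have mw := borel_continuous (t := \val u) cw.
rewrite -lee_fin EFinM iwD -ge0_integralZl//; last 2 first.
- exact/measurable_EFinP.
- by move=> x _; rewrite lee_fin.
apply: le_trans (rnorm_cintegral_le (mu u) mD mh) _.
apply: (@le_trans _ _ (\int[mu u]_(x in D) (d%:E * (w x)%:E))%E).
  apply: ge0_le_integral => //.
  - by move=> x _; rewrite lee_fin rnorm_ge0.
  - by apply/measurable_EFinP; exact: cmeasurable_rnorm.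
  - by apply/measurable_EFinP; apply: measurable_funM => //; exact: measurable_funTS.
apply: ge0_subset_integral => //.
  by apply/measurable_EFinP; exact: measurable_funM.
by move=> x _; rewrite -EFinM lee_fin mulr_ge0.
Qed.

(** Both the integrand and its domain move with x. Let [k] in [Cc] extend the integrand at [x0]. The
    integral of [k] varies continuously with the fibre by the Haar system axiom, and for x near [x0]
    the integrand at x is uniformly close to [k] on the fibre of x, by the tube lemma over the
    support of [f]. *)
Lemma conv_continuous (f g : S -> C) : Cc f -> Cc g -> continuous (conv mu f g).
Proof.
move=> fC gC; have [cf cK] := fC; have [cg _] := gC.
move=> x0; have [k [kC kE k0]] := conv_integrand_extension x0 fC cg.
set K := closure _ in k0.
have [w [L [cw cL _ w01 [wK wL]]]] :=
  @urysohn_compact R S S_hausdorff S_locally_compact K setT cK openT (@subsetT _ K).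
have wC : Cc (fun x => (w x)%:C%C : C).
  apply: (Cc_compact_support S_hausdorff _ cL); last by move=> x /wL ->.
  by apply: continuous_ReIm => //; move=> x; exact: cvg_cst.
apply/(@cvg_rnormP _ C _ (nbhs x0)) => e e0.
pose I x := complex.Re (cintegral (mu (rngU x)) setT (fun x => (w x)%:C%C)).
have I0 : 0 <= I x0.
  by rewrite /I /=; apply: Rintegral_ge0 => x _; case/andP: (w01 x).
have cI (h : S -> C) : Cc h -> (fun x => cintegral (mu (rngU x)) setT h : C) @ x0 -->
    (cintegral (mu (rngU x0)) setT h : C).
  move=> hC.
  exact: (cvg_comp _ _ (@rngU_continuous S x0) (mu_continuous hC (x := rngU x0))).
(* [I x] is the mass of the weight over the fibre of x and stays below [I x0 + 1] near [x0]; hence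
   [d * I x] is at most e / 2 there. *)
pose d := e / 2 / (I x0 + 1).
have d0 : 0 < d by rewrite !divr_gt0// ltr_wpDl.
have nU : \forall x \near x0, forall y, K y -> grng y = grng x ->
    rnorm (f y * g (gmul (ginv y) x) - k y : C) < d.
  apply: (@compact_near_uniform _ _ K x0 (fun y x => grng y = grng x ->
    rnorm (f y * g (gmul (ginv y) x) - k y : C) < d)) => // y Ky.
  (* If the ranges of y and [x0] differ, they differ for all nearby pairs and the estimate is
     vacuous. *)
  have [yx|yx] := pselect (grng y = grng x0); last first.
    have op : open [set q : S * S | grng q.1 <> grng q.2].
      rewrite (_ : mkset _ = ~` [set q : S * S | grng q.1 = grng q.2])//.
      apply: closed_openC; apply: eq_closed => // q.
        by apply: (@continuous_comp _ _ _ fst); [exact: cvg_fst|exact: grng_continuous].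
      by apply: (@continuous_comp _ _ _ snd); [exact: cvg_snd|exact: grng_continuous].
    have : nbhs (y, x0) [set q : S * S | grng q.1 <> grng q.2] by exact: open_nbhs_nbhs.
    move=> [[B1 B2] [/= yB xB] B12]; exists (B1, B2) => //.
    by move=> q Bq _ /(B12 q Bq).
  have H : id @ within [set q : S * S | grng q.1 = grng q.2] (nbhs (y, x0)) --> (y, x0).
    exact: cvg_within.
  set W := within _ _ in H.
  have FW : Filter W by exact: within_filter.
  have H1 : (fun q : S * S => q.1) @ W --> y by exact: (cvg_comp _ _ H cvg_fst).
  have H2 : (fun q : S * S => q.2) @ W --> x0 by exact: (cvg_comp _ _ H cvg_snd).
  have HT : \forall q \near W, grng q.1 = grng q.2 by exact: withinT.
  have c1 := cvg_conv_integrand FW cf cg yx H1 H2 HT.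
  have ck : continuous k by case: kC.
  have cv : (fun q : S * S => f q.1 * g (gmul (ginv q.1) q.2) - k q.1 : C) @ W -->
      (f y * g (gmul (ginv y) x0) - k y : C).
    exact: (cvgB c1 (cvg_comp _ _ H1 (ck y))).
  have := (@cvg_rnormP _ C _ _ FW _ _).1 cv d d0.
  rewrite kE// subrr => -[[B1 B2] [/= yB xB] B12]; exists (B1, B2) => //.
  by move=> q Bq _ qq; have := B12 q Bq qq; rewrite subr0.
have nI : \forall x \near x0, I x < I x0 + 1.
  move/(@cvg_rnormP _ C): (cI _ wC) => /(_ 1 ltr01); apply: filterS => x.
  move=> /(le_lt_trans (rnorm_Re _)); rewrite ReB -/(I x) -/(I x0).
  by rewrite ltr_norml => /andP[_]; rewrite ltrBlDr addrC.
have nk : \forall x \near x0, rnorm (cintegral (mu (rngU x)) setT k - cintegral (mu (rngU x0)) setT k : C) < e / 2.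
  by move/(@cvg_rnormP _ C): (cI _ kC) => /(_ (e / 2)); apply; rewrite divr_gt0.
near=> x.
have cD := rfiber_closed S_hausdorff (u := grng x).
have mD := borel_closed (t := \val (rngU x)) cD.
have mF := borel_cmeasurable_within (\val (rngU x)) cD (conv_integrand_continuous (x := x) cf cg).
have iF : cintegrable (mu (rngU x)) (rfiber (grng x)) (fun y => f y * g (gmul (ginv y) x)).
  have [Mf Mf0 fM] := Cc_bounded fC; have [Mg Mg0 gM] := Cc_bounded gC.
  apply: (radon_cintegrable S_hausdorff (mu_radon (rngU x)) (K := K) (M := Mf * Mg)) => //.
    by move=> y _; rewrite rnormM ler_pM ?rnorm_ge0.
  by move=> y _ nKy; rewrite (Cc_eq0 nKy) mul0r.
have ik : cintegrable (mu (rngU x)) (rfiber (grng x)) k.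
  exact: Cc_cintegrable.
have -> : conv mu f g x0 = cintegral (mu (rngU x0)) setT k by exact: conv_extensionE.
have kx : cintegral (mu (rngU x)) setT k = cintegral (mu (rngU x)) (rfiber (grng x)) k.
  apply: cintegral_conull => //.
  by apply: borel_cmeasurable; case: kC.
rewrite -[X in X - _](subrK (cintegral (mu (rngU x)) (rfiber (grng x)) k)) -addrA.
apply: le_lt_trans (rnormD _ _) _; rewrite -{2}kx.
rewrite /conv -cintegralB//.
have H1 : rnorm (cintegral (mu (rngU x)) (rfiber (grng x)) (fun y => f y * g (gmul (ginv y) x) - k y) : C) <= d * I x.
  apply: cintegral_le_weight => //; first exact: (cmeasurableB mF (cintegrable_measurable ik)).
  - exact: ltW.
  - by move=> y; case/andP: (w01 y).
  move=> y yx; have [Ky|nKy] := pselect (K y).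
    by rewrite wK// mulr1 ltW//; apply: (near nU x) => //.
  rewrite (k0 y nKy) (Cc_eq0 nKy) mul0r subrr (rnorm0 C).
  by have /andP[wy0 _] := w01 y; exact: mulr_ge0 (ltW d0) wy0.
have H2 : rnorm (cintegral (mu (rngU x)) setT k - cintegral (mu (rngU x0)) setT k : C) < e / 2.
  by near: x.
have H3 : d * I x <= e / 2.
  have : I x < I x0 + 1 by near: x.
  rewrite /d => /ltW Ix; rewrite mulrAC ler_pdivrMr ?ltr_wpDl//.
  by rewrite ler_wpM2l// divr_ge0// ltW.
lra.
Unshelve. all: end_near. Qed.

Lemma conv_Cc (f g : S -> C) : Cc f -> Cc g -> Cc (conv mu f g).
Proof.
move=> fC gC; have [_ cK] := fC; have [_ cL] := gC.
apply: (Cc_compact_support S_hausdorff _ (compact_gmul S_hausdorff cK cL)).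
  exact: conv_continuous.
move=> x nx; rewrite /conv -[RHS](@cintegral0 _ _ _ (mu (rngU x)) (rfiber (grng x))).
apply: eq_cintegral => y yx.
have [fy|/Cc_eq0 ->] := pselect (closure [set x | f x != 0] y); last by rewrite mul0r.
have [gy|/Cc_eq0 ->] := pselect (closure [set x | g x != 0] (gmul (ginv y) x)); last by rewrite mulr0.
exfalso; apply: nx; exists y, (gmul (ginv y) x); split => //.
  by rewrite grngM ?gsrcV// grngV.
by rewrite gmulVK.
Qed.

End convolution.

(** * Square-integrable functions *)

Section L2_seminorm.
Context d (T : measurableType d) (R : realType) (mu : {measure set T -> \bar R}).
Local Notation C := (R[i]^o).
Implicit Types (h k : T -> C).

Definition norm2 h : \bar R := Lnorm mu 2%:E (fun x => (rnorm (h x))%:E).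

Lemma norm2_ge0 h : (0 <= norm2 h)%E.
Proof. exact: Lnorm_ge0. Qed.

Lemma norm2_sqr h : (norm2 h `^ 2 = \int[mu]_x (rnorm (h x) ^+ 2)%:E)%E.
Proof.
rewrite /norm2 poweR_Lnorm//; apply: eq_integral => x _.
by rewrite /= ger0_norm ?rnorm_ge0// powR_mulrn ?rnorm_ge0.
Qed.

Lemma norm2E h : norm2 h = ((\int[mu]_x (rnorm (h x) ^+ 2)%:E) `^ 2^-1)%E.
Proof. by rewrite -norm2_sqr -poweRrM mulfV// poweRe1// norm2_ge0. Qed.

Lemma norm2_leP h (e : R) : 0 <= e ->
  (norm2 h <= e%:E)%E <-> (\int[mu]_x (rnorm (h x) ^+ 2)%:E <= (e ^+ 2)%:E)%E.
Proof.
move=> e0; rewrite -norm2_sqr; have := norm2_ge0 h.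
case: (norm2 h) => [r| |]; last by [].
- by rewrite !lee_fin => r0 /=; rewrite powR_mulrn// ler_pXn2r.
- by move=> _; rewrite poweRyr.
Qed.

Lemma eq_norm2 h k : (forall x, rnorm (h x) = rnorm (k x)) -> norm2 h = norm2 k.
Proof. by move=> hk; apply: eq_Lnorm => x; rewrite hk. Qed.

Lemma le_norm2 h k : cmeasurable setT h -> cmeasurable setT k ->
  (forall x, rnorm (h x) <= rnorm (k x)) -> (norm2 h <= norm2 k)%E.
Proof.
move=> mh mk hk; have := norm2_ge0 k; case e : (norm2 k) => [r| |] // r0; last exact: leey.
apply/norm2_leP => //.
have /norm2_leP : (norm2 k <= r%:E)%E by rewrite e.
move=> /(_ r0); apply: le_trans; apply: ge0_le_integral => //.
- by move=> x _; rewrite lee_fin sqr_ge0.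
- exact: cmeasurable_rnorm_sqr.
- exact: cmeasurable_rnorm_sqr.
- by move=> x _; rewrite lee_fin ler_pXn2r ?nnegrE ?rnorm_ge0.
Qed.

Lemma norm2D h k : cmeasurable setT h -> cmeasurable setT k ->
  (norm2 (fun x => (h x + k x)%R) <= norm2 h + norm2 k)%E.
Proof.
move=> mh mk; have mhk : cmeasurable setT (fun x => h x + k x).
  by have := cmeasurableDZ 1 mh mk; under eq_fun do rewrite mul1r.
have mrh := cmeasurable_rnorm mh; have mrk := cmeasurable_rnorm mk.
have H := minkowski_EFin mu mrh mrk (ler1n R 2).
apply: le_trans H.
(* The sum of absolute values is read as a complex function so that monotonicity of [norm2] applies
   to it. *)
have -> : Lnorm mu 2%:E (EFin \o ((fun x => rnorm (h x)) \+ (fun x => rnorm (k x))))%R =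
    norm2 (fun x => (rnorm (h x) + rnorm (k x))%:C%C).
  by apply: eq_Lnorm => x /=; rewrite rnorm_real ger0_norm// addr_ge0 ?rnorm_ge0.
apply: le_norm2 => //.
  by split => /=; [exact: measurable_funD|exact: measurable_cst].
by move=> x; rewrite rnorm_real (le_trans (rnormD _ _))// ler_norm.
Qed.

Lemma norm2Z (a : C) h : cmeasurable setT h ->
  norm2 (fun x => (a * h x)%R) = ((rnorm a)%:E * norm2 h)%E.
Proof.
move=> mh; have ra := rnorm_ge0 a.
have E : (norm2 (fun x => (a * h x)%R) `^ 2 = ((rnorm a)%:E * norm2 h) `^ 2)%E.
  rewrite norm2_sqr poweRM// ?norm2_ge0// norm2_sqr.
  rewrite (_ : ((rnorm a)%:E `^ 2)%E = (rnorm a ^+ 2)%:E); last by rewrite /= powR_mulrn.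
  rewrite -ge0_integralZl//.
  - by apply: eq_integral => x _; rewrite rnormM exprMn EFinM.
  - exact: cmeasurable_rnorm_sqr.
  - by move=> x _; rewrite lee_fin sqr_ge0.
  - by rewrite lee_fin sqr_ge0.
have := congr1 (fun z => (z `^ 2^-1)%E) E.
have a2 : (0 <= (rnorm a)%:E * norm2 h)%E by rewrite mule_ge0// norm2_ge0.
by rewrite -!poweRrM mulfV// (poweRe1 (norm2_ge0 _)) (poweRe1 a2).
Qed.

Lemma norm2B h k : norm2 (fun x => h x - k x) = norm2 (fun x => k x - h x).
Proof. by apply: eq_norm2 => x; rewrite rnormB. Qed.

Lemma norm2_triangle h k l : cmeasurable setT h -> cmeasurable setT k -> cmeasurable setT l ->
  (norm2 (fun x => (h x - l x)%R) <= norm2 (fun x => (h x - k x)%R) + norm2 (fun x => (k x - l x)%R))%E.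
Proof.
move=> mh mk ml.
rewrite (_ : (fun x => h x - l x) = (fun x => (h x - k x) + (k x - l x))).
  by apply: norm2D; exact: cmeasurableB.
by apply/funext => x; rewrite addrA subrK.
Qed.

Lemma norm2_eq0 h : cmeasurable setT h -> norm2 h = 0%E -> {ae mu, forall x, h x = 0}.
Proof.
move=> mh h0.
have : ((fun x => (rnorm (h x))%:E) = \0 %[ae mu])%E.
  apply: Lnorm_eq0_eq0 h0 => //; apply/measurable_EFinP; exact: cmeasurable_rnorm.
by apply: filterS => x /= /(_ I) [] /eqP; rewrite (@rnorm_eq0 _ C) => /eqP.
Qed.

Lemma norm2_ae_eq h k : cmeasurable setT h -> cmeasurable setT k ->
  {ae mu, forall x, h x = k x} -> norm2 h = norm2 k.
Proof.
move=> mh mk hk; rewrite !norm2E; congr (_ `^ _)%E.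
apply: ae_eq_integral; [exact: measurableT|exact: cmeasurable_rnorm_sqr..|].
by apply: filterS hk => x /= -> _.
Qed.

End L2_seminorm.

Lemma cvg_geometric_increments (R : realType) (u : R ^nat) (M q : R) :
  `|q| < 1 -> (forall n, `|u n.+1 - u n| <= M * q ^+ n) -> cvgn u.
Proof.
move=> q1 uM.
have cvs : cvgn (series (telescope u)).
  apply: normed_cvg; apply: (@series_le_cvg _ _ (geometric M q)).
  - by move=> n /=.
  - by move=> n /=; exact: le_trans (uM n).
  - exact: uM.
  - exact: is_cvg_geometric_series.
rewrite telescopeK in cvs.
rewrite (_ : u = [sequence u n - u 0%N]_n + (fun=> u 0%N)).
  by apply: is_cvgD => //; exact: is_cvg_cst.
by apply/funext => n; rewrite /GRing.add /= subrK.
Qed.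

Lemma limn_esup_EFin (R : realType) (u : R ^nat) : cvgn u ->
  fine (limn_esup (fun n => (u n)%:E)) = limn u.
Proof.
move=> cu; have H : (fun n => (u n)%:E) @ \oo --> (limn u)%:E.
  by apply: cvg_EFin => //; exact: nearW.
by rewrite (cvg_limn_einf_sup H).2.
Qed.

Lemma limn_einf_le (R : realType) (u : (\bar R)^nat) (l : \bar R) :
  (forall n, u n <= l)%E -> (limn_einf u <= l)%E.
Proof.
move=> ul; rewrite limn_einf_lim; apply: lime_le; first exact: is_cvg_einfs.
apply: nearW => n; apply: le_trans (ul n).
by apply: ereal_inf_lbound; exists n => /=.
Qed.

(** * Completeness of L^2 *)

Section L2_complete.
Context d (T : measurableType d) (R : realType) (mu : {measure set T -> \bar R}).
Local Notation C := (R[i]^o).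

Lemma norm2_complete (g : nat -> T -> C) (c : R) : 0 <= c ->
  (forall n, cmeasurable setT (g n)) ->
  (forall n m, (n <= m)%N -> (norm2 mu (fun x => (g n x - g m x)%R) <= (c * (1 / 2) ^+ n)%:E)%E) ->
  exists2 k : T -> C, cmeasurable setT k &
    forall n, (norm2 mu (fun x => (g n x - k x)%R) <= (c * (1 / 2) ^+ n)%:E)%E.
Proof.
move=> c0 mg gc; have h0 n : 0 <= (1 / 2) ^+ n :> R by rewrite exprn_ge0.
(* The weights 2^n make the increments |g_n - g_{n+1}| decay geometrically at
   every point where the sum of the F n is finite. *)
pose F n x := (2 ^+ n * rnorm (g n x - g n.+1 x) ^+ 2)%:E.
have mF n : measurable_fun setT (F n).
  apply/measurable_EFinP; apply: measurable_funM => //; apply: measurable_funX.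
  by apply: cmeasurable_rnorm; exact: cmeasurableB.
have F0 n x : (0 <= F n x)%E by rewrite lee_fin mulr_ge0 ?exprn_ge0 ?rnorm_ge0.
(* The integral is at most 2^n (c 2^-n)^2 = c^2 2^-n, written in the form whose sum over n is
   bounded by 2 c^2. *)
have iF n : (\int[mu]_x F n x <= (2 * c ^+ 2 / (2 ^ n.+1)%:R)%:E)%E.
  under eq_integral do rewrite /F EFinM.
  rewrite ge0_integralZl//; last 2 first.
  - by apply: cmeasurable_rnorm_sqr; exact: cmeasurableB.
  - by move=> x _; rewrite lee_fin sqr_ge0.
  have /norm2_leP := gc n n.+1 (leqnSn n).
  move=> /(_ (mulr_ge0 c0 (h0 n))) H.
  apply: (@le_trans _ _ ((2 ^+ n)%:E * ((c * (1 / 2) ^+ n) ^+ 2)%:E)%E).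
    by rewrite lee_pmul2l// lte_fin exprn_gt0.
  have -> : (1 / 2) ^+ n = (2 ^+ n)^-1 :> R by rewrite mul1r exprVn.
  rewrite -EFinM lee_fin natrX (exprS (2 : R) n); have : 2 ^+ n != 0 :> R by rewrite expf_neq0.
  move: (2 ^+ n) => y y0.
  by rewrite le_eqVlt; apply/orP; left; apply/eqP; field.
pose SF x := (\sum_(0 <= n <oo) F n x)%E.
have mSF : measurable_fun setT SF by apply: ge0_emeasurable_sum.
have iSF : (\int[mu]_x SF x < +oo)%E.
  rewrite integral_nneseries//.
  apply: (@le_lt_trans _ _ (2 * c ^+ 2)%:E); last exact: ltry.
  apply: le_trans (epsilon_trick0 xpredT _); last by rewrite mulr_ge0 ?sqr_ge0.
  apply: lee_nneseries => [n _ _|n _]; last exact: iF.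
  by apply: integral_ge0 => x _; exact: F0.
have aeSF : {ae mu, forall x, SF x \is a fin_num}.
  have : mu.-integrable setT SF.
    apply/integrableP; split => //.
    by under eq_integral do rewrite gee0_abs ?nneseries_ge0//.
  by move=> /(integrable_ae measurableT); apply: filterS => x; exact.
have step x n : SF x \is a fin_num ->
    rnorm (g n.+1 x - g n x) <= Num.sqrt (fine (SF x)) * Num.sqrt (1 / 2) ^+ n.
  move=> SFx; have SF0 : 0 <= fine (SF x) by apply: fine_ge0; exact: nneseries_ge0.
  have FS : (F n x <= SF x)%E.
    apply: le_trans (nneseries_lim_ge n.+1 _); last by move=> ? _ _; exact: F0.
    rewrite big_nat_recr//= leeDr// sume_ge0//; by move=> ? _; exact: F0.
  have s0 : 0 <= Num.sqrt (fine (SF x)) * Num.sqrt (1 / 2) ^+ n.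
    by apply: mulr_ge0; [exact: sqrtr_ge0|apply: exprn_ge0; exact: sqrtr_ge0].
  rewrite -(@ler_pXn2r _ 2 isT) ?nnegrE ?rnorm_ge0//.
  rewrite exprMn sqr_sqrtr// -exprM mulnC exprM sqr_sqrtr//.
  rewrite expr_div_n expr1n mul1r ler_pdivlMr ?exprn_gt0// mulrC rnormB.
  by rewrite -lee_fin fineK.
have q1 : `|Num.sqrt (1 / 2) : R| < 1.
  rewrite ger0_norm ?sqrtr_ge0// -(@ltr_pXn2r _ 2)// ?nnegrE ?sqrtr_ge0// sqr_sqrtr// expr1n.
  by lra.
(* The upper limit is measurable everywhere and agrees with the limit at almost every point, where
   the sequence converges. *)
pose kR x := fine (limn_esup (fun n => (complex.Re (g n x))%:E)).
pose kI x := fine (limn_esup (fun n => (complex.Im (g n x))%:E)).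
have mkR : measurable_fun setT kR.
  apply: (@measurableT_comp _ _ _ _ _ _ fine) => //.
  by apply: measurable_fun_limn_esup => n; apply/measurable_EFinP; case: (mg n).
have mkI : measurable_fun setT kI.
  apply: (@measurableT_comp _ _ _ _ _ _ fine) => //.
  by apply: measurable_fun_limn_esup => n; apply/measurable_EFinP; case: (mg n).
have cvk x : SF x \is a fin_num -> (fun n => g n x) @ \oo --> (Complex (kR x) (kI x) : C).
  move=> SFx; apply: cvg_ReIm => /=.
    have cR : cvgn (fun n => complex.Re (g n x)).
      apply: (cvg_geometric_increments q1) => n.
      by rewrite -ReB; exact: le_trans (rnorm_Re _) (step x n SFx).
    by rewrite /kR limn_esup_EFin.
  have cI : cvgn (fun n => complex.Im (g n x)).
    apply: (cvg_geometric_increments q1) => n.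
    by rewrite -ImB; exact: le_trans (rnorm_Im _) (step x n SFx).
  by rewrite /kI limn_esup_EFin.
exists (fun x => Complex (kR x) (kI x)); first by split.
move=> n; apply/norm2_leP; first by rewrite mulr_ge0.
(* Fatou's lemma along the tail from n turns the Cauchy estimate into the same estimate for the
   limit. *)
pose f m x := (rnorm (g n x - g (n + m)%N x) ^+ 2)%:E.
have mf m : measurable_fun setT (f m).
  by apply: cmeasurable_rnorm_sqr; exact: cmeasurableB.
have f0 m x : setT x -> (0 <= f m x)%E by rewrite lee_fin sqr_ge0.
have mk : cmeasurable setT (fun x => Complex (kR x) (kI x)) by split.
apply: (@le_trans _ _ (\int[mu]_x limn_einf (f^~ x))%E).
  rewrite le_eqVlt; apply/orP; left; apply/eqP; apply: ae_eq_integral => //.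
  - by apply: cmeasurable_rnorm_sqr; exact: cmeasurableB.
  - rewrite (_ : (fun x => limn_einf (f^~ x)) = (fun x => - limn_esup (fun m => - f m x))%E).
      apply: (@measurableT_comp _ _ _ _ _ _ (@oppe R)); first exact: oppe_measurable.
      apply: (measurable_fun_limn_esup (f := fun m x => (- f m x)%E)) => m.
      by apply: (@measurableT_comp _ _ _ _ _ _ (@oppe R)); first exact: oppe_measurable.
    apply/funext => x; rewrite -limn_einfN; congr limn_einf.
    by apply/funext => m; rewrite /f /= opprK.
  - apply: filterS aeSF => x SFx _.
    have H : (fun m => (rnorm (g n x - g (n + m)%N x) ^+ 2)) @ \oo --> (rnorm (g n x - Complex (kR x) (kI x)) ^+ 2).
      have W : (fun m => g n x - g (n + m)%N x : C) @ \oo --> (g n x - Complex (kR x) (kI x) : C).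
        apply: cvgB; first exact: cvg_cst.
        have Sh := cvk x SFx; rewrite -(cvg_shiftn n) in Sh.
        apply: cvg_trans Sh; apply: near_eq_cvg.
        by apply: nearW => m; rewrite /= addnC.
      by apply: cvgX2; exact: (cvg_comp _ _ W (@rnorm_continuous R C _)).
    have HE : f^~ x @ \oo --> (rnorm (g n x - Complex (kR x) (kI x)) ^+ 2)%:E.
      by apply: cvg_EFin => //; exact: nearW.
    by rewrite (cvg_limn_einf_sup HE).1.
apply: le_trans (fatou mu measurableT mf f0) _.
apply: limn_einf_le => m.
have /norm2_leP := gc n (n + m)%N (leq_addr _ _).
by apply; rewrite mulr_ge0.
Qed.

End L2_complete.

(** * Density of [Cc] in L^2 *)

Section L2_density.
Variables (R : realType) (X : topologicalType) (t : X).
Local Notation C := (R[i]^o).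
Hypothesis hX : hausdorff_space X.
Hypothesis lX : locally_compact [set: X].
Variable mu : borel_measure R t.
Hypothesis mu_radon : radon mu.
Implicit Types (h k : X -> C).
Local Notation n2 h := (norm2 mu h).

Lemma CcDZ (a : C) h k : Cc h -> Cc k -> Cc (fun x => a * h x + k x).
Proof.
move=> [ch cK] [ck cL].
apply: (Cc_compact_support hX _ (compactU cK cL)).
  by move=> x; apply: cvgD; [apply: cvgM; [exact: cvg_cst|exact: ch]|exact: ck].
move=> x /not_orP[nK nL].
by rewrite (Cc_eq0 nK) (Cc_eq0 nL) mulr0 addr0.
Qed.

Lemma Cc0 : Cc (fun _ : X => 0 : C).
Proof.
apply: (Cc_compact_support hX _ (@compact0 X)) => //.
by move=> x; exact: cvg_cst.
Qed.

Lemma Cc_cmeasurable h : Cc h -> cmeasurable (setT : set (borel t)) h.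
Proof. by move=> [ch _]; exact: borel_cmeasurable. Qed.

Definition Cc_approx h := forall e : R, 0 < e ->
  exists2 g : X -> C, Cc g & (n2 (fun x => (h x - g x)%R) <= e%:E)%E.

Lemma Cc_approxDZ (a : C) h k : cmeasurable (setT : set (borel t)) h ->
  cmeasurable (setT : set (borel t)) k ->
  Cc_approx h -> Cc_approx k -> Cc_approx (fun x => a * h x + k x).
Proof.
move=> mh mk ah ak e e0.
have a1 : 0 < rnorm a + 1 by rewrite ltr_wpDl// rnorm_ge0.
have [|g gC hg] := ah (e / 2 / (rnorm a + 1)); first by rewrite !divr_gt0.
have [|l lC kl] := ak (e / 2); first by rewrite divr_gt0.
exists (fun x => a * g x + l x); first exact: CcDZ.
have mg := Cc_cmeasurable gC; have ml := Cc_cmeasurable lC.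
rewrite (_ : (fun x => _) = (fun x => a * (h x - g x) + (k x - l x))); last first.
  by apply/funext => x; ring.
apply: (@le_trans _ _ (n2 (fun x => (a * (h x - g x))%R) + n2 (fun x => (k x - l x)%R))%E).
  apply: norm2D; last exact: cmeasurableB.
  have := cmeasurableDZ a (cmeasurableB mh mg) (cmeasurable_cst setT 0).
  by under eq_fun do rewrite addr0.
rewrite norm2Z; last exact: cmeasurableB.
rewrite (splitr e) EFinD leeD//.
apply: (@le_trans _ _ ((rnorm a)%:E * (e / 2 / (rnorm a + 1))%:E)%E).
  by apply: lee_wpmul2l => //; rewrite lee_fin rnorm_ge0.
rewrite -EFinM lee_fin mulrA ler_pdivrMr//.
have ra := rnorm_ge0 a; nra.
Qed.

Lemma Cc_approx_limit h : cmeasurable (setT : set (borel t)) h ->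
  (forall e : R, 0 < e -> exists2 k : X -> C,
    cmeasurable (setT : set (borel t)) k /\ Cc_approx k & (n2 (fun x => (h x - k x)%R) <= e%:E)%E) ->
  Cc_approx h.
Proof.
move=> mh H e e0; have e2 : 0 < e / 2 by rewrite divr_gt0.
have [k [mk ak] hk] := H _ e2; have [g gC kg] := ak _ e2.
exists g => //; apply: le_trans (norm2_triangle mu mh mk (Cc_cmeasurable gC)) _.
by rewrite (splitr e) EFinD leeD.
Qed.

Lemma Cc_approx_indic (B : set X) : measurable (B : set (borel t)) -> (mu B < +oo)%E ->
  Cc_approx (fun x => (\1_B x)%:C%C).
Proof.
move=> mB Bfin e e0; have d0 : 0 < e ^+ 2 / 2 by rewrite divr_gt0// exprn_gt0.
have Bf : mu B \is a fin_num by rewrite ge0_fin_numE.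
have [U [oU BU] muU] : exists2 U, open U /\ B `<=` U & (mu U < mu B + (e ^+ 2 / 2)%:E)%E.
  have [|_ [U [oU BU] <-] UB] := @lb_ereal_inf_adherent R
    [set mu U | U in [set U : set X | open U /\ B `<=` U]] _ d0.
    by rewrite -(radon_outer mu_radon mB).
  by exists U => //; rewrite -(radon_outer mu_radon mB) in UB.
have Uf : mu U \is a fin_num.
  by rewrite ge0_fin_numE// (lt_trans muU)// lte_add_pinfty// ltry.
(* Inner regularity holds for open sets only, so the compact set is taken inside [U] and not inside
   [B]. The squared error is then at most the sum of the indicators of U minus K and U minus B, each
   of measure at most e^2 / 2. *)
have [K [cK KU] muK] : exists2 K, compact K /\ K `<=` U & (mu U - (e ^+ 2 / 2)%:E < mu K)%E.
  have [|_ [K [cK KU] <-] UK] := @ub_ereal_sup_adherent R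
    [set mu K | K in [set K : set X | compact K /\ K `<=` U]] _ d0.
    by rewrite -(radon_inner mu_radon oU).
  by exists K => //; rewrite -(radon_inner mu_radon oU) in UK.
have [g [L [cg cL LU g01 [gK gL]]]] := @urysohn_compact R X hX lX K U cK oU KU.
have gC : Cc (fun x => (g x)%:C%C : C).
  apply: (Cc_compact_support hX _ cL); last by move=> x /gL ->.
  by apply: continuous_ReIm => //; move=> x; exact: cvg_cst.
exists (fun x => (g x)%:C%C : C) => //.
apply/norm2_leP; first exact: ltW.
have mU := borel_open (t := t) oU; have mK := borel_compact (t := t) hX cK.
have mUK : measurable (U `\` K : set (borel t)) by exact: measurableD.
have mUB : measurable (U `\` B : set (borel t)) by exact: measurableD.
apply: (@le_trans _ _ (\int[mu]_x ((\1_(U `\` K) x)%:E + (\1_(U `\` B) x)%:E))%E).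
  apply: ge0_le_integral => //.
  - by move=> x _; rewrite lee_fin sqr_ge0.
  - apply: cmeasurable_rnorm_sqr.
    apply: cmeasurableB; last exact: Cc_cmeasurable.
    by split => /=; [exact: measurable_indic|exact: measurable_cst].
  - by apply: emeasurable_funD; apply/measurable_EFinP; exact: measurable_indic.
  move=> x _; rewrite -EFinD lee_fin -rmorphB rnorm_real real_normK ?num_real//.
  have /andP[g0 g1] := g01 x.
  have [Ux|nUx] := pselect (U x); last first.
    rewrite gL; last by move=> /LU.
    by rewrite !indicE !memNset; [rewrite subrr expr0n/= addr0|move=> []|move=> []|move=> /BU].
  have [Kx|nKx] := pselect (K x); have [Bx|nBx] := pselect (B x).
  - by rewrite gK// !indicE mem_set// !memNset; [rewrite subrr expr0n/= addr0|move=> []|move=> []].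
  - rewrite gK// !indicE memNset// memNset; last by move=> [].
    by rewrite mem_set//= sub0r sqrrN expr1n add0r.
  - rewrite !indicE mem_set// mem_set// memNset; last by move=> [].
    by rewrite addr0 /=; nra.
  - rewrite !indicE memNset// mem_set// mem_set//= sub0r sqrrN.
    by nra.
rewrite ge0_integralD//; last 2 first.
- by apply/measurable_EFinP; exact: measurable_indic.
- by apply/measurable_EFinP; exact: measurable_indic.
rewrite !integral_indic// !setIT.
rewrite (_ : e ^+ 2 = e ^+ 2 / 2 + e ^+ 2 / 2); last by rewrite -splitr.
have Ulty : (mu U < +oo)%E by rewrite -ge0_fin_numE.
have Kf : mu K \is a fin_num by rewrite ge0_fin_numE// (radon_compact mu_radon).
rewrite EFinD; apply: leeD.
  have -> : (mu (U `\` K) = mu U - mu K)%E by rewrite measureD// (setIidr KU).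
  case: (mu U) Uf muK => [a| |]// _; case: (mu K) Kf => [b| |]// _.
  by rewrite -!EFinB !lte_fin !lee_fin; lra.
have -> : (mu (U `\` B) = mu U - mu B)%E by rewrite measureD// (setIidr BU).
case: (mu U) Uf muU => [a| |]// _; case: (mu B) Bf => [b| |]// _.
by rewrite -EFinB -EFinD !lte_fin !lee_fin; lra.
Qed.

Lemma Cc_approx0 : Cc_approx (fun=> 0).
Proof.
move=> e e0; exists (fun=> 0); first exact: Cc0.
apply/norm2_leP; first exact: ltW.
under eq_integral do rewrite subrr (rnorm0 C) expr0n/=.
by rewrite integral0 lee_fin sqr_ge0.
Qed.

Import HBNNSimple.

Lemma Cc_approx_simple (f : {nnsfun borel t >-> R}) :
  (\int[mu]_x (f x ^+ 2)%:E < +oo)%E -> Cc_approx (fun x => (f x)%:C%C).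
Proof.
move=> foo.
(* Induction over an arbitrary list of values, not only over the range of [f]. *)
suff H (s : seq R) : Cc_approx (fun x => (\sum_(y <- s) y * \1_(f @^-1` [set y]) x)%:C%C).
  have := H (finmap.enum_fset (fset_set (range f))); congr Cc_approx.
  by apply/funext => x; rewrite [in RHS]fimfunE fsbig_finite.
elim: s => [|y s IH].
  rewrite (_ : (fun x => _) = (fun=> 0)); first exact: Cc_approx0.
  by apply/funext => x; rewrite big_nil.
(* The level set of the value 0 may have infinite measure; its term vanishes and is dropped. *)
have [->|y0] := eqVneq y 0.
  rewrite (_ : (fun x => _) =
    (fun x => (\sum_(y <- s) y * \1_(f @^-1` [set y]) x)%:C%C)) //.
  by apply/funext => x; rewrite big_cons mul0r add0r.
rewrite (_ : (fun x => _) = (fun x => y%:C%C * (\1_(f @^-1` [set y]) x)%:C%C +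
    (\sum_(y <- s) y * \1_(f @^-1` [set y]) x)%:C%C)); last first.
  by apply/funext => x; rewrite big_cons rmorphD rmorphM.
have mB : measurable (f @^-1` [set y]) by exact: measurable_sfunP.
apply: Cc_approxDZ => //.
- by split => /=; [exact: measurable_indic|exact: measurable_cst].
- split => /=; last exact: measurable_cst.
  by apply: measurable_sum => z; apply: measurable_funM => //; exact: measurable_indic.
apply: Cc_approx_indic => //.
rewrite -(setIT (f @^-1` _)) -integral_indic//.
(* Chebyshev's inequality: on this level set, y^-2 f^2 equals 1. *)
apply: (@le_lt_trans _ _ (\int[mu]_x ((y ^- 2)%:E * (f x ^+ 2)%:E))%E).
  apply: ge0_le_integral => //.
  - by apply/measurable_EFinP; exact: measurable_indic.
  - by apply/measurable_EFinP; apply: measurable_funM => //; exact: measurable_funX.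
  move=> x _; rewrite -EFinM lee_fin indicE.
  have [fx|nfx] := pselect (f x = y); last first.
    by rewrite memNset// mulr_ge0 ?sqr_ge0// invr_ge0 sqr_ge0.
  by rewrite mem_set// fx mulVf// expf_neq0.
rewrite ge0_integralZl//.
- by rewrite lte_mul_pinfty// lee_fin invr_ge0 sqr_ge0.
- by apply/measurable_EFinP; exact: measurable_funX.
- by move=> x _; rewrite lee_fin sqr_ge0.
- by rewrite lee_fin invr_ge0 sqr_ge0.
Qed.

(** Simple functions increase to [h], and the squared errors are dominated by the integrable h^2. *)
Lemma Cc_approx_nonneg (h : X -> R) : measurable_fun (setT : set (borel t)) h ->
  (forall x, 0 <= h x) -> (\int[mu]_x (h x ^+ 2)%:E < +oo)%E ->
  Cc_approx (fun x => (h x)%:C%C).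
Proof.
move=> mh h0 hoo; have mEh : measurable_fun (setT : set (borel t)) (EFin \o h).
  exact/measurable_EFinP.
pose f := nnsfun_approx measurableT mEh.
have fcvg x : (fun n => f n x) @ \oo --> h x.
  have H : EFin \o (fun n => f n x) @ \oo --> (EFin \o h) x.
    by apply: (cvg_nnsfun_approx measurableT mEh) => // y _ /=; rewrite lee_fin.
  exact: (fine_cvg H).
have fle n x : f n x <= h x.
  have nd : nondecreasing_seq (fun n => f n x).
    by move=> m k mk; have /lefP := nd_nnsfun_approx measurableT mEh mk; exact.
  have := @nondecreasing_cvgn_le _ (fun n => f n x) nd _ n.
  rewrite (cvg_lim _ (fcvg x))//; apply.
  by rewrite ?(cvg_lim _ (fcvg x))//; exact: fcvg.
have f0 n x : 0 <= f n x by [].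
apply: Cc_approx_limit => [|e e0].
  by split => //=; exact: measurable_cst.
have mfn n : measurable_fun setT (f n) by exact: measurable_funP.
have ih2 : mu.-integrable setT (fun x => (h x ^+ 2)%:E).
  apply/integrableP; split; first by apply/measurable_EFinP; exact: measurable_funX.
  by under eq_integral do rewrite gee0_abs ?lee_fin ?sqr_ge0//.
have d1 n : measurable_fun (setT : set (borel t)) (fun x => ((h x - f n x) ^+ 2)%:E).
  by apply/measurable_EFinP; apply: measurable_funX; exact: measurable_funB.
have d2 : {ae mu, forall x, (setT : set (borel t)) x -> (fun n => ((h x - f n x) ^+ 2)%:E) @ \oo --> 0%E}.
  apply: nearW => x _; apply: cvg_EFin; first exact: nearW.
  have -> : (0 : R) = (h x - h x) ^+ 2 by rewrite subrr expr0n.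
  by apply: cvgX2; apply: cvgB; [exact: cvg_cst|exact: fcvg].
have d3 : {ae mu, forall x n, (setT : set (borel t)) x -> (`|((h x - f n x) ^+ 2)%:E| <= (h x ^+ 2)%:E)%E}.
  apply: nearW => x n _; rewrite gee0_abs lee_fin ?sqr_ge0//.
  by rewrite ler_pXn2r// ?nnegrE ?subr_ge0// gerBl.
have [_ _] := dominated_convergence measurableT d1 (measurable_cst _) d2 ih2 d3.
rewrite integral0 => cv.
have e20 : (0 < (e ^+ 2)%:E :> \bar R)%E by rewrite lte_fin exprn_gt0.
have [N _ /(_ N (leqnn N)) HN] : \forall n \near \oo, (\int[mu]_x ((h x - f n x) ^+ 2)%:E < (e ^+ 2)%:E)%E.
  have nb : nbhs (0%E : \bar R) [set y | (y < (e ^+ 2)%:E)%E].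
    by apply: open_nbhs_nbhs; split => //; exact: open_ereal_lt_ereal.
  exact: (cv _ nb).
exists (fun x => (f N x)%:C%C).
  split; first by split => //=; exact: measurable_cst.
  apply: Cc_approx_simple; apply: le_lt_trans hoo; apply: ge0_le_integral => //.
  - by move=> x _; rewrite lee_fin sqr_ge0.
  - by apply/measurable_EFinP; exact: measurable_funX.
  - by apply/measurable_EFinP; exact: measurable_funX.
  - by move=> x _; rewrite lee_fin ler_pXn2r// nnegrE.
apply/norm2_leP; first exact: ltW.
under eq_integral do rewrite -rmorphB rnorm_real real_normK ?num_real//.
exact: ltW.
Qed.

Lemma Cc_dense h : cmeasurable (setT : set (borel t)) h -> (n2 h < +oo)%E -> Cc_approx h.
Proof.
move=> mh hoo; have [mR mI] := mh.
have Qoo : (\int[mu]_x (rnorm (h x) ^+ 2)%:E < +oo)%E.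
  by rewrite -norm2_sqr poweR_lty.
have real (r : X -> R) : measurable_fun (setT : set (borel t)) r ->
    (forall x, `|r x| <= rnorm (h x)) -> Cc_approx (fun x => (r x)%:C%C).
  move=> mr rh.
  have pos (s : X -> R) : measurable_fun (setT : set (borel t)) s ->
      (forall x, 0 <= s x <= `|r x|) -> Cc_approx (fun x => (s x)%:C%C).
    move=> ms s0r; apply: Cc_approx_nonneg => //; first by move=> x; case/andP: (s0r x).
    apply: le_lt_trans Qoo; apply: ge0_le_integral => //.
    - by move=> x _; rewrite lee_fin sqr_ge0.
    - by apply/measurable_EFinP; exact: measurable_funX.
    - exact: cmeasurable_rnorm_sqr.
    move=> x _; have /andP[s0 sr] := s0r x.
    by rewrite lee_fin ler_pXn2r// ?nnegrE ?rnorm_ge0// (le_trans sr).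
  have mnr : measurable_fun (setT : set (borel t)) (fun x => `|r x|).
    exact: measurableT_comp.
  rewrite (_ : (fun x => _) = (fun x => (-1) * (((`|r x| - r x) / 2)%:C%C) + ((`|r x| + r x) / 2)%:C%C)); last first.
    by apply/funext => x; rewrite mulN1r -rmorphN -rmorphD; congr (_%:C%C); field.
  have bnd x : - `|r x| <= r x <= `|r x| by rewrite -ler_norml.
  have m1 : measurable_fun (setT : set (borel t)) (fun x => (`|r x| - r x) / 2).
    by apply: measurable_funM => //; exact: measurable_funB.
  have m2 : measurable_fun (setT : set (borel t)) (fun x => (`|r x| + r x) / 2).
    by apply: measurable_funM => //; exact: measurable_funD.
  apply: Cc_approxDZ.
  - by split => //=; exact: measurable_cst.
  - by split => //=; exact: measurable_cst.
  - by apply: pos => // x; have /andP[] := bnd x; lra.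
  - by apply: pos => // x; have /andP[] := bnd x; lra.
rewrite (_ : h = (fun x => 'i%C * (complex.Im (h x))%:C%C + (complex.Re (h x))%:C%C)); last first.
  by apply/funext => x; rewrite addrC -complexE.
apply: Cc_approxDZ.
- by split => //=; exact: measurable_cst.
- by split => //=; exact: measurable_cst.
- by apply: real => // x; exact: rnorm_Im.
- by apply: real => // x; exact: rnorm_Re.
Qed.

End L2_density.

(** * Bounded extension of operators from [Cc] to L^2 *)

Section L2_extension.
Variables (R : realType) (X : topologicalType) (t : X).
Local Notation C := (R[i]^o).
Hypothesis hX : hausdorff_space X.
Hypothesis lX : locally_compact [set: X].
Variable nu : borel_measure R t.
Hypothesis nu_radon : radon nu.
Implicit Types (f g h k : X -> C).
Local Notation n2 h := (norm2 nu h).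

Lemma borel_aeS (P Q : X -> Prop) : (forall x, P x -> Q x) ->
  {ae nu, forall x, P x} -> {ae nu, forall x, Q x}.
Proof. by apply: (@filterS _ _ (@ae_filter_ringOfSetsType _ (borel t) R nu)). Qed.

Definition square_integrable h := cmeasurable (setT : set (borel t)) h /\ (n2 h < +oo)%E.

Lemma Cc_square_integrable g : Cc g -> square_integrable g.
Proof.
move=> gC; split; first exact: Cc_cmeasurable.
have [M M0 gM] := Cc_bounded gC; have [_ cK] := gC.
set K := closure _ in cK.
have mK := borel_compact (t := t) hX cK; have Koo := radon_compact nu_radon cK.
have Kf : nu K \is a fin_num by rewrite ge0_fin_numE.
apply: (@le_lt_trans _ _ (Num.sqrt (M ^+ 2 * fine (nu K)))%:E); last exact: ltry.
apply/norm2_leP; first exact: sqrtr_ge0.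
rewrite sqr_sqrtr; last by rewrite mulr_ge0 ?sqr_ge0// fine_ge0.
apply: (@le_trans _ _ (\int[nu]_x ((M ^+ 2)%:E * (\1_K x)%:E))%E).
  apply: ge0_le_integral => //.
  - by move=> x _; rewrite lee_fin sqr_ge0.
  - apply: cmeasurable_rnorm_sqr.
    exact: Cc_cmeasurable.
  - by apply/measurable_EFinP; apply: measurable_funM => //; exact: measurable_indic.
  move=> x _; rewrite -EFinM lee_fin indicE; have [Kx|nKx] := pselect (K x).
    by rewrite mem_set// mulr1 ler_pXn2r// ?nnegrE ?rnorm_ge0// ltW.
  by rewrite (Cc_eq0 nKx) (rnorm0 C) expr0n/= mulr_ge0 ?sqr_ge0.
rewrite ge0_integralZl//.
- by rewrite integral_indic// setIT -[X in (_ * X <= _)%E](fineK Kf) -EFinM.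
- by apply/measurable_EFinP; exact: measurable_indic.
- by rewrite lee_fin sqr_ge0.
Qed.

Lemma square_integrableDZ (a : C) h k : square_integrable h -> square_integrable k ->
  square_integrable (fun x => a * h x + k x).
Proof.
move=> [mh hoo] [mk koo]; split; first exact: cmeasurableDZ.
have mah : cmeasurable (setT : set (borel t)) (fun x => a * h x).
  have := cmeasurableDZ a mh (cmeasurable_cst setT 0).
  by under eq_fun do rewrite addr0.
apply: le_lt_trans (norm2D nu mah mk) _.
rewrite norm2Z// lte_add_pinfty// lte_mul_pinfty// lee_fin; exact: rnorm_ge0.
Qed.

Lemma square_integrableB h k : square_integrable h -> square_integrable k ->
  square_integrable (fun x => h x - k x).
Proof.
move=> ih ik; have := square_integrableDZ (-1) ik ih.
by rewrite (_ : (fun x => h x - k x) = (fun x => -1 * k x + h x))//;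
  apply/funext => x; rewrite mulN1r addrC.
Qed.

Lemma norm2_fin h : square_integrable h -> n2 h = (fine (n2 h))%:E.
Proof. by move=> [_ hoo]; rewrite fineK// ge0_fin_numE// norm2_ge0. Qed.

Lemma fine_norm2_ge0 h : 0 <= fine (n2 h).
Proof. by apply: fine_ge0; exact: norm2_ge0. Qed.

Variable K : (X -> C) -> (X -> C).
Hypothesis K_Cc : forall g, Cc g -> Cc (K g).
Hypothesis K_linear : forall (a : C) g h, Cc g -> Cc h ->
  K (fun x => a * g x + h x) = (fun x => a * K g x + K h x).

Definition Cc_opnorm : \bar R :=
  ereal_sup [set n2 (K g) | g in [set g | Cc g /\ (n2 g <= 1)%E]].

(** The content of [Ind_delta], for a single measure and with an arbitrary linear operator [K] on
    [Cc] in place of convolution by f. *)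
Definition extends_to (T : (X -> C) -> (X -> C)) : Prop :=
  [/\ forall h, square_integrable h -> square_integrable (T h),
      forall (a : C) h k, square_integrable h -> square_integrable k ->
        {ae nu, forall x, T (fun x => a * h x + k x) x = a * T h x + T k x},
      exists M : R, forall h, square_integrable h -> (n2 (T h) <= M%:E * n2 h)%E &
      forall g, Cc g -> {ae nu, forall x, T g x = K g x}].

Lemma Cc_opnorm_ge0 : (0 <= Cc_opnorm)%E.
Proof.
apply: (@le_trans _ _ (n2 (K (fun=> 0)))); first exact: norm2_ge0.
apply: ereal_sup_ubound; exists (fun=> 0) => //; split; first exact: Cc0.
by rewrite (_ : n2 _ = 0%E)// /norm2; under eq_Lnorm do rewrite (rnorm0 C); rewrite Lnorm0.
Qed.

Lemma Cc_opnorm_bound (s : R) g : Cc_opnorm = s%:E -> Cc g ->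
  (n2 (K g) <= s%:E * n2 g)%E.
Proof.
move=> sE gC; have s0 : 0 <= s by rewrite -lee_fin -sE Cc_opnorm_ge0.
have ig := Cc_square_integrable gC; have iKg := Cc_square_integrable (K_Cc gC).
have g0 := fine_norm2_ge0 g.
rewrite (norm2_fin ig) -EFinM; apply/lee_addgt0Pr => e e0.
(* Scaling by the norm of [g] fails when it is 0, so a slightly larger number is used; the excess
   costs s e / (s + 1), which is at most e. *)
pose c := fine (n2 g) + e / (s + 1).
have c0 : 0 < c by rewrite ltr_wpDl// divr_gt0// ltr_wpDl.
have C0 : Cc (fun _ : X => 0 : C) by exact: Cc0.
(* The summand 0 gives [l] the shape to which [K_linear] applies. *)
pose l : X -> C := fun x => (c^-1)%:C%C * g x + 0.
have lC : Cc l by exact: CcDZ.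
have mZ (h : X -> C) : (fun x => (c^-1)%:C%C * h x + 0) = (fun x => (c^-1)%:C%C * h x).
  by apply/funext => x; rewrite addr0.
have rc : rnorm ((c^-1)%:C%C : C) = c^-1 by rewrite rnorm_real ger0_norm// invr_ge0 ltW.
have K0 : K (fun=> 0) = (fun=> 0).
  have := K_linear (-1) C0 C0; rewrite (_ : (fun x : X => -1 * 0 + 0 : C) = (fun=> 0)); last first.
    by apply/funext => x; rewrite mulr0 addr0.
  by move=> ->; apply/funext => x; rewrite mulN1r addNr.
have lK : n2 (K l) = ((c^-1)%:E * n2 (K g))%E.
  rewrite /l K_linear// K0 mZ norm2Z ?rc//; by case: iKg.
have l1 : (n2 l <= 1)%E.
  rewrite /l mZ norm2Z ?rc//; last by case: ig.
  rewrite (norm2_fin ig) -EFinM lee_fin ler_pdivrMl// mulr1 /c lerDl.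
  by rewrite divr_ge0 ?ltW// ltr_wpDl.
have : (n2 (K l) <= s%:E)%E by rewrite -sE; apply: ereal_sup_ubound; exists l.
rewrite lK (norm2_fin iKg) -EFinM -EFinD !lee_fin ler_pdivrMl// => H.
apply: le_trans H _; rewrite /c mulrDl mulrC lerD2l.
rewrite mulrAC ler_pdivrMr ?ltr_wpDl// ler_wpM2l// ?ltW//.
by rewrite ltr_pwDr.
Qed.

(** A bounded extension makes [K] bounded on the unit ball of [Cc], and density of [Cc] prevents the
    supremum over the unit ball of L^2 from being larger. *)
Lemma extends_opnorm T : extends_to T ->
  Cc_opnorm \is a fin_num /\
  ereal_sup [set n2 (T h) | h in [set h | square_integrable h /\ (n2 h <= 1)%E]] = Cc_opnorm.
Proof.
move=> [T2 TD [M TM] TK].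
have TKn g : Cc g -> n2 (T g) = n2 (K g).
  move=> gC; have ig := Cc_square_integrable gC; have iKg := Cc_square_integrable (K_Cc gC).
  apply: norm2_ae_eq; [by case: (T2 _ ig)|by case: iKg|exact: TK].
have sM : (Cc_opnorm <= `|M|%:E)%E.
  apply: ge_ereal_sup => _ [g [gC g1] <-]; rewrite -TKn//.
  apply: le_trans (TM _ (Cc_square_integrable gC)) _.
  apply: (@le_trans _ _ (`|M|%:E * n2 g)%E).
    by apply: lee_wpmul2r; [exact: norm2_ge0|rewrite lee_fin ler_norm].
  by rewrite -[leRHS]mule1; apply: lee_wpmul2l => //; rewrite lee_fin.
have sf : Cc_opnorm \is a fin_num.
  by rewrite ge0_fin_numE ?Cc_opnorm_ge0// (le_lt_trans sM)// ltry.
split => //; apply/eqP; rewrite eq_le; apply/andP; split; last first.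
  apply: ge_ereal_sup => _ [g [gC g1] <-]; rewrite -TKn//.
  by apply: ereal_sup_ubound; exists g => //; split => //; exact: Cc_square_integrable.
apply: ge_ereal_sup => _ [h [ih h1] <-].
have [mh hoo] := ih; have sE := esym (fineK sf).
set s := fine Cc_opnorm in sE; have s0 : 0 <= s by rewrite -lee_fin -sE Cc_opnorm_ge0.
rewrite sE; apply/lee_addgt0Pr => e e0.
(* With [g] within [d] of [h], the norm of T h is at most |M| d + s (1 + d), and this is at most s +
   e. *)
pose d := e / (`|M| + s + 1).
have D0 : 0 < `|M| + s + 1 by rewrite ltr_wpDl// addr_ge0.
have d0 : 0 < d by rewrite divr_gt0.
have [g gC hg] := Cc_dense hX lX nu_radon mh hoo d0.
have ig := Cc_square_integrable gC.
have ihg := square_integrableB ih ig.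
have [mg _] := ig; have [mTh _] := T2 _ ih; have [mTg _] := T2 _ ig.
have [mThg _] := T2 _ ihg.
have eTh : n2 (T h) = n2 (fun x => T (fun x => h x - g x) x + T g x).
  have m2 : cmeasurable (setT : set (borel t)) (fun x => T (fun x => h x - g x) x + T g x).
    have := cmeasurableDZ 1 mThg mTg; by under eq_fun do rewrite mul1r.
  apply: norm2_ae_eq => //.
  have := TD 1 _ _ ihg ig.
  have -> : (fun x => 1 * (h x - g x) + g x) = h.
    by apply/funext => x; rewrite mul1r subrK.
  by apply: borel_aeS => x ->; rewrite mul1r.
rewrite eTh; apply: le_trans (norm2D nu mThg mTg) _.
have b1 : (n2 (T (fun x => (h x - g x)%R)) <= (`|M| * d)%:E)%E.
  apply: le_trans (TM _ ihg) _; rewrite EFinM.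
  apply: (@le_trans _ _ (`|M|%:E * n2 (fun x => (h x - g x)%R))%E).
    by apply: lee_wpmul2r; [exact: norm2_ge0|rewrite lee_fin ler_norm].
  by apply: lee_wpmul2l => //; rewrite lee_fin.
have gn : (n2 g <= (1 + d)%:E)%E.
  have -> : n2 g = n2 (fun x => h x + (g x - h x)).
    by apply: eq_norm2 => x; congr rnorm; ring.
  apply: le_trans (norm2D nu mh (cmeasurableB mg mh)) _.
  by rewrite EFinD leeD// norm2B.
have b2 : (n2 (T g) <= (s * (1 + d))%:E)%E.
  rewrite TKn//; apply: le_trans (Cc_opnorm_bound sE gC) _.
  by rewrite EFinM; apply: lee_wpmul2l => //; rewrite lee_fin.
apply: le_trans (leeD b1 b2) _; rewrite -!EFinD lee_fin.
have dE : d * (`|M| + s + 1) = e by rewrite /d mulfVK// gt_eqF.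
nra.
Qed.

(* The graph of the extension of K to L^2. *)
Definition Cc_closure_graph h k : Prop := forall e : R, 0 < e ->
  exists2 g, Cc g & (n2 (fun x => (h x - g x)%R) <= e%:E)%E /\
                    (n2 (fun x => (k x - K g x)%R) <= e%:E)%E.

Lemma Cc_closure_graphDZ (a : C) h k h' k' : square_integrable h -> square_integrable k ->
  square_integrable h' -> square_integrable k' ->
  Cc_closure_graph h k -> Cc_closure_graph h' k' ->
  Cc_closure_graph (fun x => a * h x + h' x) (fun x => a * k x + k' x).
Proof.
move=> ih ik ih' ik' hk hk' e e0.
have ra := rnorm_ge0 a; have a1 : 0 < rnorm a + 1 by rewrite ltr_wpDl.
have key (u v u' v' : X -> C) : square_integrable u -> square_integrable v ->
    square_integrable u' -> square_integrable v' ->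
    (n2 (fun x => (u x - v x)%R) <= (e / (rnorm a + 1))%:E)%E ->
    (n2 (fun x => (u' x - v' x)%R) <= (e / (rnorm a + 1))%:E)%E ->
    (n2 (fun x => ((a * u x + u' x) - (a * v x + v' x))%R) <= e%:E)%E.
  move=> iu iv iu' iv' uv uv'.
  rewrite (_ : (fun x => _) = (fun x => a * (u x - v x) + (u' x - v' x))); last first.
    by apply/funext => x; ring.
  have [muv _] := square_integrableB iu iv; have [muv' _] := square_integrableB iu' iv'.
  have mau : cmeasurable (setT : set (borel t)) (fun x => a * (u x - v x)).
    have := cmeasurableDZ a muv (cmeasurable_cst setT 0).
    by under eq_fun do rewrite addr0.
  apply: le_trans (norm2D nu mau muv') _; rewrite norm2Z//.
  apply: (@le_trans _ _ ((rnorm a)%:E * (e / (rnorm a + 1))%:E + (e / (rnorm a + 1))%:E)%E).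
    by apply: leeD => //; apply: lee_wpmul2l => //; rewrite lee_fin.
  rewrite -EFinM -EFinD lee_fin -{2}[e / _]mul1r -mulrDl mulrCA mulfV ?mulr1//.
  by rewrite gt_eqF.
have [|g gC [hg kg]] := hk (e / (rnorm a + 1)); first by rewrite divr_gt0.
have [|g' gC' [hg' kg']] := hk' (e / (rnorm a + 1)); first by rewrite divr_gt0.
exists (fun x => a * g x + g' x); first exact: CcDZ.
split; last rewrite K_linear//; by apply: key => //;
  apply: Cc_square_integrable => //; exact: K_Cc.
Qed.

Lemma Cc_closure_graph_bound (s : R) h k : Cc_opnorm = s%:E ->
  square_integrable h -> square_integrable k ->
  Cc_closure_graph h k -> (n2 k <= s%:E * n2 h)%E.
Proof.
move=> sE ih ik hk; have s0 : 0 <= s by rewrite -lee_fin -sE Cc_opnorm_ge0.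
rewrite (norm2_fin ih) -EFinM; apply/lee_addgt0Pr => e e0.
have s1 : 0 < s + 1 by rewrite ltr_wpDl.
have [|g gC [hg kg]] := hk (e / (s + 1)); first by rewrite divr_gt0.
have ig := Cc_square_integrable gC; have iKg := Cc_square_integrable (K_Cc gC).
have [mh _] := ih; have [mk _] := ik; have [mg _] := ig; have [mKg _] := iKg.
have -> : n2 k = n2 (fun x => (k x - K g x) + K g x).
  by apply: eq_norm2 => x; rewrite subrK.
apply: le_trans (norm2D nu (cmeasurableB mk mKg) mKg) _.
have gn : (n2 g <= (fine (n2 h) + e / (s + 1))%:E)%E.
  have -> : n2 g = n2 (fun x => h x + (g x - h x)).
    by apply: eq_norm2 => x; congr rnorm; ring.
  apply: le_trans (norm2D nu mh (cmeasurableB mg mh)) _.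
  by rewrite (norm2_fin ih) EFinD leeD// norm2B.
have Kg : (n2 (K g) <= (s * (fine (n2 h) + e / (s + 1)))%:E)%E.
  apply: le_trans (Cc_opnorm_bound sE gC) _.
  by rewrite EFinM; apply: lee_wpmul2l => //; rewrite lee_fin.
apply: le_trans (leeD kg Kg) _; rewrite -!EFinD lee_fin.
rewrite mulrDr addrCA lerD2l -{1}[e / _]mul1r -mulrDl addrC mulrCA mulfV ?mulr1//.
by rewrite gt_eqF.
Qed.

Lemma Cc_closure_graph_unique (s : R) h k k' : Cc_opnorm = s%:E ->
  square_integrable h -> square_integrable k -> square_integrable k' ->
  Cc_closure_graph h k -> Cc_closure_graph h k' -> {ae nu, forall x, k x = k' x}.
Proof.
move=> sE ih ik ik' hk hk'.
have H := Cc_closure_graphDZ (-1) ih ik' ih ik hk' hk.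
have iD : square_integrable (fun x => -1 * k' x + k x) by exact: square_integrableDZ.
have i0 : square_integrable (fun x => -1 * h x + h x) by exact: square_integrableDZ.
have := Cc_closure_graph_bound sE i0 iD H.
have -> : n2 (fun x => -1 * h x + h x) = 0%E.
  rewrite (_ : n2 _ = n2 (fun=> 0)); last by apply: eq_norm2 => x; rewrite mulN1r addNr.
  by rewrite /norm2; under eq_Lnorm do rewrite (rnorm0 C); rewrite Lnorm0.
rewrite mule0 => D0.
have : n2 (fun x => -1 * k' x + k x) = 0%E.
  by apply/eqP; rewrite eq_le D0 norm2_ge0.
move=> /norm2_eq0; case: iD => mD _ => /(_ mD); apply: borel_aeS => x.
by rewrite mulN1r addrC => /eqP; rewrite subr_eq0 => /eqP.
Qed.

(** Approximants of [h] in [Cc] at rate 2^-n have images under [K] that form a Cauchy sequence with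
    rate 2 s 2^-n; the partner of [h] is their limit. *)
Lemma Cc_closure_graph_total (s : R) h : Cc_opnorm = s%:E -> square_integrable h ->
  exists2 k, square_integrable k & Cc_closure_graph h k.
Proof.
move=> sE ih; have s0 : 0 <= s by rewrite -lee_fin -sE Cc_opnorm_ge0.
have [mh hoo] := ih.
have h0 n : 0 < (1 / 2) ^+ n :> R by rewrite exprn_gt0.
have /choice[g gP] n : exists g, Cc g /\ (n2 (fun x => (h x - g x)%R) <= ((1 / 2) ^+ n)%:E)%E.
  by have [g gC hg] := Cc_dense hX lX nu_radon mh hoo (h0 n); exists g.
have gC n : Cc (g n) by case: (gP n).
have hg n : (n2 (fun x => (h x - g n x)%R) <= ((1 / 2) ^+ n)%:E)%E by case: (gP n).
have mg n : cmeasurable (setT : set (borel t)) (g n) by exact: Cc_cmeasurable.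
have mono n m : (n <= m)%N -> (1 / 2) ^+ m <= (1 / 2) ^+ n :> R.
  by move=> nm; apply: ler_wiXn2l => //; lra.
have KB n m : K (fun x => g n x - g m x) = (fun x => K (g n) x - K (g m) x).
  have -> : (fun x => g n x - g m x) = (fun x => -1 * g m x + g n x).
    by apply/funext => x; rewrite mulN1r addrC.
  by rewrite K_linear//; apply/funext => x; rewrite mulN1r addrC.
have cau n m : (n <= m)%N ->
    (n2 (fun x => (K (g n) x - K (g m) x)%R) <= (s * 2 * (1 / 2) ^+ n)%:E)%E.
  move=> nm; rewrite -KB.
  have gnm : Cc (fun x => g n x - g m x).
    have := CcDZ hX (-1) (gC m) (gC n).
    by rewrite (_ : (fun x => _) = (fun x => g n x - g m x))//;
      apply/funext => x; rewrite mulN1r addrC.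
  apply: le_trans (Cc_opnorm_bound sE gnm) _.
  rewrite -mulrA EFinM; apply: lee_wpmul2l; first by rewrite lee_fin.
  apply: le_trans (norm2_triangle nu (mg n) mh (mg m)) _.
  rewrite norm2B mulrDl mul1r EFinD; apply: leeD => //.
  by apply: le_trans (hg m) _; rewrite lee_fin mono.
have [|k mk kP] := norm2_complete _ (fun n => Cc_cmeasurable t (K_Cc (gC n))) cau.
  by rewrite mulr_ge0.
have ik : square_integrable k.
  have iK0 := Cc_square_integrable (K_Cc (gC 0%N)); have [mK0 K0oo] := iK0.
  split => //; have -> : n2 k = n2 (fun x => K (g 0%N) x + (k x - K (g 0%N) x)).
    by apply: eq_norm2 => x; congr rnorm; ring.
  apply: le_lt_trans (norm2D nu mK0 (cmeasurableB mk mK0)) _.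
  rewrite lte_add_pinfty// norm2B; apply: le_lt_trans (kP 0%N) _; exact: ltry.
exists k => // e e0.
(* The constant dominates both rates, 1 for the approximants and 2 s for their images. *)
have [n ne] : exists n, (s * 2 + 1) * (1 / 2) ^+ n <= e.
  have c : (fun n => (s * 2 + 1) * (1 / 2) ^+ n) @ \oo --> 0.
    rewrite -[X in _ --> X](mulr0 (s * 2 + 1)); apply: cvgM; first exact: cvg_cst.
    by apply: cvg_expr; rewrite ger0_norm; lra.
  have [N _ /(_ N (leqnn N)) /=] := (cvgrPdist_le _ _).1 c e e0.
  rewrite sub0r normrN => H; exists N; apply: le_trans H; exact: ler_norm.
have hn := ltW (h0 n).
exists (g n) => //; split.
  by apply: le_trans (hg n) _; rewrite lee_fin; apply: le_trans ne; nra.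
rewrite norm2B; apply: le_trans (kP n) _; rewrite lee_fin; apply: le_trans ne; nra.
Qed.

(** Any choice of partners along the graph works: it need not be linear pointwise, but uniqueness of
    partners makes it linear almost everywhere. *)
Lemma extension_exists : Cc_opnorm \is a fin_num -> exists T, extends_to T.
Proof.
move=> sf; have sE := esym (fineK sf); set s := fine _ in sE.
have /choice[T TP] h : exists k, square_integrable h ->
    square_integrable k /\ Cc_closure_graph h k.
  have [ih|nih] := pselect (square_integrable h); last by exists h.
  by have [k ik hk] := Cc_closure_graph_total sE ih; exists k.
exists T; split.
- by move=> h /TP[].
- move=> a h k ih ik; have iahk := square_integrableDZ a ih ik.
  have [iT PT] := TP _ iahk; have [iTh PTh] := TP _ ih; have [iTk PTk] := TP _ ik.
  apply: (Cc_closure_graph_unique sE iahk iT) PT _; first exact: square_integrableDZ.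
  exact: Cc_closure_graphDZ.
- by exists s => h ih; have [iTh PTh] := TP _ ih; exact: Cc_closure_graph_bound.
- move=> g gC; have ig := Cc_square_integrable gC; have [iTg PTg] := TP _ ig.
  have iKg := Cc_square_integrable (K_Cc gC).
  apply: (Cc_closure_graph_unique sE ig iTg iKg) => // e e0; exists g => //.
  have Z (l : X -> C) : (n2 (fun x => (l x - l x)%R) <= e%:E)%E.
    rewrite (_ : n2 _ = n2 (fun=> 0)); last by apply: eq_norm2 => x; rewrite subrr.
    rewrite /norm2; under eq_Lnorm do rewrite (rnorm0 C).
    by rewrite Lnorm0// lee_fin ltW.
  by split; exact: Z.
Qed.

End L2_extension.

(** * The reduced norm in terms of [Cc] *)

Section reduced_norm.
Variables (R : realType) (S : topologicalGroupoidType).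
Hypothesis S_hausdorff : hausdorff_space S.
Hypothesis S_locally_compact : locally_compact [set: S].
Variable mu : measure_family R S.
Hypothesis mu_radon : forall u, radon (mu u).
Hypothesis mu_conull : forall u, mu u (~` rfiber (\val u)) = 0%E.
Local Notation C := (R[i]^o).
Hypothesis mu_continuous : forall k : S -> C, Cc k ->
  continuous (fun u : unit_space S => cintegral (mu u) setT k : C).

(** Inversion is an involutive homeomorphism, so it exchanges the open and compact sets that occur
    in the regularity conditions. *)
Lemma mu_src_radon (u : unit_space S) : radon (mu_src mu u).
Proof.
have VK (B : set S) : ginv @^-1` (ginv @^-1` B) = B.
  by apply/seteqP; split => x /=; rewrite ginvK.
have oV (U : set S) : open U -> open (ginv @^-1` U).
  by move=> oU; apply: open_comp => // x _; exact: ginv_continuous.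
split.
- by move=> K cK; apply: (radon_compact (mu_radon u)); exact: compact_ginv.
- move=> B mB; have mVB : measurable (ginv @^-1` B : set (borel (\val u))).
    by have := ginv_measurable (S := S) (u := \val u) measurableT mB; rewrite setTI.
  rewrite -[LHS]/(mu u (ginv @^-1` B)) (radon_outer (mu_radon u) mVB).
  congr ereal_inf; apply/seteqP; split => _ [U [oU BU] <-].
    exists (ginv @^-1` U); first by split; [exact: oV|rewrite -(VK B) => x /= /BU].
    by rewrite -[LHS]/(mu u (ginv @^-1` (ginv @^-1` U))) VK.
  by exists (ginv @^-1` U) => //; split; [exact: oV|move=> x /= /BU].
- move=> U oU.
  rewrite -[LHS]/(mu u (ginv @^-1` U)) (radon_inner (mu_radon u) (oV _ oU)).
  congr ereal_sup; apply/seteqP; split => _ [K [cK KU] <-].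
    exists (ginv @^-1` K); first by split; [exact: compact_ginv|rewrite -(VK U) => x /= /KU].
    by rewrite -[LHS]/(mu u (ginv @^-1` (ginv @^-1` K))) VK.
  by exists (ginv @^-1` K) => //; split; [exact: compact_ginv|move=> x /= /KU].
Qed.

Lemma conv_integrable (f g : S -> C) x : Cc f -> Cc g ->
  cintegrable (mu (rngU x)) (rfiber (grng x)) (fun y => f y * g (gmul (ginv y) x)).
Proof.
move=> fC gC; have [cf cK] := fC; have [cg _] := gC.
have cD := rfiber_closed S_hausdorff (u := grng x).
have [Mf Mf0 fM] := Cc_bounded fC; have [Mg Mg0 gM] := Cc_bounded gC.
apply: (radon_cintegrable S_hausdorff (mu_radon (rngU x)) (M := Mf * Mg) cD cK).
- exact: (borel_cmeasurable_within (\val (rngU x)) cD (conv_integrand_continuous (x := x) cf cg)).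
- by move=> y _; rewrite rnormM ler_pM ?rnorm_ge0.
- by move=> y _ nKy; rewrite (Cc_eq0 nKy) mul0r.
Qed.

Lemma convDZr (f : S -> C) (a : C) g h : Cc f -> Cc g -> Cc h ->
  conv mu f (fun x => a * g x + h x) = (fun x => a * conv mu f g x + conv mu f h x).
Proof.
move=> fC gC hC; apply/funext => x; rewrite /Defs.conv.
rewrite -cintegralDZ; [|by apply: borel_closed; exact: rfiber_closed|exact: conv_integrable..].
by apply: eq_cintegral => y _; ring.
Qed.

Lemma Ind_deltaP (u : unit_space S) f T :
  Ind_delta mu u f T <-> extends_to (mu_src mu u) (conv mu f) T.
Proof.
have L2P h : L2 mu u h <-> square_integrable (mu_src mu u) h.
  by split=> [[mR mI hoo]|[[mR mI] hoo]].
split=> [[[TL TD [M TM]] TK]|[TL TD [M TM] TK]].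
  split => //; last by exists M => h /L2P; exact: TM.
  - by move=> h /L2P /TL /L2P.
  - by move=> a h k /L2P ih /L2P; exact: TD.
split => //; split => //; last by exists M => h /L2P; exact: TM.
- by move=> h /L2P /TL /L2P.
- by move=> a h k /L2P ih /L2P; exact: TD.
Qed.

Lemma L2_opnormE (u : unit_space S) T : L2_opnorm mu u T =
  ereal_sup [set norm2 (mu_src mu u) (T h) |
    h in [set h | square_integrable (mu_src mu u) h /\ (norm2 (mu_src mu u) h <= 1)%E]].
Proof.
rewrite /L2_opnorm; congr ereal_sup; apply/seteqP; split => _ [h [ih h1] <-];
  exists h => //; split => //; first by case: ih => mR mI hoo.
by case: ih => -[mR mI] hoo.
Qed.

(* The extension Ind delta_u (f) exists exactly when [conv mu f] is bounded on Cc
   for the L^2-norm, hence the condition [e \is a fin_num]. *)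
Lemma reduced_normE f : Cc f -> reduced_norm mu f =
  esup0 [set e | exists u, e \is a fin_num /\ e = Cc_opnorm (mu_src mu u) (conv mu f)].
Proof.
move=> fC; congr esup0.
have fK g : Cc g -> Cc (conv mu f g) by exact: conv_Cc.
have fD (a : C) g h : Cc g -> Cc h ->
  conv mu f (fun x => a * g x + h x) = (fun x => a * conv mu f g x + conv mu f h x).
  exact: convDZr.
apply/seteqP; split => e /=.
  move=> [u [T [/Ind_deltaP fT ->]]]; exists u; rewrite L2_opnormE.
  by have [fin ->] := extends_opnorm S_hausdorff S_locally_compact (mu_src_radon u) fK fD fT.
move=> [u [fin eE]]; rewrite eE in fin *.
have [T fT] := extension_exists S_hausdorff S_locally_compact (mu_src_radon u) fK fD fin.
exists u, T; split; first exact/Ind_deltaP.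
rewrite L2_opnormE.
by have [_ ->] := extends_opnorm S_hausdorff S_locally_compact (mu_src_radon u) fK fD fT.
Qed.

End reduced_norm.

(** * Isomorphism of completions *)

Section dense_isomorphism.
Variable R : realType.
Local Notation C := (R[i]^o).

Section star_norm.
Variable A : cstar_algebra R.

Lemma cmulBl (x y z : A) : cmul (x - y) z = cmul x z - cmul y z.
Proof. by rewrite [x - y]addrC -[- y]scaleN1r cmul_linearl scaleN1r addrC. Qed.

Lemma cmulBr (x y z : A) : cmul x (y - z) = cmul x y - cmul x z.
Proof. by rewrite [y - z]addrC -[- z]scaleN1r cmul_linearr scaleN1r addrC. Qed.

Lemma cstarB (x y : A) : cstar (x - y) = cstar x - cstar y.
Proof.
rewrite [x - y]addrC -[- y]scaleN1r cstar_semilinear addrC.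
by rewrite (rmorphN1 (@conjc R)) scaleN1r.
Qed.

Lemma rnorm_cmul (x y : A) : rnorm (cmul x y) <= rnorm x * rnorm y.
Proof. by rewrite -lecR rmorphM/= !rnormC cnormM. Qed.

(** The C*-identity and submultiplicativity bound the norm of y by that of its adjoint; the
    involution gives the converse. *)
Lemma rnorm_cstar (x : A) : rnorm (cstar x) = rnorm x.
Proof.
have H (y : A) : rnorm y <= rnorm (cstar y).
  have [->|y0] := eqVneq (rnorm y) 0; first exact: rnorm_ge0.
  have yp : 0 < rnorm y by rewrite lt_def y0 rnorm_ge0.
  rewrite -(ler_pM2r yp); apply: le_trans (rnorm_cmul _ _).
  by rewrite -lecR rmorphM/= !rnormC cnorm_star expr2.
by apply/eqP; rewrite eq_le H andbT -{2}[x]cstarK H.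
Qed.

End star_norm.

Section two_algebras.
Variables (X : Type) (V : set X) (lin : C -> X -> X -> X) (m : X -> X -> X) (st : X -> X).
Hypothesis Vlin : forall a f g, V f -> V g -> V (lin a f g).
Hypothesis Vm : forall f g, V f -> V g -> V (m f g).
Hypothesis Vst : forall f, V f -> V (st f).

(** The dense subalgebra is an abstract set with operations, so that both completions can be indexed
    by the functions on the first groupoid, although those of the second have another type. *)
Definition dense_star_morphism (A : cstar_algebra R) (j : X -> A) : Prop :=
  [/\ forall a f g, V f -> V g -> j (lin a f g) = a *: j f + j g,
      forall f g, V f -> V g -> j (m f g) = cmul (j f) (j g),
      forall f, V f -> j (st f) = cstar (j f) &
      dense (j @` V)].

(* The graph of the isomorphism that extends j f |-> k f to the completions. *)
Definition joint_limit (A B : cstar_algebra R) (j : X -> A) (k : X -> B) (a : A) (b : B) :=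
  forall e : R, 0 < e -> exists2 f, V f & rnorm (a - j f) < e /\ rnorm (b - k f) < e.

Lemma joint_limit_sym (A B : cstar_algebra R) (j : X -> A) (k : X -> B) a b :
  joint_limit j k a b -> joint_limit k j b a.
Proof. by move=> ab e /ab[f Vf [? ?]]; exists f. Qed.

Section relation.
Variables (A B : cstar_algebra R) (j : X -> A) (k : X -> B).
Hypothesis (jP : dense_star_morphism j) (kP : dense_star_morphism k).
Hypothesis jk : forall f, V f -> rnorm (j f) = rnorm (k f).

Lemma joint_limit_lin (z : C) a b a' b' : joint_limit j k a b -> joint_limit j k a' b' ->
  joint_limit j k (z *: a + a') (z *: b + b').
Proof.
move=> ab ab' e e0; have [jl _ _ _] := jP; have [kl _ _ _] := kP.
have z0 := rnorm_ge0 z.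
have d0 : 0 < e / (rnorm z + 1) by rewrite divr_gt0//; lra.
have [f Vf [af bf]] := ab _ (divr_gt0 d0 (ltr0n _ 2)).
have [g Vg [ag bg]] := ab' _ (divr_gt0 e0 (ltr0n _ 2)).
have H (W : normedModType R[i]) (x y x' y' : W) : rnorm (x - y) < e / (rnorm z + 1) / 2 ->
    rnorm (x' - y') < e / 2 -> rnorm (z *: x + x' - (z *: y + y')) < e.
  move=> h h'; have -> : z *: x + x' - (z *: y + y') = z *: (x - y) + (x' - y').
    by rewrite scalerBr opprD addrACA.
  apply: le_lt_trans (rnormD _ _) _; rewrite rnormZ.
  have : rnorm z * rnorm (x - y) <= (rnorm z + 1) * (e / (rnorm z + 1) / 2).
    apply: ler_pM => //; [exact: rnorm_ge0|lra|exact: ltW].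
  have -> : (rnorm z + 1) * (e / (rnorm z + 1) / 2) = e / 2 by field; apply/eqP; lra.
  lra.
exists (lin z f g); first exact: Vlin.
by rewrite jl// kl//; split; apply: H.
Qed.

Lemma joint_limit_mul a b a' b' : joint_limit j k a b -> joint_limit j k a' b' ->
  joint_limit j k (cmul a a') (cmul b b').
Proof.
move=> ab ab' e e0; have [_ jm _ _] := jP; have [_ km _ _] := kP.
pose M := rnorm a + rnorm a' + rnorm b + rnorm b' + 1.
have [a0 a'0 b0 b'0] : [/\ 0 <= rnorm a, 0 <= rnorm a', 0 <= rnorm b & 0 <= rnorm b'].
  by split; exact: rnorm_ge0.
have M0 : 0 < M by rewrite /M; lra.
(* The bound 1 keeps the approximants below the norms of their limits plus 1; the bound e / M makes
   the two error terms of a product add up to less than e, in either algebra. *)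
pose d := Num.min 1 (e / M).
have d0 : 0 < d by rewrite lt_min ltr01 divr_gt0.
have d1 : d <= 1 by rewrite ge_min lexx.
have dM : d * M <= e by rewrite -ler_pdivlMr// ge_min lexx orbT.
have [f Vf [af bf]] := ab _ d0.
have [g Vg [ag bg]] := ab' _ d0.
have H (W : cstar_algebra R) (x y x' y' : W) : rnorm x + rnorm x' + 1 <= M ->
    rnorm (x - y) < d -> rnorm (x' - y') < d -> rnorm (cmul x x' - cmul y y') < e.
  move=> xM h h'.
  have -> : cmul x x' - cmul y y' = cmul (x - y) x' + cmul y (x' - y').
    by rewrite cmulBl cmulBr addrA subrK.
  have y1 : rnorm y <= rnorm x + 1.
    have -> : y = x - (x - y) by rewrite opprB addrC subrK.
    by apply: le_trans (rnormD _ _) _; rewrite rnormN lerD2l; lra.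
  apply: le_lt_trans (rnormD _ _) _.
  have [x0 x'0] : 0 <= rnorm x /\ 0 <= rnorm x' by split; exact: rnorm_ge0.
  have h1 : rnorm (cmul (x - y) x') <= d * rnorm x'.
    by apply: le_trans (rnorm_cmul _ _) _; apply: ler_wpM2r => //; exact: ltW.
  have h2 : rnorm (cmul y (x' - y')) < (rnorm x + 1) * d.
    apply: le_lt_trans (rnorm_cmul _ _) _.
    apply: (@le_lt_trans _ _ ((rnorm x + 1) * rnorm (x' - y'))).
      by apply: ler_wpM2r => //; exact: rnorm_ge0.
    by rewrite ltr_pM2l//; lra.
  have h3 : d * (rnorm x + rnorm x' + 1) <= d * M by rewrite ler_pM2l.
  nra.
exists (m f g); first exact: Vm.
rewrite jm// km//; split; apply: H => //; rewrite /M; lra.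
Qed.

Lemma joint_limit_star a b : joint_limit j k a b -> joint_limit j k (cstar a) (cstar b).
Proof.
move=> ab e e0; have [_ _ js _] := jP; have [_ _ ks _] := kP.
have [f Vf [af bf]] := ab _ e0.
exists (st f); first exact: Vst.
by rewrite js// ks// -!cstarB !rnorm_cstar.
Qed.

Lemma joint_limit_norm a b : joint_limit j k a b -> rnorm a = rnorm b.
Proof.
move=> ab; apply/eqP; rewrite -subr_eq0 -normr_le0; apply/ler_addgt0Pl => e e0; rewrite addr0.
have [f Vf [af bf]] := ab _ (divr_gt0 e0 (ltr0n _ 2)).
have H (W : normedModType R[i]) (x y : W) : `|rnorm x - rnorm y| <= rnorm (x - y).
  rewrite ler_norml; apply/andP; split.
    by rewrite lerNl opprB lerBlDr rnormB -{1}[y](subrK x) rnormD.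
  by rewrite lerBlDr -{1}[x](subrK y) rnormD.
have -> : rnorm a - rnorm b = (rnorm a - rnorm (j f)) + (rnorm (k f) - rnorm b) by rewrite jk//; ring.
apply: le_trans (ler_normD _ _) _; rewrite (splitr e); apply: lerD.
  exact: (le_trans (H _ _ _) (ltW af)).
by rewrite distrC; exact: (le_trans (H _ _ _) (ltW bf)).
Qed.

(** Subtracting the two pairs relates 0 to b' - b, and related elements have equal norms. *)
Lemma joint_limit_unique a b b' : joint_limit j k a b -> joint_limit j k a b' -> b = b'.
Proof.
move=> ab ab'; have H := joint_limit_norm (joint_limit_lin (-1) ab ab').
have {}H : rnorm (-1 *: b + b') = 0 by rewrite -H scaleN1r addNr (rnorm0 A).
by move/eqP: H; rewrite (@rnorm_eq0 _ B) scaleN1r addrC subr_eq0 => /eqP.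
Qed.

(** If j f_n tends to [a], then k f_n is Cauchy, since [j] and [k] give differences of elements of
    [V] the same norm; its limit is the partner of [a]. *)
Lemma joint_limit_total a : exists b, joint_limit j k a b.
Proof.
have [jl _ _ jd] := jP; have [kl _ _ _] := kP.
have /choice[f fP] n : exists f, V f /\ rnorm (a - j f) < n.+1%:R^-1.
  have n0 : (0 : R) < n.+1%:R^-1 by rewrite invr_gt0.
  have nA : nbhs a [set y | rnorm (y - a) < n.+1%:R^-1] by apply/nbhs_rnorm; exists n.+1%:R^-1.
  have [y [ya [g Vg gy]]] : (interior [set y : A | rnorm (y - a) < n.+1%:R^-1] `&` j @` V) !=set0.
    by apply: jd; [exists a; exact: nA|exact: open_interior].
  by exists g; split => //; rewrite rnormB gy; exact: (interior_subset ya : _ < _).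
have kB g h : V g -> V h -> rnorm (k g - k h) = rnorm (j g - j h).
  move=> Vg Vh; have := jk (Vlin (-1) Vh Vg).
  by rewrite jl// kl// !scaleN1r [- j h + _]addrC [- k h + _]addrC => ->.
have small (r : R) : 0 < r -> \forall n \near \oo, rnorm (a - j (f n)) < r.
  move=> r0; near=> n; apply: lt_trans (fP n).2 _.
  by near: n; exact: near_infty_natSinv_lt (PosNum r0).
have : cauchy ((fun n => k (f n)) @ \oo).
  apply: cauchy_exP => e e0.
  have eE : (rnorm (e : C))%:C%C = e by rewrite (@rnormC _ C); exact: gtr0_norm.
  have r0 : 0 < rnorm (e : C) by rewrite -ltcR eE.
  have [N _ /= HN] := small _ (divr_gt0 r0 (ltr0n _ 2)).
  exists (k (f N)); exists N => // n Nn /=.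
  rewrite -ball_normE /= -eE -rnormC ltcR kB; [|exact: (fP _).1..].
  have -> : j (f N) - j (f n) = (a - j (f n)) - (a - j (f N)).
    by rewrite opprB [RHS]addrC addrA subrK.
  apply: le_lt_trans (rnormD _ _) _; rewrite rnormN.
  by have := HN _ Nn; have := HN N (leqnn N); lra.
move=> /cauchy_cvg kc; exists (lim ((fun n => k (f n)) @ \oo)) => e e0.
have kl' : \forall n \near \oo, rnorm (k (f n) - lim ((fun n => k (f n)) @ \oo)) < e.
  by apply: (kc [set y : B | rnorm (y - _) < e]); apply/nbhs_rnorm; exists e.
near \oo => n; exists (f n); first exact: (fP n).1.
split; first by near: n; exact: small.
by rewrite rnormB; near: n.
Unshelve. all: by end_near. Qed.

End relation.

Lemma dense_star_isomorphic (A B : cstar_algebra R) (j : X -> A) (k : X -> B) :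
  dense_star_morphism j -> dense_star_morphism k ->
  (forall f, V f -> rnorm (j f) = rnorm (k f)) -> star_isomorphic A B.
Proof.
move=> jP kP jk; have kj f : V f -> rnorm (k f) = rnorm (j f) by move=> /jk.
have /choice[Phi PhiP] := joint_limit_total jP kP jk.
have /choice[Psi PsiP] := joint_limit_total kP jP kj.
exists Phi; split.
- move=> z a a'; apply: (joint_limit_unique jP kP jk (PhiP _)).
  exact: joint_limit_lin.
- move=> a a'; apply: (joint_limit_unique jP kP jk (PhiP _)).
  exact: joint_limit_mul.
- move=> a; apply: (joint_limit_unique jP kP jk (PhiP _)).
  exact: joint_limit_star.
exists Psi.
- move=> a; apply: (joint_limit_unique kP jP kj (PsiP _)).
  exact: joint_limit_sym.
- move=> b; apply: (joint_limit_unique jP kP jk (PhiP _)).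
  exact: joint_limit_sym.
Qed.

End two_algebras.
End dense_isomorphism.

(** * Transport along a bijection of dense subalgebras *)

Section transport.
Variables (R : realType) (S S' : topologicalGroupoidType).
Variables (mu : measure_family R S) (mu' : measure_family R S').
Local Notation C := (R[i]^o).
Variables (V : set (S -> C)) (V' : set (S' -> C)).

Definition star_morphism (F : (S -> C) -> (S' -> C)) : Prop :=
  [/\ forall f, V f -> V' (F f),
      forall (a : C) f g, V f -> V g -> F (fun x => a * f x + g x) = (fun x => a * F f x + F g x),
      forall f g, V f -> V g -> F (conv mu f g) = conv mu' (F f) (F g) &
      forall f, V f -> F (gstar f) = gstar (F f)].

Lemma completions_isomorphic F N N' (A A' : cstar_algebra R)
    (j : (S -> C) -> A) (j' : (S' -> C) -> A') :
  star_morphism F -> (forall f', V' f' -> exists2 f, V f & F f = f') ->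
  (forall (a : C) f g, V f -> V g -> V (fun x => a * f x + g x)) ->
  (forall f g, V f -> V g -> V (conv mu f g)) -> (forall f, V f -> V (gstar f)) ->
  (forall f, V f -> N f = N' (F f)) ->
  is_completion mu V N j -> is_completion mu' V' N' j' -> star_isomorphic A A'.
Proof.
move=> [FV Flin Fm Fs] Fsurj Vlin Vm Vs NN' [jlin jm js jN jd] [klin km ks kN kd].
apply: (dense_star_isomorphic Vlin Vm Vs (j := j) (k := j' \o F)).
- by split.
- split.
  + by move=> a f g Vf Vg; rewrite /= Flin// klin//; exact: FV.
  + by move=> f g Vf Vg; rewrite /= Fm// km//; exact: FV.
  + by move=> f Vf; rewrite /= Fs// ks//; exact: FV.
  + rewrite (_ : _ @` V = j' @` V')//; apply/seteqP; split => [_ [f Vf <-]|_ [f' Vf' <-]].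
      by exists (F f) => //; exact: FV.
    by have [f Vf <-] := Fsurj _ Vf'; exists f.
- by move=> f Vf; apply: EFin_inj; rewrite jN// NN'// -kN//; exact: FV.
Qed.

End transport.

(** Composition with F' carries representations of [V] to representations of V'. Only one inequality
    is stated; the other follows by exchanging the two algebras. *)
Lemma full_norm_le (R : realType) (S S' : topologicalGroupoidType)
    (mu : measure_family R S) (mu' : measure_family R S')
    (V : set (S -> R[i]^o)) (V' : set (S' -> R[i]^o)) F F' f :
  star_morphism mu' mu V' V F' -> (forall g', V' g' -> I_norm mu (F' g') = I_norm mu' g') ->
  F' (F f) = f ->
  (full_norm mu V f <= full_norm mu' V' (F f))%E.
Proof.
move=> [FV Flin Fm Fs] FI FK; rewrite /full_norm /esup0; apply: ub_ereal_sup => e [->|].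
  by apply: ereal_sup_ubound; left.
move=> [H [L [[Lc Ll Lm Ls] LI ->]]]; apply: ereal_sup_ubound; right.
exists H, (L \o F'); split.
- split.
  + by move=> g Vg; exact: Lc (FV _ Vg).
  + by move=> a g h x Vg Vh; rewrite /= Flin// Ll//; exact: FV.
  + by move=> g h x Vg Vh; rewrite /= Fm// Lm//; exact: FV.
  + by move=> g x y Vg; rewrite /= Fs// Ls//; exact: FV.
- by move=> g Vg; rewrite /= -FI//; exact: LI (FV _ Vg).
- by rewrite /= FK.
Qed.

(** * Equivariant functions on a twist *)

Section twisted_algebra.
Variables (R : realType) (Gam : topologicalZmodType).
Hypothesis Gam_hausdorff : hausdorff_space Gam.
Hypothesis Gam_compact : compact [set: Gam].
Variables (lam : borel_measure R (0 : Gam)) (lam_haar : normalised_haar lam).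
Variables (G : topologicalGroupoidType) (G_hausdorff : hausdorff_space G).
Hypothesis G_locally_compact : locally_compact [set: G].
Variables (lambda : measure_family R G) (lambda_haar : haar_system lambda).
Variables (S : topologicalGroupoidType).
Variables (iota : trivial_bundle G Gam -> S) (p : S -> G).
Hypothesis tw : gamma_twist iota p.
Variables (mu : measure_family R S) (mu_induced : induced_haar_system iota p lam lambda mu).
Local Notation C := (R[i]^o).
Local Notation pU u := (rngU (p (\val u))).
Local Notation act := (twist_act iota p).
Implicit Types (u : unit_space S).

Let hS : hausdorff_space S := twist_hausdorff tw.
Let lS : locally_compact [set: S] := twist_locally_compact tw.

(** * The Haar system of [G] as the image of the induced one *)

Lemma twist_pU u : \val (pU u) = p (\val u).
Proof. by rewrite /= -(hom_rng (twist_p_hom tw)) unitUP. Qed.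

Lemma lambda_conull (v : unit_space G) : lambda v (~` rfiber (\val v)) = 0%E.
Proof.
apply: (radon_null_open G_hausdorff (haar_system_radon lambda_haar v)).
  by apply: closed_openC; exact: rfiber_closed.
by move=> x nx; rewrite (haar_system_support lambda_haar).
Qed.

Lemma mu_radon u : radon (mu u).
Proof. by have [] := mu_induced u. Qed.

(** Properness of [p] puts the composite in [Cc]; in the defining formula of [mu] the inner integral
    is then that of a constant against a probability measure. *)
Lemma twist_integral_Cc u (h : G -> C) : Cc h ->
  cintegral (mu u) setT (h \o p) = cintegral (lambda (pU u)) setT h.
Proof.
move=> hC; have [s sp] := twist_section tw.
have [_ /(_ s sp) mE] := mu_induced u.
have hpC : Cc (h \o p).
  apply: (Cc_compact_support hS
    (K := p @^-1` closure [set x | h x != 0])).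
  - move=> x; apply: continuous_comp; first exact: (twist_p_continuous tw).
    by case: hC => + _; exact.
  - by apply: (twist_p_proper tw) => //; case: hC.
  - by move=> x; exact: Cc_eq0.
have rE : rfiber (p (\val u)) = rfiber (\val (pU u)) by rewrite twist_pU.
rewrite mE// rE.
rewrite [RHS](@cintegral_conull _ _ _ _ (rfiber (\val (pU u)))).
- apply: eq_cintegral => g _; rewrite -[RHS](haar_cst lam_haar).
  by apply: eq_cintegral => a _ /=; rewrite (twist_act_p tw) sp.
- by apply: borel_closed; exact: rfiber_closed.
- exact: lambda_conull.
- by apply: borel_cmeasurable; case: hC.
Qed.

Lemma p_measurable u :
  measurable_fun setT (p : borel (\val u) -> borel (\val (pU u))).
Proof. exact: (@continuous_borel S G (\val u) (\val (pU u)) p (twist_p_continuous tw)). Qed.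

(** A Urysohn function below [U] and its composite with [p] have equal integrals. Sandwiching both
    between measures of compact and open sets gives the two inequalities by inner regularity. *)
Lemma twist_measure_open u (U : set G) : open U ->
  lambda (pU u) U = mu u (p @^-1` U).
Proof.
move=> oU.
have rad := haar_system_radon lambda_haar (pU u).
have opU : open (p @^-1` U) by apply: open_comp => // x _; exact: (twist_p_continuous tw).
have key (K : set G) : compact K -> K `<=` U ->
    (lambda (pU u) K <= mu u (p @^-1` U) /\ mu u (p @^-1` K) <= lambda (pU u) U)%E.
  move=> cK KU.
  have [g [L [cg cL LU g01 [gK gL]]]] := @urysohn_compact R G G_hausdorff G_locally_compact K U cK oU KU.
  have gC : Cc (fun x => (g x)%:C%C : C).
    apply: (Cc_compact_support G_hausdorff (K := L)) => // [|x /gL -> //].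
    by apply: continuous_ReIm => //; move=> x; exact: cvg_cst.
  have /andP[l1 l2] := radon_sandwich G_hausdorff rad cK cL (borel_open oU) LU cg g01 gK gL.
  have cgp : continuous (g \o p).
    by move=> x; apply: continuous_comp; [exact: (twist_p_continuous tw)|exact: cg].
  have /andP[m1 m2] := radon_sandwich hS (mu_radon u) (twist_p_proper tw Gam_compact cK)
    (twist_p_proper tw Gam_compact cL) (borel_open opU) (fun x => LU (p x)) cgp
    (fun x => g01 (p x)) (fun x => gK (p x)) (fun x => gL (p x)).
  have e := twist_integral_Cc u gC.
  split.
    by apply: le_trans l1 _; rewrite -e.
  by apply: le_trans m1 _; rewrite -[X in cintegral (mu u) _ X]/((fun x => (g x)%:C%C : C) \o p) e.
apply/eqP; rewrite eq_le; apply/andP; split.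
  rewrite (radon_inner rad oU); apply: ge_ereal_sup => _ [K [cK KU] <-].
  by have [] := key K cK KU.
rewrite (radon_inner (mu_radon u) opU); apply: ge_ereal_sup => _ [K [cK KU] <-].
(* A compact subset of the preimage of [U] is enlarged to its saturation, the preimage of a compact
   subset of [U]. *)
have cpK : compact (p @` K).
  by apply: continuous_image_compact => //; exact: (twist_p_continuous tw).
have pKU : p @` K `<=` U by move=> _ [x Kx <-]; exact: KU.
have [_ ] := key _ cpK pKU; apply: le_trans; apply: le_measure; rewrite ?inE.
- exact: borel_compact.
- by apply: borel_compact => //; exact: (twist_p_proper tw).
- exact: preimage_image.
Qed.

(** Outer regularity on both sides extends the equality from open sets to Borel sets. *)
Lemma twist_measure_image u (B : set G) : measurable (B : set (borel (\val (pU u)))) ->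
  lambda (pU u) B = mu u (p @^-1` B).
Proof.
move=> mB; have mpB : measurable (p @^-1` B : set (borel (\val u))).
  by have := @p_measurable u measurableT _ mB; rewrite setTI.
rewrite (radon_outer (haar_system_radon lambda_haar _) mB) (radon_outer (mu_radon u) mpB).
apply/eqP; rewrite eq_le; apply/andP; split.
  apply: le_ereal_inf_tmp => _ [V [oV BV] <-].
  (* The largest set whose preimage lies in [V]; it is open because [p] is closed. *)
  pose U := ~` (p @` (~` V)).
  have oU : open U.
    by apply: closed_openC; apply: (twist_p_closed tw) => //; exact: open_closedC.
  have UV : p @^-1` U `<=` V.
    by move=> x Ux; apply: contrapT => nVx; apply: Ux; exists x.
  have BU : B `<=` U by move=> g Bg [x nVx xg]; apply: nVx; apply: BV; rewrite /= xg.
  apply: (@le_trans _ _ (lambda (pU u) U)); first by apply: ereal_inf_lbound; exists U.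
  rewrite (twist_measure_open u oU); apply: le_measure; rewrite ?inE.
  - by apply: borel_open; apply: open_comp => // x _; exact: (twist_p_continuous tw).
  - exact: borel_open.
  - exact: UV.
apply: le_ereal_inf_tmp => _ [U [oU BU] <-].
rewrite (twist_measure_open u oU); apply: ereal_inf_lbound; exists (p @^-1` U) => //; split.
  by apply: open_comp => // x _; exact: (twist_p_continuous tw).
by move=> x; exact: BU.
Qed.

Lemma mu_conull u : mu u (~` rfiber (\val u)) = 0%E.
Proof.
rewrite -[in X in ~` X](unitUP u) (twist_rfiber tw) preimage_setC.
rewrite -twist_measure_image; first exact: lambda_conull.
by apply: borel_open; apply: closed_openC; exact: rfiber_closed.
Qed.

Lemma quotient_continuous_p (Z : topologicalType) (phi : G -> Z) :
  continuous (phi \o p) -> continuous phi.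
Proof.
move=> /continuousP cp; apply/continuousP => U oU.
by have [_ pq] := twist_p_quotient tw; apply/pq; exact: cp.
Qed.

(** In applications [phi] comes from an arbitrary section and is not known to be continuous.
    Openness of [p] makes it continuous on the fibre of [G], hence measurable there, and the image
    measure applies. *)
Lemma cintegral_descend u (F : S -> C) (phi : G -> C) :
  {within rfiber (\val u), continuous F} ->
  (forall x, rfiber (\val u) x -> F x = phi (p x)) ->
  cintegral (mu u) (rfiber (\val u)) F =
  cintegral (lambda (pU u)) (rfiber (\val (pU u))) phi.
Proof.
move=> /subspace_continuousP cF Fphi.
have rE : rfiber (\val u) = p @^-1` rfiber (\val (pU u)).
  by rewrite -[in LHS](unitUP u) (twist_rfiber tw).
have mp := @p_measurable u.
have muE := twist_measure_image (u := u).
rewrite (cintegral_image mp muE).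
- by rewrite -rE; apply: eq_cintegral.
- by apply: borel_closed; exact: rfiber_closed.
apply: borel_cmeasurable_within; first exact: rfiber_closed.
apply/subspace_continuousP => g gD W Wg.
have [x _ xg] : (p @` [set: S]) g by exact: (twist_p_surj tw).
have xD : rfiber (\val u) x by rewrite rE /= xg.
have {}Wg : nbhs (phi g) W := Wg.
rewrite -xg -(Fphi x xD) in Wg.
have : nbhs x [set y | rfiber (\val u) y -> W (F y)] := cF x xD W Wg.
move=> /(twist_p_nbhs tw); rewrite xg => gA.
suff : nbhs g [set g' | rfiber (\val (pU u)) g' -> W (phi g')] by [].
apply: filterS gA => _ /= [y yW <-] yD.
have {}yD : rfiber (\val u) y by rewrite rE.
by rewrite -Fphi//; exact: yW.
Qed.

Lemma mu_src_image u (B : set G) : measurable (B : set (borel (\val (pU u)))) ->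
  mu_src lambda (pU u) B = mu_src mu u (p @^-1` B).
Proof.
move=> mB.
have mVB : measurable (ginv @^-1` B : set (borel (\val (pU u)))).
  by have := ginv_measurable (S := G) (u := \val (pU u)) measurableT mB; rewrite setTI.
have H := twist_measure_image mVB.
rewrite -[LHS]/(lambda (pU u) (ginv @^-1` B)) H.
rewrite -[RHS]/(mu u (ginv @^-1` (p @^-1` B))); congr (mu u _).
by apply/seteqP; split => x /=; rewrite (hom_inv (twist_p_hom tw)).
Qed.

Lemma integral_image_p u (nu : borel_measure R (\val u)) (nu' : borel_measure R (\val (pU u)))
    (F : S -> R) (phi : G -> R) :
  (forall B, measurable B -> nu' B = nu (p @^-1` B)) ->
  continuous F -> (forall x, 0 <= F x) -> (forall x, F x = phi (p x)) ->
  (\int[nu]_x (F x)%:E = \int[nu']_x (phi x)%:E)%E.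
Proof.
move=> nuE cF F0 Fphi.
have cphi : continuous phi.
  by apply: quotient_continuous_p; have <- : F = phi \o p by exact/funext.
have mphi : measurable_fun (setT : set (borel (\val (pU u)))) (fun g => (phi g)%:E).
  by apply/measurable_EFinP; exact: borel_continuous.
have -> := ge0_integral_image (@p_measurable u) nuE measurableT mphi.
  by rewrite preimage_setT; apply: eq_integral => x _; rewrite Fphi.
move=> g _; have [x _ <-] : (p @` [set: S]) g by exact: (twist_p_surj tw).
by rewrite -Fphi lee_fin.
Qed.

Lemma integral_descend u (F : S -> R) (phi : G -> R) : continuous F ->
  (forall x, 0 <= F x) -> (forall x, F x = phi (p x)) ->
  (\int[mu u]_x (F x)%:E = \int[lambda (pU u)]_x (phi x)%:E)%E.
Proof. by apply: integral_image_p; exact: twist_measure_image. Qed.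

Lemma src_integral_descend u (F : S -> R) (phi : G -> R) : continuous F ->
  (forall x, 0 <= F x) -> (forall x, F x = phi (p x)) ->
  (\int[mu_src mu u]_x (F x)%:E = \int[mu_src lambda (pU u)]_x (phi x)%:E)%E.
Proof. by apply: integral_image_p; exact: mu_src_image. Qed.

(** * Averages over the orbits *)

Section average.
Variables (chi : Gam -> circle R) (chi_character : is_character chi).

(** The result is equivariant for the inverse of [chi]: conjugation by inversion later turns it into
    an average that is equivariant for [chi], and the trivial character gives the plain orbit
    average. *)
Definition twist_avg (k : S -> C) : S -> C := fun y =>
  cintegral lam setT (fun a => cval (chi a) * k (act a y)).

Lemma chi_continuous : continuous (fun a => cval (chi a) : C).
Proof.
move=> a; apply: continuous_comp; first by case: chi_character => _; exact.
exact: cval_continuous.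
Qed.

Lemma twist_avg_integrand (k : S -> C) y : continuous k ->
  continuous (fun a => cval (chi a) * k (act a y) : C).
Proof.
move=> ck a; apply: cvgM; first exact: chi_continuous.
apply: (@continuous_comp _ _ _ (fun a => act a y) k); last exact: ck.
exact: twist_act_continuousl.
Qed.

Lemma twist_avg_equivariant (k : S -> C) b y : continuous k ->
  twist_avg k (act b y) = cval (- chi b) * twist_avg k y.
Proof.
move=> ck; have [cD _] := chi_character.
rewrite /twist_avg -[X in _ = _ * X](haar_translate lam_haar b (@twist_avg_integrand k y ck)).
rewrite -cintegralZ//.
  apply: eq_cintegral => a _; rewrite cD cvalD !mulrA cvalN mul1r [b + a]addrC.
  by rewrite (twist_actD tw).
apply: (haar_cintegrable Gam_hausdorff Gam_compact lam_haar (f := fun a => _)).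
move=> a; have H : (fun x : Gam => (b, x)) @ a --> (b, a).
  by apply: cvg_pair; [exact: cvg_cst|exact: cvg_id].
have H2 := cvg_comp _ _ H (@add_continuous Gam (b, a)).
exact: (cvg_comp _ _ H2 (@twist_avg_integrand k y ck (b + a))).
Qed.

(** By the tube lemma over the compact group, [k] at a.y' is close to [k] at a.y uniformly in a. *)
Lemma twist_avg_continuous (k : S -> C) : continuous k -> continuous (twist_avg k).
Proof.
move=> ck y; apply/(@cvg_rnormP _ C _ (nbhs y)) => e e0.
have : \forall y' \near y, forall a, [set: Gam] a -> rnorm (k (act a y') - k (act a y) : C) < e / 2.
  apply: (@compact_near_uniform _ _ [set: Gam] y (fun a y' => rnorm (k (act a y') - k (act a y) : C) < e / 2)) => // a _.
  have e4 : 0 < e / 2 / 2 by rewrite !divr_gt0.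
  have nW : nbhs (act a y) (k @^-1` [set z | rnorm (z - k (act a y) : C) < e / 2 / 2]).
    by apply: ck; apply/nbhs_rnorm; exists (e / 2 / 2).
  have : (fun q : Gam * S => act q.1 q.2) @ (a, y) --> act a y.
    by apply: (twist_act_cvg tw); [exact: cvg_fst|exact: cvg_snd].
  move=> /(_ _ nW) [[B1 B2] [/= aB yB] B12]; exists (B1, B2) => //.
  move=> [a' y'] /= [B1a' B2y'] _.
  have /= h1 := B12 (a', y') (conj B1a' B2y').
  have /= h2 := B12 (a', y) (conj B1a' (nbhs_singleton yB)).
  have -> : k (act a' y') - k (act a' y) = (k (act a' y') - k (act a y)) + (k (act a y) - k (act a' y)) by ring.
  apply: le_lt_trans (rnormD _ _) _; rewrite [X in _ + X]rnormB; lra.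
apply: filterS => y' Hy'.
rewrite /twist_avg -cintegralB//; try exact: (haar_cintegrable Gam_hausdorff Gam_compact lam_haar (@twist_avg_integrand k _ ck)).
apply: (@le_lt_trans _ _ (e / 2)); last by lra.
apply: (haar_le_norm Gam_hausdorff Gam_compact lam_haar).
  by move=> a; apply: cvgB; exact: twist_avg_integrand.
by move=> a; rewrite -mulrBr rnormM rnorm_cval mul1r ltW// Hy'.
Qed.

(** The support grows at most to the saturation of that of [k], compact because [p] is proper. *)
Lemma twist_avg_Cc (k : S -> C) : Cc k -> Cc (twist_avg k).
Proof.
move=> [ck cK].
apply: (Cc_compact_support hS (K := p @^-1` (p @` closure [set x | k x != 0]))).
- exact: twist_avg_continuous.
- apply: (twist_p_proper tw) => //.
  by apply: continuous_image_compact => //; exact: (twist_p_continuous tw).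
move=> y ny; rewrite /twist_avg -[RHS](@cintegral0 _ _ _ lam setT).
apply: eq_cintegral => a _; rewrite (@Cc_eq0 _ _ k) ?mulr0//.
by move=> ky; apply: ny => /=; exists (act a y) => //; rewrite (twist_act_p tw).
Qed.

Lemma twist_avg_sqr (k : S -> C) y : continuous k ->
  rnorm (twist_avg k y : C) ^+ 2 <=
  complex.Re (cintegral lam setT (fun a => (rnorm (k (act a y)) ^+ 2)%:C%C)).
Proof.
move=> ck; apply: le_trans (haar_sqr_le Gam_hausdorff Gam_compact lam_haar (@twist_avg_integrand k y ck)) _.
by under eq_cintegral do rewrite rnormM rnorm_cval mul1r.
Qed.

End average.

Definition chi_triv : Gam -> circle R := fun=> 0.

Lemma chi_triv_character : is_character chi_triv.
Proof. by split; [move=> a b; rewrite /chi_triv addr0|move=> a; exact: cvg_cst]. Qed.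

Lemma twist_avg_trivE (k : S -> C) y :
  twist_avg chi_triv k y = cintegral lam setT (fun a => k (act a y)).
Proof. by apply: eq_cintegral => a _; rewrite cval0 mul1r. Qed.

Lemma twist_avg_triv_invariant (k : S -> C) b y : continuous k ->
  twist_avg chi_triv k (act b y) = twist_avg chi_triv k y.
Proof.
move=> ck; rewrite twist_avg_equivariant//; last exact: chi_triv_character.
by rewrite /chi_triv oppr0 cval0 mul1r.
Qed.

(** The formula defining [mu] already integrates over each orbit, and on an orbit the average is
    constant with value that inner integral. *)
Lemma integral_twist_avg u (k : S -> C) : Cc k ->
  cintegral (mu u) setT (twist_avg chi_triv k) = cintegral (mu u) setT k.
Proof.
move=> kC; have [s sp] := twist_section tw; have [_ /(_ s sp) mE] := mu_induced u.
have ck : continuous k by case: kC.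
rewrite (mE _ kC) (mE _ (twist_avg_Cc chi_triv_character kC)).
apply: eq_cintegral => g _; rewrite -[RHS](haar_cst lam_haar).
by apply: eq_cintegral => a _; rewrite twist_avg_triv_invariant// twist_avg_trivE.
Qed.

(** Continuity of the induced system is not part of its definition. Replacing [k] by its orbit
    average keeps all integrals and yields a function that descends to [Cc] on [G], where the Haar
    system is continuous. *)
Lemma twist_haar_continuous (k : S -> C) : Cc k ->
  continuous (fun u => cintegral (mu u) setT k : C).
Proof.
move=> kC; have ck : continuous k by case: kC.
have [s sp] := twist_section tw.
pose k0 := twist_avg chi_triv k.
have k0C : Cc k0 by apply: twist_avg_Cc => //; exact: chi_triv_character.
have [ck0 cK0] := k0C.
pose kap g := k0 (s g).
have kapE : kap \o p = k0.
  apply/funext => x; rewrite /kap /=.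
  have [a xa] := twist_fiber tw (sp (p x)).
  by rewrite [in RHS]xa /k0 twist_avg_triv_invariant.
have kapC : Cc kap.
  apply: (Cc_compact_support G_hausdorff (K := p @` closure [set x | k0 x != 0])).
  - by apply: quotient_continuous_p; rewrite kapE.
  - by apply: continuous_image_compact => //; exact: (twist_p_continuous tw).
  move=> g ng; apply: (Cc_eq0 (f := k0)) => sg.
  by apply: ng; exists (s g).
have E u : cintegral (mu u) setT k = cintegral (lambda (pU u)) setT kap.
  rewrite -integral_twist_avg// -/k0 -kapE.
  exact: twist_integral_Cc.
rewrite (_ : (fun u => _) = (fun u => cintegral (lambda (pU u)) setT kap : C)); last first.
  by apply/funext => u; rewrite E.
move=> u.
have c1 : {for u, continuous (fun u : unit_space S => pU u)}.
  apply: (@continuous_comp _ _ _ (\val : unit_space S -> S) (fun x => rngU (p x))).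
    exact: initial_continuous.
  apply: continuous_comp; first exact: (twist_p_continuous tw).
  exact: rngU_continuous.
exact: (cvg_comp _ _ c1 (haar_system_continuous lambda_haar kapC (x := pU u))).
Qed.

Lemma twist_conv_Cc (f g : S -> C) : Cc f -> Cc g -> Cc (conv mu f g).
Proof. exact: (conv_Cc hS lS mu_radon mu_conull twist_haar_continuous). Qed.

(** * The equivariant subalgebra and the projection onto it *)

Variables (chi : Gam -> circle R) (chi_character : is_character chi).
Local Notation V := (Cc_twist iota p chi).

Let chiN a := characterN a chi_character.

Lemma conj_cvalN (z : circle R) : conjc (cval (- z)) = cval z.
Proof.
have n1 : cval z * conjc (cval z) = 1.
  by rewrite -sqr_normc -(@rnormC _ C) rnorm_cval expr1n.
have nz : cval z != 0 by apply: contra_eq_neq n1 => ->; rewrite mul0r eq_sym oner_eq0.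
have -> : cval (- z) = conjc (cval z).
  by apply: (mulfI nz); rewrite n1 mulrC cvalN.
by rewrite conjcK.
Qed.

Lemma Cc_twistDZ (a : C) f g : V f -> V g -> V (fun x => a * f x + g x).
Proof.
move=> [fC fchi] [gC gchi]; split; first exact: CcDZ.
by move=> b x; rewrite fchi gchi; ring.
Qed.

Lemma Cc_twist_conv f g : V f -> V g -> V (conv mu f g).
Proof.
move=> [fC fchi] [gC gchi]; split; first exact: twist_conv_Cc.
move=> a x; rewrite -cintegralZ; last 2 first.
- by apply: borel_closed; exact: rfiber_closed.
- exact: (conv_integrable hS mu_radon x fC gC).
have rE : rngU (act a x) = rngU x by apply: val_inj; rewrite /= (twist_act_rng tw).
(* The two points have the same range, but the measure and its Borel structure depend on that unit;
   with units as variables they are identified by substitution. *)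
have E (w : unit_space S) (h h' : S -> C) (z z' : S) : rngU x = w -> grng z = grng x -> z' = x ->
    (forall y, rfiber (grng x) y -> h y = h' y) ->
    cintegral (mu w) (rfiber (grng z)) h = cintegral (mu (rngU z')) (rfiber (grng z')) h'.
  by move=> <- -> -> hh; exact: eq_cintegral.
apply: E => //; first exact: (twist_act_rng tw).
move=> y yx; rewrite (twist_act_mulr tw) ?gsrcV// gchi; ring.
Qed.

Lemma Cc_twist_star f : V f -> V (gstar f).
Proof.
move=> [fC fchi]; have [cf cK] := fC; split.
  apply: (Cc_compact_support hS _ (compact_ginv cK)).
    move=> x; have ch : {for x, continuous (f \o ginv)}.
      by apply: continuous_comp; [exact: ginv_continuous|exact: cf].
    exact: (cvg_comp _ _ ch (@conjc_continuous _ (f (ginv x)))).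
  by move=> x nx; rewrite /gstar (Cc_eq0 nx) rmorph0.
move=> a x; rewrite /gstar (twist_act_inv tw) fchi rmorphM; congr (_ * _).
by rewrite chiN; exact: conj_cvalN.
Qed.

(** The spectral projection onto the character [chi], in the familiar form of [twist_projE]. Passing
    through inversion lets it inherit the properties of [twist_avg]. *)
Definition twist_proj (g : S -> C) : S -> C := fun x =>
  twist_avg chi (g \o ginv) (ginv x).

Lemma Cc_ginv (g : S -> C) : Cc g -> Cc (g \o ginv).
Proof.
move=> [cg cK]; apply: (Cc_compact_support hS _ (compact_ginv cK)).
  by move=> x; apply: continuous_comp; [exact: ginv_continuous|exact: cg].
by move=> x nx; exact: (Cc_eq0 nx).
Qed.

Lemma twist_projE g x : twist_proj g x =
  cintegral lam setT (fun a => cval (chi a) * g (act (- a) x)).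
Proof.
by apply: eq_cintegral => a _ /=; rewrite (twist_act_inv tw) ginvK.
Qed.

Lemma twist_proj_V g : Cc g -> V (twist_proj g).
Proof.
move=> gC; have gVC := Cc_ginv gC; have cgV : continuous (g \o ginv) by case: gVC.
split.
  by apply: Cc_ginv; apply: twist_avg_Cc.
move=> a x; rewrite /twist_proj (twist_act_inv tw) twist_avg_equivariant//.
congr (_ * _); congr cval.
by rewrite chiN opprK.
Qed.

(** Replacing y by a.y in f(y) g(y^-1 x) produces chi(a) from f and g((-a).(y^-1 x)). So the orbit
    average of the integrand is the integrand for the projection of [g], and averaging does not
    change the integral. As averages are taken of functions in [Cc], the integrand is first extended
    off its fibre. *)
Lemma conv_twist_proj f g : V f -> Cc g -> conv mu f (twist_proj g) = conv mu f g.
Proof.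
move=> [fC fchi] gC; apply/funext => x; have [cg _] := gC.
have [k [kC kE _]] := conv_integrand_extension hS lS x fC cg.
have k0C : Cc (twist_avg chi_triv k).
  by apply: twist_avg_Cc => //; exact: chi_triv_character.
rewrite (conv_extensionE hS mu_conull kC kE).
rewrite -integral_twist_avg//.
apply: (conv_extensionE hS mu_conull k0C) => y yx.
rewrite twist_avg_trivE twist_projE -cintegralZ//; last first.
  have chV : continuous (g \o ginv) by have [] := Cc_ginv gC.
  have := haar_cintegrable Gam_hausdorff Gam_compact lam_haar
    (@twist_avg_integrand _ chi_character (g \o ginv) (ginv (gmul (ginv y) x)) chV).
  by under eq_fun do rewrite /= (twist_act_inv tw) ginvK.
apply: eq_cintegral => a _; rewrite kE; last by rewrite /rfiber /= (twist_act_rng tw).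
rewrite fchi (twist_act_inv tw) (twist_act_mull tw) ?gsrcV//; ring.
Qed.

Lemma mu_src_integral u (F : S -> R) : continuous F -> (forall x, 0 <= F x) ->
  (\int[mu_src mu u]_x (F x)%:E = \int[mu u]_x (F (ginv x))%:E)%E.
Proof.
move=> cF F0.
apply: (ge0_integral_pushforward (ginv_measurable (S := S) (u := \val u))) => //.
- by apply/measurable_EFinP; exact: borel_continuous.
- by move=> x _; rewrite lee_fin.
Qed.

Lemma Cc_integral_Re u (k : S -> C) : Cc k ->
  (\int[mu u]_x (complex.Re (k x))%:E)%E = (complex.Re (cintegral (mu u) setT k))%:E.
Proof.
move=> kC; have [iR _] := Cc_cintegrable hS (mu_radon u) (@closedT S) kC.
by rewrite /= fineK// integrable_fin_num.
Qed.

(** Jensen's inequality bounds the square of the projection at each point by the orbit average of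
    |g|^2, whose integral is that of |g|^2. Inversion moves the computation to [mu], for which the
    averaging lemma is stated. *)
Lemma norm2_twist_proj u g : Cc g ->
  (norm2 (mu_src mu u) (twist_proj g) <= norm2 (mu_src mu u) g)%E.
Proof.
move=> gC; have [PC _] := twist_proj_V gC.
have hC := Cc_ginv gC; have [ch cK] := hC; have [cg _] := gC.
have mrad := mu_src_radon mu_radon u.
have ig := Cc_square_integrable hS mrad gC.
rewrite (norm2_fin ig); set e := fine _; have e0 : 0 <= e by exact: fine_norm2_ge0.
apply/norm2_leP => //.
have -> : (e ^+ 2)%:E = (\int[mu_src mu u]_x (rnorm (g x : C) ^+ 2)%:E)%E.
  by rewrite -norm2_sqr (norm2_fin ig) -/e poweR_EFin powR_mulrn.
have csq (k : S -> C) : continuous k -> continuous (fun x => rnorm (k x : C) ^+ 2).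
  move=> ck x; have c1 := cvg_comp _ _ (ck x) (@rnorm_continuous R C (k x)).
  exact: (cvg_comp _ _ c1 (@exprn_continuous R 2 _)).
have [cP _] := PC.
have srcE (k : S -> C) : continuous k -> (\int[mu_src mu u]_x (rnorm (k x : C) ^+ 2)%:E =
    \int[mu u]_x (rnorm (k (ginv x) : C) ^+ 2)%:E)%E.
  by move=> ck; exact: (@mu_src_integral u (fun x => rnorm (k x : C) ^+ 2) (csq k ck) (fun x => sqr_ge0 _)).
rewrite (srcE _ cP) (srcE _ cg).
pose w (x : S) : C := (rnorm (g (ginv x) : C) ^+ 2)%:C%C.
have wC : Cc w.
  apply: (Cc_compact_support hS _ cK).
    apply: continuous_ReIm; first exact: (csq _ ch).
    by move=> x; exact: cvg_cst.
  by move=> x nx; rewrite /w (Cc_eq0 nx : g (ginv x) = 0) (rnorm0 C) expr0n.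
have cw : continuous w by case: wC.
have aC : Cc (twist_avg chi_triv w).
  by apply: twist_avg_Cc => //; exact: chi_triv_character.
apply: (@le_trans _ _ (\int[mu u]_x (complex.Re (twist_avg chi_triv w x))%:E)%E).
  have [ca _] := aC; apply: ge0_le_integral => //.
  - by move=> x _; rewrite lee_fin sqr_ge0.
  - apply/measurable_EFinP; apply: borel_continuous; apply: (csq (fun x => twist_proj g (ginv x))).
    by have [] := Cc_ginv PC.
  - by apply/measurable_EFinP; have [] := borel_cmeasurable (\val u) ca.
  move=> x _; rewrite lee_fin /twist_proj ginvK.
  have := twist_avg_sqr chi_character x ch.
  by rewrite twist_avg_trivE.
rewrite Cc_integral_Re// integral_twist_avg//.
by rewrite -Cc_integral_Re.
Qed.

Lemma twist_opnormE u f : V f -> Cc_opnorm (mu_src mu u) (conv mu f) =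
  ereal_sup [set norm2 (mu_src mu u) (conv mu f g) |
    g in [set g | V g /\ (norm2 (mu_src mu u) g <= 1)%E]].
Proof.
move=> Vf; apply/eqP; rewrite eq_le; apply/andP; split.
  apply: ub_ereal_sup => _ [g [gC g1] <-]; apply: ereal_sup_ubound.
  exists (twist_proj g); last first.
    by rewrite conv_twist_proj.
  split; first exact: twist_proj_V.
  apply: le_trans g1.
  exact: norm2_twist_proj.
apply: le_ereal_sup => _ [g [[gC _] g1] <-]; exists g => //.
Qed.

Lemma twist_reduced_normE f : V f -> reduced_norm mu f =
  esup0 [set e | exists u, e \is a fin_num /\
    e = ereal_sup [set norm2 (mu_src mu u) (conv mu f g) |
      g in [set g | V g /\ (norm2 (mu_src mu u) g <= 1)%E]]].
Proof.
move=> Vf; have [fC _] := Vf.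
rewrite (reduced_normE hS lS mu_radon mu_conull
  twist_haar_continuous fC).
congr esup0; apply/seteqP; split => e [u]; rewrite ?twist_opnormE// => H; exists u => //.
by rewrite twist_opnormE.
Qed.

Lemma norm2_descend u (f : S -> C) (phi : G -> R) : continuous f ->
  (forall x, rnorm (f x) = phi (p x)) ->
  norm2 (mu_src mu u) f = ((\int[mu_src lambda (pU u)]_g (phi g ^+ 2)%:E) `^ 2^-1)%E.
Proof.
move=> cf fphi; rewrite norm2E.
congr poweR; apply: (@src_integral_descend u (fun x => rnorm (f x) ^+ 2) (fun g => phi g ^+ 2)).
- move=> x; have c1 := cvg_comp _ _ (cf x) (@rnorm_continuous R C (f x)).
  exact: (cvg_comp _ _ c1 (@exprn_continuous R 2 _)).
- by move=> x; exact: sqr_ge0.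
- by move=> x; rewrite fphi.
Qed.

End twisted_algebra.

(** * The pushout of a twist along a character *)

Section circle_topology.
Variable R : realType.
Local Notation C := (R[i]^o).
Local Notation T := (circle R).

Lemma circle_hausdorff : hausdorff_space T.
Proof.
move=> z w zw; apply: val_inj; apply: (@norm_hausdorff _ C) => U W zU wW.
by have [x [? ?]] := zw _ _ (@cval_continuous R z _ zU) (@cval_continuous R w _ wW); exists (cval x).
Qed.

Lemma expi_subproof (t : R) : ((cos t +i* sin t)%C : C) \in [set z : C | `|z| = 1].
Proof.
by rewrite inE /= -(@rnormC _ C) rnormE /= cos2Dsin2 sqrtr1.
Qed.

Definition expi (t : R) : T := exist _ ((cos t +i* sin t)%C : C) (expi_subproof t).

Lemma expi_continuous : continuous expi.
Proof.
apply: continuous_comp_initial; apply: continuous_ReIm.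
- exact: continuous_cos.
- exact: continuous_sin.
Qed.

Lemma circle_compact : compact [set: T].
Proof.
rewrite (_ : setT = expi @` `[- pi, pi]%classic).
  apply: continuous_compact; last exact: segment_compact.
  by apply: continuous_subspaceT; exact: expi_continuous.
apply/seteqP; split => // z _.
have zn : complex.Re (cval z) ^+ 2 + complex.Im (cval z) ^+ 2 = 1.
  by rewrite -rnorm_sqr rnorm_cval expr1n.
set x := complex.Re _ in zn; set y := complex.Im _ in zn.
have x1 : -1 <= x <= 1 by apply/andP; split; nra.
have ezE t : cos t = x -> sin t = y -> expi t = z.
  move=> tx ty; apply: val_inj => /=; rewrite tx ty.
  by rewrite -[RHS]/(cval z) /x /y; case: (cval z).
have sE : sin (acos x) = `|y|.
  by rewrite sin_acos// -zn addrAC subrr add0r sqrtr_sqr.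
have [y0|y0] := leP 0 y.
  exists (acos x); first by rewrite /= in_itv /= acos_lepi// andbT; have := acos_ge0 x1; have := pi_ge0 R; lra.
  by apply: ezE; [rewrite acosK|rewrite sE ger0_norm].
exists (- acos x); first by rewrite /= in_itv /= lerN2 acos_lepi//=; have := acos_ge0 x1; have := pi_ge0 R; lra.
by apply: ezE; [rewrite cosN acosK|rewrite sinN sE ltr0_norm// opprK].
Qed.

End circle_topology.

Section pushout.
Local Open Scope quotient_scope.
Variables (R : realType) (Gam : topologicalZmodType).
Hypothesis Gam_compact : compact [set: Gam].
Variables (chi : Gam -> circle R) (chi_character : is_character chi).
Variables (G S : topologicalGroupoidType).
Variables (iota : trivial_bundle G Gam -> S) (p : S -> G).
Hypothesis tw : gamma_twist iota p.
Local Notation T := (circle R).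
Local Notation act := (twist_act iota p).
Let ph := twist_p_hom tw.

Let chiD : {morph chi : a b / a + b}. Proof. by case: chi_character. Qed.
Let chi_cont : continuous chi. Proof. by case: chi_character. Qed.

Let chi0 := character0 chi_character.
Let chiN a := characterN a chi_character.

(** The orbit relation of [Gam] on the product, with a acting on the circle by [- chi a]; as for
    [p], this makes the quotient map open and compactness of [Gam] effective. *)
Definition pushout_rel (x y : T * S) : bool :=
  `[< exists a, y = (x.1 - chi a, act a x.2) >].

Lemma pushout_rel_refl : reflexive pushout_rel.
Proof.
by move=> [z x]; apply/asboolP; exists 0; rewrite chi0 subr0 (twist_act0 tw).
Qed.

Lemma pushout_rel_sym : symmetric pushout_rel.
Proof.
have H x y : pushout_rel x y -> pushout_rel y x.
  case: x => z x /asboolP[a ->]; apply/asboolP; exists (- a).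
  by rewrite /= chiN opprK subrK (twist_actK tw).
by move=> x y; apply/idP/idP; exact: H.
Qed.

Lemma pushout_rel_trans : transitive pushout_rel.
Proof.
move=> y [z x] w /asboolP[a ->] /asboolP[b ->]; apply/asboolP; exists (b + a) => /=.
by rewrite chiD opprD addrA addrAC (twist_actD tw).
Qed.

Definition pushout_equiv :=
  EquivRel pushout_rel pushout_rel_refl pushout_rel_sym pushout_rel_trans.

Definition pushout : Type := quotient_topology {eq_quot pushout_equiv}.

HB.instance Definition _ := Topological.copy pushout (quotient_topology {eq_quot pushout_equiv}).

Definition push (x : T * S) : pushout := \pi_(quotient_topology {eq_quot pushout_equiv}) x.

Definition push_repr (x : pushout) : T * S := repr (x : {eq_quot pushout_equiv}).

Lemma push_reprK : cancel push_repr push.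
Proof. exact: (@reprK _ {eq_quot pushout_equiv}). Qed.

Lemma pushP x y : push x = push y <-> exists a, y = (x.1 - chi a, act a x.2).
Proof.
have H : reflect (push x = push y) (pushout_equiv x y) by exact: eqmodP.
by split=> [/H/asboolP//|xy]; apply/H; apply/asboolP.
Qed.

Lemma push_act a z x : push (z, act a x) = push (z + chi a, x).
Proof. by apply/esym/pushP; exists a; rewrite /= addrK. Qed.

Lemma push_ind (P : pushout -> Prop) : (forall z x, P (push (z, x))) -> forall x, P x.
Proof. by move=> H x; rewrite -(push_reprK x); case: (push_repr x). Qed.

Lemma push_reprP z x : exists a, push_repr (push (z, x)) = (z - chi a, act a x).
Proof. by have /pushP[a H] := esym (push_reprK (push (z, x))); exists a. Qed.

Lemma push_unit_inj x y : grng x = x -> grng y = y ->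
  push (0, x) = push (0, y) -> x = y.
Proof.
move=> xu yu /pushP[a [_ ya]]; apply: (twist_p_unit_inj tw) => //.
by rewrite ya (twist_act_p tw).
Qed.

(** The operations are computed on chosen representatives; [push_rngE] to [push_mulE] show that
    other representatives give the same class, for products when the arrows compose. *)
Definition push_rng (x : pushout) : pushout := push (0, grng (push_repr x).2).
Definition push_src (x : pushout) : pushout := push (0, gsrc (push_repr x).2).
Definition push_inv (x : pushout) : pushout :=
  push (- (push_repr x).1, ginv (push_repr x).2).
Definition push_mul (x y : pushout) : pushout :=
  push ((push_repr x).1 + (push_repr y).1, gmul (push_repr x).2 (push_repr y).2).

Lemma push_rngE z x : push_rng (push (z, x)) = push (0, grng x).
Proof. by rewrite /push_rng; have [a ->] := push_reprP z x; rewrite /= (twist_act_rng tw). Qed.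

Lemma push_srcE z x : push_src (push (z, x)) = push (0, gsrc x).
Proof. by rewrite /push_src; have [a ->] := push_reprP z x; rewrite /= (twist_act_src tw). Qed.

Lemma push_invE z x : push_inv (push (z, x)) = push (- z, ginv x).
Proof.
rewrite /push_inv; have [a ->] := push_reprP z x.
by rewrite /= (twist_act_inv tw) push_act chiN opprB addrAC subrr add0r.
Qed.

Lemma push_composable z x w y :
  push_src (push (z, x)) = push_rng (push (w, y)) <-> gsrc x = grng y.
Proof.
rewrite push_srcE push_rngE; split => [|->//]; apply: push_unit_inj.
  exact: grng_src.
exact: grng_rng.
Qed.

(** Changing representatives shifts the circle parts by [- chi a] and [- chi b]; centrality pulls a
    and b out of the product, where they contribute the opposite shifts. *)
Lemma push_mulE z x w y : gsrc x = grng y ->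
  push_mul (push (z, x)) (push (w, y)) = push (z + w, gmul x y).
Proof.
move=> xy; rewrite /push_mul; have [a ->] := push_reprP z x; have [b ->] := push_reprP w y.
rewrite /= (twist_act_mull tw) ?(twist_act_rng tw)// (twist_act_mulr tw)//.
by rewrite !push_act -addrA addrACA !subrK.
Qed.

Let pr_rng x : push_rng (push_rng x) = push_rng x.
Proof. by elim/push_ind: x => z x; rewrite !push_rngE grng_rng. Qed.
Let ps_rng x : push_src (push_rng x) = push_rng x.
Proof. by elim/push_ind: x => z x; rewrite push_rngE push_srcE gsrc_rng. Qed.
Let pr_src x : push_rng (push_src x) = push_src x.
Proof. by elim/push_ind: x => z x; rewrite push_srcE push_rngE grng_src. Qed.
Let ps_src x : push_src (push_src x) = push_src x.
Proof. by elim/push_ind: x => z x; rewrite !push_srcE gsrc_src. Qed.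
Let pr_mul x y : push_src x = push_rng y -> push_rng (push_mul x y) = push_rng x.
Proof.
elim/push_ind: x => z x; elim/push_ind: y => w y /push_composable xy.
by rewrite push_mulE// !push_rngE grngM.
Qed.
Let ps_mul x y : push_src x = push_rng y -> push_src (push_mul x y) = push_src y.
Proof.
elim/push_ind: x => z x; elim/push_ind: y => w y /push_composable xy.
by rewrite push_mulE// !push_srcE gsrcM.
Qed.
Let p_mulA x y t : push_src x = push_rng y -> push_src y = push_rng t ->
  push_mul x (push_mul y t) = push_mul (push_mul x y) t.
Proof.
elim/push_ind: x => z x; elim/push_ind: y => w y; elim/push_ind: t => v t.
move=> /push_composable xy /push_composable yt.
rewrite (push_mulE _ _ xy) (push_mulE _ _ yt) push_mulE ?grngM// push_mulE ?gsrcM//.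
by rewrite addrA gmulA.
Qed.
Let p_mul1 x : push_mul (push_rng x) x = x.
Proof. by elim/push_ind: x => z x; rewrite push_rngE push_mulE ?gsrc_rng// add0r gmul_rng. Qed.
Let p_mulr1 x : push_mul x (push_src x) = x.
Proof. by elim/push_ind: x => z x; rewrite push_srcE push_mulE ?grng_src// addr0 gmul_src. Qed.
Let pr_inv x : push_rng (push_inv x) = push_src x.
Proof. by elim/push_ind: x => z x; rewrite push_invE push_rngE push_srcE grngV. Qed.
Let ps_inv x : push_src (push_inv x) = push_rng x.
Proof. by elim/push_ind: x => z x; rewrite push_invE push_rngE push_srcE gsrcV. Qed.
Let p_mulV x : push_mul x (push_inv x) = push_rng x.
Proof.
by elim/push_ind: x => z x; rewrite push_invE push_mulE ?grngV// subrr push_rngE gmulgV.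
Qed.
Let p_mulVl x : push_mul (push_inv x) x = push_src x.
Proof.
by elim/push_ind: x => z x; rewrite push_invE push_mulE ?gsrcV// addNr push_srcE gmulVg.
Qed.

HB.instance Definition _ := @isGroupoid.Build pushout
  push_rng push_src push_inv push_mul pr_rng ps_rng pr_src ps_src
  pr_mul ps_mul p_mulA p_mul1 p_mulr1 pr_inv ps_inv p_mulV p_mulVl.

(** * Topology of the pushout *)

Lemma push_continuous : continuous push.
Proof. exact: pi_continuous. Qed.

Lemma pushout_openP (U : set pushout) : open U <-> open (push @^-1` U).
Proof. by []. Qed.

Lemma push_open (U : set (T * S)) : open U -> open (push @` U).
Proof.
move=> oU; apply/pushout_openP.
rewrite (_ : _ @^-1` _ = \bigcup_(a in [set: Gam]) ((fun x => (x.1 - chi a, act a x.2)) @^-1` U)).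
  apply: bigcup_open => a _; apply: open_comp => // -[z x] _.
  apply: (@cvg_pair _ _ _ _ (nbhs (z - chi a)) (nbhs (act a x))).
    have H : (fun q : T * S => (q.1, - chi a)) @ (z, x) --> (z, - chi a).
      by apply: (@cvg_pair _ _ _ _ (nbhs z) (nbhs (- chi a))); [exact: cvg_fst|exact: cvg_cst].
    exact: (cvg_comp _ _ H (@add_continuous T (z, - chi a))).
  by apply: (cvg_comp _ _ cvg_snd); exact: (twist_act_continuousr tw).
apply/seteqP; split => x /=.
  by move=> [y Uy /esym/pushP[a ya]]; exists a => //=; rewrite -ya.
by move=> [a _ /= Ua]; exists (x.1 - chi a, act a x.2) => //; apply/esym/pushP; exists a.
Qed.

Lemma push_nbhs x (U : set (T * S)) : nbhs x U -> nbhs (push x) (push @` U).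
Proof.
rewrite nbhsE => -[W [oW Wx] WU]; rewrite nbhsE.
exists (push @` W); first by split; [exact: push_open|exists x].
exact: image_subset.
Qed.

Lemma push_comp_continuous (Z : topologicalType) (f : pushout -> Z) :
  continuous (f \o push) -> continuous f.
Proof.
move=> /continuousP cf; apply/continuousP => A oA; apply/pushout_openP; exact: cf.
Qed.

Let push_inv_continuous : continuous (ginv : pushout -> pushout).
Proof.
apply: push_comp_continuous.
rewrite (_ : _ \o _ = push \o (fun q : T * S => (- q.1, ginv q.2))); last first.
  by apply/funext => -[z x]; exact: push_invE.
move=> [z x]; apply: continuous_comp; last exact: push_continuous.
apply: (@cvg_pair _ _ _ _ (nbhs (- z)) (nbhs (ginv x))).
  have c1 : (fun q : T * S => q.1) @ (z, x) --> z by exact: cvg_fst.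
  exact: (cvg_comp _ _ c1 (@opp_continuous T z)).
have c2 : (fun q : T * S => q.2) @ (z, x) --> x by exact: cvg_snd.
exact: (cvg_comp _ _ c2 (@ginv_continuous S x)).
Qed.

(** Openness of [push] turns neighbourhoods of representatives into neighbourhoods of classes, and
    composability of classes is composability of any representatives. *)
Let push_mul_continuous : {within [set q : pushout * pushout | gsrc q.1 = grng q.2],
  continuous (fun q : pushout * pushout => gmul q.1 q.2)}.
Proof.
apply/subspace_continuousP => -[]; elim/push_ind => z x; elim/push_ind => w y.
move=> /push_composable xy W.
move=> nW; have {}nW : nbhs (push_mul (push (z, x)) (push (w, y))) W := nW.
rewrite push_mulE// in nW.
have [[A B] [/= zwA xyB] AB] := push_continuous nW.
suff : nbhs (push (z, x), push (w, y))
  [set q : pushout * pushout | push_src q.1 = push_rng q.2 -> W (push_mul q.1 q.2)] by [].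
have : nbhs (z, w) [set q : T * T | A (q.1 + q.2)] by exact: (@add_continuous T (z, w)).
move=> [[A1 A2] [/= zA1 wA2] A12].
have /subspace_continuousP/(_ (x, y) xy B xyB) := @gmul_continuous S.
move=> [[B1 B2] [/= xB1 yB2] B12].
have N1 : nbhs (push (z, x)) (push @` (A1 `*` B1)) by apply: push_nbhs; exists (A1, B1).
have N2 : nbhs (push (w, y)) (push @` (A2 `*` B2)) by apply: push_nbhs; exists (A2, B2).
exists (push @` (A1 `*` B1), push @` (A2 `*` B2)) => //.
move=> [_ _] [/= [[z' x'] [/= Az Bx] <-] [[w' y'] [/= Aw By] <-]] /push_composable xy'.
rewrite /= push_mulE//; apply: (AB (z' + w', gmul x' y')); split => /=.
  exact: (A12 (z', w')).
exact: (B12 (x', y')).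
Qed.

HB.instance Definition _ :=
  isTopologicalGroupoid.Build pushout push_mul_continuous push_inv_continuous.

(** If no a relates two representatives, the tube lemma over the compact group gives neighbourhoods
    of them between which no a relates any points; their images under the open map [push] separate
    the classes. *)
Lemma pushout_hausdorff : hausdorff_space pushout.
Proof.
have hS := twist_hausdorff tw.
elim/push_ind => z x; elim/push_ind => w y xy; apply: contrapT => nxy.
pose P (a : Gam) (q : (T * S) * (T * S)) := q.2 != (q.1.1 - chi a, act a q.1.2).
have : \forall q \near ((z, x), (w, y)), forall a, [set: Gam] a -> P a q.
  apply: compact_near_uniform => // a _.
  have nE : w <> z - chi a \/ y <> act a x.
    apply/not_andP => -[wE yE]; apply: nxy; apply/pushP; exists a.
    by rewrite /= wE yE.
  pose X := (Gam * ((T * S) * (T * S)))%type.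
  have c1 : continuous (fun t : X => t.1) by move=> t; exact: cvg_fst.
  have c2 : continuous (fun t : X => t.2) by move=> t; exact: cvg_snd.
  have c21 : continuous (fun t : X => t.2.1) by move=> t; apply: (cvg_comp _ _ (c2 t)); exact: cvg_fst.
  have c22 : continuous (fun t : X => t.2.2) by move=> t; apply: (cvg_comp _ _ (c2 t)); exact: cvg_snd.
  have c211 : continuous (fun t : X => t.2.1.1) by move=> t; apply: (cvg_comp _ _ (c21 t)); exact: cvg_fst.
  have c212 : continuous (fun t : X => t.2.1.2) by move=> t; apply: (cvg_comp _ _ (c21 t)); exact: cvg_snd.
  have c221 : continuous (fun t : X => t.2.2.1) by move=> t; apply: (cvg_comp _ _ (c22 t)); exact: cvg_fst.
  have c222 : continuous (fun t : X => t.2.2.2) by move=> t; apply: (cvg_comp _ _ (c22 t)); exact: cvg_snd.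
  have cz : continuous (fun t : X => t.2.1.1 - chi t.1).
    move=> t; have H1 : (fun t : X => - chi t.1) @ t --> - chi t.1.
      have H2 := cvg_comp _ _ (c1 t) (@chi_cont t.1).
      exact: (cvg_comp _ _ H2 (@opp_continuous T _)).
    have H : (fun t : X => (t.2.1.1, - chi t.1)) @ t --> (t.2.1.1, - chi t.1).
      by apply: (@cvg_pair _ _ _ _ (nbhs t.2.1.1) (nbhs (- chi t.1))); [exact: c211|exact: H1].
    exact: (cvg_comp _ _ H (@add_continuous T (t.2.1.1, - chi t.1))).
  have ca : continuous (fun t : X => act t.1 t.2.1.2).
    by move=> t; apply: (twist_act_cvg tw); [exact: c1|exact: c212].
  have cl1 := @eq_closed _ _ _ _ (@circle_hausdorff R) c221 cz.
  have cl2 := @eq_closed _ _ _ _ hS c222 ca.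
  have : nbhs ((a, ((z, x), (w, y))) : X)
      (~` ([set t : X | t.2.2.1 = t.2.1.1 - chi t.1] `&` [set t : X | t.2.2.2 = act t.1 t.2.1.2])).
    apply: open_nbhs_nbhs; split; first by apply: closed_openC; exact: closedI.
    by move=> -[/= wE yE]; case: nE.
  move=> [[A B] [/= aA zB] AB]; exists (A, B) => // -[a' q'] /= AB' _.
  by apply/eqP => qE; apply: (AB (a', q') AB'); rewrite /= qE.
move=> [[A B] [/= zA wB] AB].
have [t [[a Aa at_] [b Bb bt]]] := xy _ _ (push_nbhs zA) (push_nbhs wB).
have /pushP[c bc] : push a = push b by rewrite at_.
by have := AB (a, b) (conj Aa Bb) c I; rewrite /P /= -bc eqxx.
Qed.

Lemma pushout_locally_compact : locally_compact [set: pushout].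
Proof.
elim/push_ind => z x _.
have [K xK [cK _]] := twist_locally_compact tw I : compact_near (within setT (nbhs x)).
have xK' : nbhs x [set y | [set: S] y -> K y] := xK.
have {xK'}xK : nbhs x K by apply: filterS xK' => y; exact.
exists (push @` ([set: T] `*` K)).
  suff : nbhs (push (z, x)) [set y | [set: pushout] y -> (push @` ([set: T] `*` K)) y] by [].
  apply: (@filterS _ (nbhs (push (z, x))) _ (push @` ([set: T] `*` K))); first by move=> ? ?.
  by apply: push_nbhs; exists (setT, K) => //; split => //; exact: filterT.
have cI : compact (push @` ([set: T] `*` K)).
  apply: continuous_image_compact; first exact: push_continuous.
  by apply: compact_setX => //; exact: circle_compact.
by split => //; apply: compact_closed => //; exact: pushout_hausdorff.
Qed.

(** * The pushout as a circle twist *)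

Definition push_iota (q : trivial_bundle G T) : pushout := push (q.2, iota (q.1, 0)).
Definition push_p (x : pushout) : G := p (push_repr x).2.

Lemma push_pE z x : push_p (push (z, x)) = p x.
Proof. by rewrite /push_p; have [a ->] := push_reprP z x; rewrite /= (twist_act_p tw). Qed.

Lemma push_iota_act z x a : push_iota (rngU (push_p (push (z, x))), a) = push (a, grng x).
Proof. by rewrite push_pE /push_iota (twist_iota0 tw). Qed.

Lemma push_twist_act z x a : twist_act push_iota push_p a (push (z, x)) = push (a + z, x).
Proof.
rewrite /twist_act push_iota_act -[gmul _ _]/(push_mul _ _) push_mulE ?gmul_rng//.
by rewrite gsrc_rng.
Qed.

Lemma push_iotaP z u a : push (z, iota (u, a)) = push_iota (u, z + chi a).
Proof.
have -> : iota (u, a) = act a (iota (u, 0)).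
  rewrite /twist_act (twist_p_iota tw) rngU_unit -(twist_iotaD tw).
  by rewrite addr0.
by rewrite push_act.
Qed.

Lemma push_iota_continuous : continuous push_iota.
Proof.
move=> [u z]; apply: continuous_comp; last exact: push_continuous.
apply: (@cvg_pair _ _ _ _ (nbhs z) (nbhs (iota (u, 0)))); first exact: cvg_snd.
have c : (fun q : trivial_bundle G T => (q.1, 0 : Gam)) @ (u, z) --> (u, 0 : Gam).
  by apply: (@cvg_pair _ _ _ _ (nbhs u) (nbhs (0 : Gam))); [exact: cvg_fst|exact: cvg_cst].
exact: (cvg_comp _ _ c (twist_iota_continuous tw (x := (u, 0)))).
Qed.

Lemma push_iota_inj : injective push_iota.
Proof.
move=> [u z] [v w] /pushP[a [wE vE]]; have /= uE : iota (v, 0) = iota (u, a).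
  rewrite vE /twist_act /= (twist_p_iota tw) rngU_unit -(twist_iotaD tw).
  by rewrite addr0.
by have [<- a0] := twist_iota_inj tw uE; rewrite wE -a0 chi0 subr0.
Qed.

Lemma push_p_iota u z : push_p (push_iota (u, z)) = \val u.
Proof. by rewrite push_pE (twist_p_iota tw). Qed.

Lemma push_iota_units : unit_space pushout = push_iota @` [set q | q.2 = 0].
Proof.
apply/seteqP; split=> [x|_ [[u z] /= -> <-]].
  elim/push_ind: x => z x; rewrite /unit_space /= => <-.
  exists (rngU (p x), 0) => //.
  by rewrite /push_iota /= (twist_iota0 tw) [grng (push _)]push_rngE.
by rewrite /unit_space /= [grng _]push_rngE (twist_iota_unit tw).
Qed.

Lemma push_iota_hom : groupoid_hom push_iota.
Proof.
move=> [u a] [v b] [<-]; split.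
  by apply/push_composable; rewrite (twist_iota_src tw) (twist_iota_unit tw).
rewrite [RHS]push_mulE; last by rewrite (twist_iota_src tw) (twist_iota_unit tw).
by rewrite -(twist_iotaD tw) addr0.
Qed.

Lemma push_p_hom : groupoid_hom push_p.
Proof.
move=> x y; elim/push_ind: x => z x; elim/push_ind: y => w y /push_composable xy.
rewrite [gmul _ _]push_mulE// !push_pE; exact: ph.
Qed.

Lemma push_p_continuous : continuous push_p.
Proof.
apply: push_comp_continuous; rewrite (_ : _ \o _ = p \o snd).
  move=> [z x]; apply: continuous_comp; first exact: cvg_snd.
  exact: (twist_p_continuous tw).
by apply/funext => -[z x]; exact: push_pE.
Qed.

Lemma push_p_surj : set_surj setT setT push_p.
Proof.
move=> g _; have [x _ <-] := @twist_p_surj _ _ _ _ _ tw g I.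
by exists (push (0, x)) => //; exact: push_pE.
Qed.

Lemma push_p_quotient : quotient_map push_p.
Proof.
split; first exact: push_p_surj.
move=> U; split => [oU|oU]; first by move/continuousP: push_p_continuous; exact.
have [_ pq] := twist_p_quotient tw; apply/pq.
rewrite (_ : _ @^-1` _ = (fun x : S => push (0, x)) @^-1` (push_p @^-1` U)); last first.
  by apply/seteqP; split => x /=; rewrite push_pE.
apply: open_comp => // x _; apply: continuous_comp; last exact: push_continuous.
by apply: (@cvg_pair _ _ _ _ (nbhs (0 : T)) (nbhs x)); [exact: cvg_cst|exact: cvg_id].
Qed.

(** A class [w, iota(v, 0)] near [push_iota (u, z)] is seen through some representative (w', iota(v,
    -a)), where w = w' + chi(-a). That [iota] is an embedding forces v to be near u and -a to be
    near 0, and continuity of [chi] then brings w near z. *)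
Lemma push_iota_embedding : top_embedding push_iota.
Proof.
split; first exact: push_iota_inj.
move=> U; split => [oU|[V oV ->]]; last by move/continuousP: push_iota_continuous; exact.
suff loc u z : U (u, z) -> exists V, [/\ open V, V (push_iota (u, z)) & push_iota @^-1` V `<=` U].
  exists (\bigcup_(V in [set V | open V /\ push_iota @^-1` V `<=` U]) V).
    by apply: bigcup_open => V [].
  apply/seteqP; split => [[u z] Uuz|q [V [_ VU]] Vq]; last exact: VU.
  by have [V [oV Vuz VU]] := loc u z Uuz; exists V.
move=> Uuz; have : nbhs (u, z) U by apply: open_nbhs_nbhs.
move=> [[U1 T1] [/= uU1 zT1] UT].
have : nbhs (z, 0 : Gam) [set q : T * Gam | T1 (q.1 + chi q.2)].
  have H : (fun q : T * Gam => (q.1, chi q.2)) @ (z, 0 : Gam) --> (z, chi 0).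
    apply: (@cvg_pair _ _ _ _ (nbhs z) (nbhs (chi 0))); first exact: cvg_fst.
    have c2 : (fun q : T * Gam => q.2) @ (z, 0 : Gam) --> (0 : Gam) by exact: cvg_snd.
    exact: (cvg_comp _ _ c2 (@chi_cont 0)).
  have := cvg_comp _ _ H (@add_continuous T (z, chi 0)).
  by apply; rewrite /= chi0 addr0.
move=> [[A B] [/= zA B0] AB].
have [_ emb] := twist_iota_embedding tw.
have [W oW WE] := (emb _).1 (open_interior (U1 `*` B : set (trivial_bundle G Gam))).
have Wu : W (iota (u, 0)).
  suff : (iota @^-1` W) (u, 0) by [].
  rewrite -WE; suff : nbhs (u, 0 : Gam) (U1 `*` B) by [].
  by exists (U1, B).
exists (push @` (A `*` W))°; split.
- exact: open_interior.
- apply: push_nbhs; exists (A, W) => //; split => //=.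
  by apply: open_nbhs_nbhs; split.
move=> [v w] /interior_subset[[w' t] [/= Aw' Wt] /pushP[a [wE vE]]].
have tE : t = iota (v, - a).
  rewrite -(twist_actK tw a t) -vE /twist_act /= (twist_p_iota tw) rngU_unit -(twist_iotaD tw).
  by rewrite addr0.
have : (U1 `*` B : set (trivial_bundle G Gam))° (v, - a) by rewrite WE /= -tE.
move=> /interior_subset[/= U1v Ba]; apply: UT; split => //=.
by have := AB (w', - a) (conj Aw' Ba); rewrite /= chiN -wE.
Qed.

Lemma pushout_twist : gamma_twist push_iota push_p.
Proof.
split.
- exact: pushout_hausdorff.
- exact: pushout_locally_compact.
- exact: push_iota_units.
- exact: push_iota_hom.
- exact: push_iota_continuous.
- exact: push_iota_embedding.
- exists (fun x => (rngU (push_p x), 0)); split.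
  + split=> [q qu|x _ //]; rewrite push_iota_units; exists q => //.
    by rewrite -qu.
  + split=> [[u z]|x].
      rewrite inE => -[<-]; congr pair; rewrite push_p_iota; exact: rngU_unit.
    rewrite inE push_iota_units => -[[u z] /= -> <-].
    by rewrite push_p_iota rngU_unit.
  + by apply: continuous_subspaceT; exact: push_iota_continuous.
  + apply: continuous_subspaceT => x.
    have c1 : (fun x => rngU (push_p x)) @ x --> rngU (push_p x).
      by apply: continuous_comp; [exact: push_p_continuous|exact: rngU_continuous].
    have c2 : (fun _ : pushout => 0 : T) @ x --> (0 : T) by exact: (@cvg_cst _ _ _ _ (@nbhs_filter pushout x)).
    exact: (@cvg_pair _ _ _ _ (nbhs (rngU (push_p x))) (nbhs (0 : T)) _ _ _ _ _ c1 c2).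
- exact: push_p_hom.
- exact: push_p_continuous.
- exact: push_p_quotient.
- exists (fun g => push_iota (rngU g, 0)); split.
  + split=> [x|g _].
      rewrite push_iota_units => -[[u z] _ <-]; rewrite push_p_iota; exact: unitUP.
    by rewrite push_iota_units; exists (rngU g, 0).
  + split=> [x|g].
      rewrite inE push_iota_units => -[[u z] /= -> <-].
      by rewrite push_p_iota rngU_unit.
    by rewrite inE => gu; rewrite push_p_iota.
  + by apply: continuous_subspaceT; exact: push_p_continuous.
  + apply: continuous_subspaceT => g; apply: continuous_comp; last exact: push_iota_continuous.
    have c2 : (fun _ : G => 0 : T) @ g --> (0 : T) by exact: (@cvg_cst _ _ _ _ (@nbhs_filter G g)).
    exact: (@cvg_pair _ _ _ _ (nbhs (rngU g)) (nbhs (0 : T)) _ _ _ _ _ (rngU_continuous (x := g)) c2).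
- exact: push_iota_inj.
- exact: push_p_surj.
- apply/seteqP; split=> [_ [[u z] _ <-]|x].
    by rewrite /= push_p_iota; exact: unitUP.
  elim/push_ind: x => z x; rewrite /= push_pE => pxu.
  have : range iota x by rewrite (twist_exact tw).
  by move=> [[u a] _ <-]; rewrite push_iotaP; exists (u, z + chi a).
move=> x a; elim/push_ind: x => z x.
have E1 : push_iota (rngU (push_p (push (z, x))), a) = push (a, grng x) by exact: push_iota_act.
have E2 : push_iota (srcU (push_p (push (z, x))), a) = push (a, gsrc x).
  rewrite push_pE /push_iota /=; congr (push (_, _)).
  rewrite -[RHS]grng_src -(twist_iota0 tw (gsrc x)); congr (iota (_, _)); apply: val_inj => /=.
  by rewrite -(hom_rng ph) grng_src (hom_src ph).
rewrite E1 E2; split.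
- by rewrite [LHS]push_srcE [RHS]push_rngE gsrc_rng.
- by rewrite [LHS]push_srcE [RHS]push_rngE grng_src.
rewrite [LHS]push_mulE ?gsrc_rng// [RHS]push_mulE ?grng_src//.
by rewrite gmul_rng gmul_src addrC.
Qed.

End pushout.

Arguments push_p {R Gam chi} chi_character {G S iota p} tw x.

(** * Comparison of two twists *)

Section comparison.
Variables (R : realType) (Gam : topologicalZmodType).
Hypothesis Gam_hausdorff : hausdorff_space Gam.
Hypothesis Gam_compact : compact [set: Gam].
Variables (lam : borel_measure R (0 : Gam)) (lam_haar : normalised_haar lam).
Variables (Gam' : topologicalZmodType).
Hypothesis Gam'_hausdorff : hausdorff_space Gam'.
Hypothesis Gam'_compact : compact [set: Gam'].
Variables (lam' : borel_measure R (0 : Gam')) (lam'_haar : normalised_haar lam').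
Variables (G : topologicalGroupoidType) (G_hausdorff : hausdorff_space G).
Hypothesis G_locally_compact : locally_compact [set: G].
Variables (lambda : measure_family R G) (lambda_haar : haar_system lambda).
Variables (S : topologicalGroupoidType).
Variables (iota : trivial_bundle G Gam -> S) (p : S -> G).
Hypothesis tw : gamma_twist iota p.
Variables (mu : measure_family R S) (mu_induced : induced_haar_system iota p lam lambda mu).
Variables (S' : topologicalGroupoidType).
Variables (iota' : trivial_bundle G Gam' -> S') (p' : S' -> G).
Hypothesis tw' : gamma_twist iota' p'.
Variables (mu' : measure_family R S') (mu'_induced : induced_haar_system iota' p' lam' lambda mu').
Local Notation C := (R[i]^o).
Local Notation act := (twist_act iota p).
Local Notation act' := (twist_act iota' p').
Variables (chi : Gam -> circle R) (chi_character : is_character chi).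
Variables (chi' : Gam' -> circle R) (chi'_character : is_character chi').
Local Notation V := (Cc_twist iota p chi).
Local Notation V' := (Cc_twist iota' p' chi').
Variables (psi : S -> S') (rho : Gam -> Gam').
Hypothesis psi_continuous : continuous psi.
Hypothesis psi_hom : groupoid_hom psi.
Hypothesis psi_p : forall x, p' (psi x) = p x.
Hypothesis psi_act : forall a x, psi (act a x) = act' (rho a) (psi x).
Hypothesis chi_rho : forall a, chi' (rho a) = chi a.

(** [psi] is not assumed proper; the support of the composite is compact because it lies in the
    preimage under [p] of a compact subset of [G]. *)
Lemma pullback_Cc_twist f : V' f -> V (f \o psi).
Proof.
move=> [[cf cK] feq]; split; last by move=> a x; rewrite /= psi_act feq chi_rho.
pose K := closure [set x | f x != 0].
apply: (Cc_compact_support (twist_hausdorff tw) (K := p @^-1` (p' @` K))).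
- by move=> x; apply: continuous_comp; [exact: psi_continuous|exact: cf].
- apply: (twist_p_proper tw) => //; apply: continuous_compact => //.
  by apply: continuous_subspaceT; exact: (twist_p_continuous tw').
- move=> x nx; apply: (Cc_eq0 (f := f)) => Kx; apply: nx.
  by exists (psi x) => //; rewrite psi_p.
Qed.

Lemma pullback_unit_p x : rngU (p (grng x)) = rngU (p' (grng (psi x))).
Proof. by rewrite -psi_p (hom_rng psi_hom). Qed.

(** Both convolutions are integrals over the same fibre of [G] of the function [phi] built from a
    section: moving within an orbit multiplies the two factors by inverse values of the
    character. *)
Lemma pullback_conv f g : V' f -> V' g ->
  conv mu' f g \o psi = conv mu (f \o psi) (g \o psi).
Proof.
move=> Vf Vg; apply/funext => x; have [s sp] := twist_section tw'.
have [[cf _] feq] := Vf; have [[cg _] geq] := Vg.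
have [[cf' _] _] := pullback_Cc_twist Vf; have [[cg' _] _] := pullback_Cc_twist Vg.
pose phi h := f (s h) * g (gmul (ginv (s h)) (psi x)).
have phiE y : rfiber (grng (psi x)) y -> f y * g (gmul (ginv y) (psi x)) = phi (p' y).
  move=> yx; have [a ya] := twist_fiber tw' (esym (sp (p' y))).
  have syx : grng (s (p' y)) = grng (psi x).
    by rewrite ya (twist_act_rng tw').
  rewrite /phi ya feq (twist_act_inv tw') (twist_act_mull tw') ?gsrcV// geq mulrACA.
  have [cD _] := chi'_character.
  by rewrite -cvalD -cD subrr (character0 chi'_character) cval0 mul1r.
have phiE' y : rfiber (grng x) y -> f (psi y) * g (psi (gmul (ginv y) x)) = phi (p y).
  move=> yx; rewrite (hom_mul psi_hom) ?gsrcV// (hom_inv psi_hom) -psi_p; apply: phiE.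
  by rewrite /rfiber /= -!(hom_rng psi_hom) yx.
rewrite /Defs.conv /=.
rewrite (cintegral_descend Gam'_compact lam'_haar G_hausdorff G_locally_compact lambda_haar tw' mu'_induced
  (u := rngU (psi x)) (conv_integrand_continuous (x := psi x) cf cg) phiE).
rewrite (cintegral_descend Gam_compact lam_haar G_hausdorff G_locally_compact lambda_haar tw mu_induced
  (u := rngU x) (conv_integrand_continuous (x := x) cf' cg') phiE').
have H (v w : unit_space G) : v = w ->
    cintegral (lambda v) (rfiber (\val v)) phi = cintegral (lambda w) (rfiber (\val w)) phi.
  by move=> ->.
by apply: H; exact/esym/pullback_unit_p.
Qed.

Lemma pullback_gstar (f : S' -> C) : gstar f \o psi = gstar (f \o psi).
Proof. by apply/funext => x; rewrite /gstar /= (hom_inv psi_hom). Qed.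

Lemma pullback_star_morphism : star_morphism mu' mu V' V (fun f => f \o psi).
Proof.
split=> //.
- exact: pullback_Cc_twist.
- exact: pullback_conv.
- by move=> f _; exact: pullback_gstar.
Qed.

(** Units are matched through [G], so suprema over the unit spaces of [S] and S' run over the same
    values. *)
Let units (u' : unit_space S') : exists u : unit_space S, rngU (p (\val u)) = rngU (p' (\val u')).
Proof.
have [s sp] := twist_section tw; exists (rngU (s (p' (\val u')))); apply: val_inj => /=.
by rewrite (hom_rng (twist_p_hom tw)) sp grng_rng.
Qed.

Let units' (u : unit_space S) : exists u' : unit_space S', rngU (p (\val u)) = rngU (p' (\val u')).
Proof.
exists (rngU (psi (\val u))); apply: val_inj => /=.
by rewrite -(hom_rng psi_hom) psi_p unitUP.
Qed.

Let rnorm_descend f : V' f -> exists2 phi : G -> R, (forall x, rnorm (f x) = phi (p' x)) &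
  (forall x, rnorm (f (psi x)) = phi (p x)).
Proof.
move=> [_ feq]; have [s sp] := twist_section tw'.
have H x : rnorm (f x) = rnorm (f (s (p' x))).
  have [a ->] := twist_fiber tw' (esym (sp (p' x))).
  by rewrite feq rnormM rnorm_cval mul1r.
by exists (fun g => rnorm (f (s g))) => // x; rewrite H psi_p.
Qed.

Let rnorm_comp_continuous (X : topologicalType) (f : X -> C) : continuous f ->
  continuous (fun x => rnorm (f x)).
Proof. by move=> cf x; exact: (cvg_comp _ _ (cf x) (@rnorm_continuous R C (f x))). Qed.

Lemma pullback_I_norm f : V' f -> I_norm mu (f \o psi) = I_norm mu' f.
Proof.
move=> Vf; have [[cf _] _] := Vf; have [[cf' _] _] := pullback_Cc_twist Vf.
have [phi fphi fphi'] := rnorm_descend Vf.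
have cn := rnorm_comp_continuous cf; have cn' := rnorm_comp_continuous cf'.
have n0 x : 0 <= rnorm (f x) by exact: rnorm_ge0.
have E1 u := integral_descend Gam_compact lam_haar G_hausdorff G_locally_compact lambda_haar
  tw mu_induced u cn' (fun x => n0 (psi x)) fphi'.
have E2 u := integral_descend Gam'_compact lam'_haar G_hausdorff G_locally_compact lambda_haar
  tw' mu'_induced u cn n0 fphi.
have E3 u := src_integral_descend Gam_compact lam_haar G_hausdorff G_locally_compact lambda_haar
  tw mu_induced u cn' (fun x => n0 (psi x)) fphi'.
have E4 u := src_integral_descend Gam'_compact lam'_haar G_hausdorff G_locally_compact lambda_haar
  tw' mu'_induced u cn n0 fphi.
rewrite /I_norm; congr maxe; congr esup0; apply/seteqP; split => _ [u _ <-].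
- by have [u' uu'] := units' u; exists u' => //; rewrite E3 E4 uu'.
- by have [u' uu'] := units u; exists u' => //; rewrite E3 E4 uu'.
- by have [u' uu'] := units' u; exists u' => //; rewrite E1 E2 uu'.
- by have [u' uu'] := units u; exists u' => //; rewrite E1 E2 uu'.
Qed.

Lemma pullback_norm2 (u : unit_space S) (u' : unit_space S') f : rngU (p (\val u)) = rngU (p' (\val u')) -> V' f ->
  norm2 (mu_src mu u) (f \o psi) = norm2 (mu_src mu' u') f.
Proof.
move=> uu' Vf; have [[cf _] _] := Vf; have [[cf' _] _] := pullback_Cc_twist Vf.
have [phi fphi fphi'] := rnorm_descend Vf.
rewrite (norm2_descend Gam_compact lam_haar G_hausdorff G_locally_compact lambda_haar tw mu_induced u cf' fphi').
by rewrite (norm2_descend Gam'_compact lam'_haar G_hausdorff G_locally_compact lambda_haar tw' mu'_induced u' cf fphi) uu'.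
Qed.

Variable F : (S -> C) -> (S' -> C).
Hypothesis F_Cc_twist : forall f, V f -> V' (F f).
Hypothesis FK : forall f, V f -> F f \o psi = f.
Hypothesis pullbackK : forall f, V' f -> F (f \o psi) = f.

(** At units over the same unit of [G], the suprema over equivariant functions coincide, so
    finiteness holds on both sides or on neither. *)
Lemma pullback_reduced_norm f : V' f -> reduced_norm mu (f \o psi) = reduced_norm mu' f.
Proof.
move=> Vf.
rewrite (twist_reduced_normE Gam_hausdorff Gam_compact lam_haar G_hausdorff G_locally_compact
  lambda_haar tw mu_induced chi_character (pullback_Cc_twist Vf)).
rewrite (twist_reduced_normE Gam'_hausdorff Gam'_compact lam'_haar G_hausdorff G_locally_compact
  lambda_haar tw' mu'_induced chi'_character Vf).
have H (u : unit_space S) (u' : unit_space S') : rngU (p (\val u)) = rngU (p' (\val u')) ->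
    ereal_sup [set norm2 (mu_src mu u) (conv mu (f \o psi) g) |
      g in [set g | V g /\ (norm2 (mu_src mu u) g <= 1)%E]] =
    ereal_sup [set norm2 (mu_src mu' u') (conv mu' f g) |
      g in [set g | V' g /\ (norm2 (mu_src mu' u') g <= 1)%E]].
  move=> uu'; have cV g : V' g -> V' (conv mu' f g).
    by move=> Vg; apply: (Cc_twist_conv Gam'_hausdorff Gam'_compact lam'_haar G_hausdorff
      G_locally_compact lambda_haar tw' mu'_induced).
  congr ereal_sup; apply/seteqP; split => _ [g [Vg g1] <-].
    have VFg := F_Cc_twist Vg; rewrite -(FK Vg) in g1 *.
    exists (F g); first by split => //; rewrite -(pullback_norm2 uu').
    by rewrite -pullback_conv// (pullback_norm2 uu')//; exact: cV.
  exists (g \o psi).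
    by split; [exact: pullback_Cc_twist|rewrite (pullback_norm2 uu')].
  by rewrite -pullback_conv// (pullback_norm2 uu')//; exact: cV.
congr esup0; apply/seteqP; split => e [u [fin eE]].
- by have [u' uu'] := units' u; exists u'; rewrite -(H _ _ uu').
- by have [u' uu'] := units u; exists u'; rewrite (H _ _ uu').
Qed.

(** The algebraic identities for [F] follow formally, since it inverts the pullback, which respects
    the operations. *)
Lemma pullback_inverse_star_morphism : star_morphism mu mu' V V' F.
Proof.
split=> //.
- move=> a f g Vf Vg; rewrite -[in LHS](FK Vf) -[in LHS](FK Vg).
  by apply: (pullbackK (f := fun x => a * F f x + F g x)); apply: (Cc_twistDZ tw'); exact: F_Cc_twist.
- move=> f g Vf Vg; have VFf := F_Cc_twist Vf; have VFg := F_Cc_twist Vg.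
  rewrite -[in LHS](FK Vf) -[in LHS](FK Vg) -pullback_conv// pullbackK//.
  exact: (Cc_twist_conv Gam'_hausdorff Gam'_compact lam'_haar G_hausdorff
    G_locally_compact lambda_haar tw' mu'_induced).
- move=> f Vf; rewrite -[in LHS](FK Vf) -pullback_gstar pullbackK//.
  by apply: (Cc_twist_star tw' chi'_character); exact: F_Cc_twist.
Qed.

Lemma pullback_star_isomorphic N N' (A A' : cstar_algebra R) j j' :
  (forall f, V f -> N f = N' (F f)) ->
  is_completion mu V N (A := A) j -> is_completion mu' V' N' (A := A') j' -> star_isomorphic A A'.
Proof.
apply: completions_isomorphic; first exact: pullback_inverse_star_morphism.
- by move=> f Vf; exists (f \o psi); [exact: pullback_Cc_twist|exact: pullbackK].
- exact: (Cc_twistDZ tw).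
- exact: (Cc_twist_conv Gam_hausdorff Gam_compact lam_haar G_hausdorff
    G_locally_compact lambda_haar tw mu_induced).
- exact: (Cc_twist_star tw chi_character).
Qed.

Lemma full_cstar_isomorphic (A A' : cstar_algebra R) :
  is_full_cstar iota p mu chi A -> is_full_cstar iota' p' mu' chi' A' -> star_isomorphic A A'.
Proof.
move=> [j jP] [j' j'P]; apply: (pullback_star_isomorphic _ jP j'P) => f Vf.
apply/eqP; rewrite eq_le; apply/andP; split.
  by apply: (full_norm_le pullback_star_morphism pullback_I_norm); exact: FK.
have FI g : V g -> I_norm mu' (F g) = I_norm mu g.
  by move=> Vg; rewrite -pullback_I_norm ?FK//; exact: F_Cc_twist.
have FKF : F (F f \o psi) = F f by rewrite FK.
by have := full_norm_le (F := fun g => g \o psi) pullback_inverse_star_morphism FI FKF; rewrite FK.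
Qed.

Lemma reduced_cstar_isomorphic (A A' : cstar_algebra R) :
  is_reduced_cstar iota p mu chi A -> is_reduced_cstar iota' p' mu' chi' A' ->
  star_isomorphic A A'.
Proof.
move=> [j jP] [j' j'P]; apply: (pullback_star_isomorphic _ jP j'P) => f Vf.
by rewrite -pullback_reduced_norm ?FK//; exact: F_Cc_twist.
Qed.

End comparison.

(** * Equivariant functions on the pushout *)

Section pushout_functions.
Variables (R : realType) (Gam : topologicalZmodType).
Hypothesis Gam_compact : compact [set: Gam].
Variables (chi : Gam -> circle R) (chi_character : is_character chi).
Variables (G S : topologicalGroupoidType).
Variables (iota : trivial_bundle G Gam -> S) (p : S -> G).
Hypothesis tw : gamma_twist iota p.
Local Notation C := (R[i]^o).
Local Notation T := (circle R).
Local Notation act := (twist_act iota p).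
Local Notation push := (push chi_character tw).
Local Notation S' := (pushout chi_character tw).
Local Notation push_iota := (push_iota chi_character tw).
Local Notation push_p := (push_p chi_character tw).
Local Notation V := (Cc_twist iota p chi).
Local Notation V' := (Cc_twist push_iota push_p (id : T -> circle R)).

Definition push_unit (x : S) : S' := push (0, x).

Lemma push_unit_continuous : continuous push_unit.
Proof.
move=> x; apply: continuous_comp; last exact: push_continuous.
by apply: (@cvg_pair _ _ _ _ (nbhs (0 : T)) (nbhs x)); [exact: cvg_cst|exact: cvg_id].
Qed.

Lemma push_unit_hom : groupoid_hom push_unit.
Proof.
move=> x y xy; split; first exact/push_composable.
by rewrite [RHS]push_mulE// addr0.
Qed.

Lemma push_unit_p x : push_p (push_unit x) = p x.
Proof. exact: push_pE. Qed.

Lemma push_unit_act a x :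
  push_unit (act a x) = twist_act push_iota push_p (chi a) (push_unit x).
Proof. by rewrite /push_unit push_twist_act push_act add0r addr0. Qed.

(** Equivariance of [f] compensates the choice of representative; [push_funE] gives the value on any
    other one. *)
Definition push_fun (f : S -> C) : S' -> C := fun x =>
  cval (push_repr x).1 * f (push_repr x).2.

Lemma push_funE f z x : V f -> push_fun f (push (z, x)) = cval z * f x.
Proof.
move=> [_ feq]; rewrite /push_fun; have [a ->] := push_reprP chi_character tw z x.
by rewrite /= feq mulrA -cvalD subrK.
Qed.

Lemma push_fun_Cc_twist f : V f -> V' (push_fun f).
Proof.
move=> Vf; have [[cf cK] feq] := Vf; split; last first.
  move=> a x; elim/(@push_ind _ _ _ chi_character): x => z x.
  by rewrite push_twist_act !push_funE// cvalD mulrA.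
pose K := closure [set x | f x != 0].
have hS' : hausdorff_space S' := @pushout_hausdorff _ _ Gam_compact _ chi_character _ _ _ _ tw.
apply: (@Cc_compact_support R S' hS' (push_fun f) (push @` ([set: T] `*` K))).
- apply: push_comp_continuous; rewrite (_ : _ \o _ = (fun x : T * S => (cval x.1 : C) * f x.2)); last first.
    by apply/funext => -[z x]; exact: push_funE.
  move=> [z x]; apply: cvgM.
    have c1 : (fun q : T * S => q.1) @ (z, x) --> z by exact: cvg_fst.
    exact: (cvg_comp _ _ c1 (@cval_continuous R z)).
  have c2 : (fun q : T * S => q.2) @ (z, x) --> x by exact: cvg_snd.
  exact: (cvg_comp _ _ c2 (cf x)).
- apply: continuous_image_compact; first exact: push_continuous.
  by apply: compact_setX => //; exact: circle_compact.
- move=> x; elim/(@push_ind _ _ _ chi_character): x => z x nx.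
  by rewrite push_funE// (Cc_eq0 (f := f)) ?mulr0// => Kx; apply: nx; exists (z, x).
Qed.

Lemma push_funK f : V f -> push_fun f \o push_unit = f.
Proof. by move=> Vf; apply/funext => x; rewrite /= push_funE// cval0 mul1r. Qed.

Lemma push_unit_funK f : V' f -> push_fun (f \o push_unit) = f.
Proof.
move=> [_ feq]; apply/funext => x; rewrite -[x in RHS](push_reprK x).
rewrite /push_fun; case: (push_repr x) => z y /=.
by rewrite /push_unit -feq push_twist_act addr0.
Qed.

End pushout_functions.

Arguments push_fun {R Gam chi} chi_character {G S iota p} tw f x.

Theorem corollary6p5 (R : realType)
    (Gam : topologicalZmodType)
    (Gam_hausdorff : hausdorff_space Gam)
    (Gam_compact : compact [set: Gam])
    (lam : borel_measure R (0 : Gam)) (lam_haar : normalised_haar lam)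
    (lamT : borel_measure R (0 : circle R)) (lamT_haar : normalised_haar lamT)
    (G : topologicalGroupoidType)
    (G_hausdorff : hausdorff_space G)
    (G_locally_compact : locally_compact [set: G])
    (lambda : measure_family R G) (lambda_haar : haar_system lambda)
    (S : topologicalGroupoidType)
    (iota : trivial_bundle G Gam -> S) (p : S -> G)
    (S_twist : gamma_twist iota p)
    (mu : measure_family R S) (mu_induced : induced_haar_system iota p lam lambda mu)
    (chi : Gam -> circle R) (chi_character : is_character chi) :
  exists (S' : topologicalGroupoidType)
         (iota' : trivial_bundle G (circle R) -> S') (p' : S' -> G),
    gamma_twist iota' p' /\
    forall mu' : measure_family R S',
      induced_haar_system iota' p' lamT lambda mu' ->
      (forall A A' : cstar_algebra R,
          is_full_cstar iota p mu chi A ->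
          is_full_cstar iota' p' mu' id A' ->
          star_isomorphic A A') /\
      (forall A A' : cstar_algebra R,
          is_reduced_cstar iota p mu chi A ->
          is_reduced_cstar iota' p' mu' id A' ->
          star_isomorphic A A').
Proof.
have tw' := pushout_twist Gam_compact chi_character S_twist.
exists (pushout chi_character S_twist), (push_iota chi_character S_twist),
  (push_p chi_character S_twist).
split=> // mu' mu'_induced.
have hT := @circle_hausdorff R; have cT := @circle_compact R.
have id_char : is_character (id : circle R -> circle R) by split=> // z; exact: cvg_id.
pose psi := push_unit chi_character S_twist; pose F := push_fun chi_character S_twist.
have psi_c : continuous psi by exact: push_unit_continuous.
have psi_h : groupoid_hom psi by exact: push_unit_hom.
have psi_p := push_unit_p chi_character S_twist.
have psi_a a x : psi (twist_act iota p a x) = twist_act (push_iota chi_character S_twist)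
  (push_p chi_character S_twist) (chi a) (psi x) by exact: push_unit_act.
have FV f := @push_fun_Cc_twist _ _ Gam_compact _ chi_character _ _ _ _ S_twist f.
have FK f (Vf : Cc_twist iota p chi f) : F f \o psi = f := push_funK chi_character S_twist Vf.
have psiK f := @push_unit_funK _ _ _ chi_character _ _ _ _ S_twist f.
(* The comparison is used with [chi] as the map of groups and the identity as second character, so
   the compatibility of characters holds by computation. *)
split.
- exact: (full_cstar_isomorphic Gam_hausdorff Gam_compact lam_haar hT cT lamT_haar G_hausdorff G_locally_compact
    lambda_haar S_twist mu_induced tw' mu'_induced chi_character id_char psi_c psi_h psi_p
    psi_a (fun=> erefl) FV FK psiK).
- exact: (reduced_cstar_isomorphic Gam_hausdorff Gam_compact lam_haar hT cT lamT_haar G_hausdorff G_locally_compact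
    lambda_haar S_twist mu_induced tw' mu'_induced chi_character id_char psi_c psi_h psi_p
    psi_a (fun=> erefl) FV FK psiK).
Qed.
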